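(* There is an absolute constant $C>0$ such that the following holds. Let $K\subset\mathbb{R}^n$ be a proper cone admitting a $\nu$-LHSCB $F$, and let $A\in\mathbb{R}^{m\times n}$, $b\in\mathbb{R}^m$, $c\in\mathbb{R}^n$. Let $z_0=(y_0,x_0,\tau_0,s_0,\kappa_0)$ be a starting point with $x_0\in\operatorname{int}K$, $s_0\in\operatorname{int}K^*$ and $$x_0=s_0=-F'(x_0)=-F_*'(s_0),\qquad y_0=0,\qquad \tau_0=\kappa_0=1.$$ Run the Algorithm described in the context from $z_0$ with parameters $\alpha=\frac{1}{100\nu}$ and $\gamma=0.9$. Then for every $\varepsilon\in(0,1)$, within at most $\lceil C\,\nu\log(1/\varepsilon)\rceil$ iterations (that is, in $O(\nu\log(1/\varepsilon))$ iterations) the Algorithm produces a point $z=(y,x,\tau,s,\kappa)\in\mathbb{R}^m\times K\times\mathbb{R}_+\times K^*\times\mathbb{R}_+$ satisfying $$\mu^{e}\le\varepsilon\qquad\text{and}\qquad \|G(z)\|\le\varepsilon\,\|G(z_0)\|,$$ where $\mu^e=\frac{\langle x,s\rangle+\tau\kappa}{\nu+1}$.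
   Context: Notation: $\langle\cdot,\cdot\rangle$ is the dot product and $\|\cdot\|$ the Euclidean norm. A proper cone is a convex, pointed, closed, full-dimensional cone. The dual cone is $K^*=\{s\in\mathbb{R}^n:\langle x,s\rangle\ge 0\ \forall x\in K\}$. A $\nu$-LHSCB (logarithmically homogeneous self-concordant barrier with parameter $\nu$) for $K$ is a thrice differentiable, strictly convex function $F:\operatorname{int}K\to\mathbb{R}$ such that, with $\|v\|_x:=\sqrt{\langle v,F''(x)v\rangle}$: (1) $F(tx)=F(x)-\nu\log t$ for all $t>0$, $x\in\operatorname{int}K$; (2) for all $x\in\operatorname{int}K$, $\{x':\|x'-x\|_x<1\}\subseteq\operatorname{int}K$; (3) $(1-\|x'-x\|_x)^2F''(x')\preceq F''(x)\preceq(1-\|x'-x\|_x)^{-2}F''(x')$ for all $x,x'\in\operatorname{int}K$ with $\|x'-x\|_x<1$ (Löwner order). It is known that $\nu\ge1$. The conjugate barrier $F_*:\operatorname{int}K^*\to\mathbb{R}$, $F_*(s):=\sup\{-\langle s,x\rangle-F(x):x\in\operatorname{int}K\}$, is a $\nu$-LHSCB for $K^*$. For $x\in\operatorname{int}K$, $s\in\operatorname{int}K^*$ put $\tilde x:=-F_*'(s)$, $\tilde s:=-F'(x)$, $\mu:=\langle x,s\rangle/\nu$, $\tilde\mu:=\langle\tilde x,\tilde s\rangle/\nu$, $\delta^P:=x-\mu\tilde x$, $\delta^D:=s-\mu\tilde s$. Linear operator: for $z=(y,x,\tau,s,\kappa)$, $$G(z):=\big(Ax-b\tau,\; -A^\top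 y+c\tau-s,\; b^\top y-c^\top x-\kappa\big).$$ Scaling matrix at $(x,s)$: $$W:=\mu F''(x)+\frac{ss^\top}{\nu\mu}-\frac{\mu\tilde s\tilde s^\top}{\nu}+\frac{\delta^D(\delta^D)^\top}{\langle\delta^P,\delta^D\rangle}-\frac{\mu[F''(x)\tilde x-\tilde\mu\tilde s][F''(x)\tilde x-\tilde\mu\tilde s]^\top}{\|\tilde x\|_x^2-\nu\tilde\mu^2},$$ where the last two terms are read as zero when $x=\mu\tilde x$ (the only case in which their denominators vanish). Algorithm with parameters $\alpha\in(0,1]$, $\gamma\in[0,1]$. Start with $z=z_0$. One iteration from the current $z=(y,x,\tau,s,\kappa)$ consists of: 1. Compute $W$ at $(x,s)$. Let $\Delta z^{\mathrm{aff}}$ solve $G(\Delta z^{\mathrm{aff}})=-G(z)$, $\tau\Delta\kappa^{\mathrm{aff}}+\kappa\Delta\tau^{\mathrm{aff}}=-\tau\kappa$, $W\Delta x^{\mathrm{aff}}+\Delta s^{\mathrm{aff}}=-s$. Let $\Delta z^{\mathrm{cen}}$ solve $G(\Delta z^{\mathrm{cen}})=G(z)$, $\tau\Delta\kappa^{\mathrm{cen}}+\kappa\Delta\tau^{\mathrm{cen}}=\mu^e$, $W\Delta x^{\mathrm{cen}}+\Delta s^{\mathrm{cen}}=\mu^e\tilde s$, where $\mu^e=\frac{\langle x,s\rangle+\tau\kappa}{\nu+1}$. 2. Set $z_+:=z+\alpha(\Delta z^{\mathrm{aff}}+\gamma\Delta z^{\mathrm{cen}})$. Write $\mu_+,\tilde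 s_+,\dots$ for the quantities above computed at $z_+$, and let $W_+$ be the scaling matrix at $(x_+,s_+)$. 3. Let $\Delta z_+^{\mathrm{cor}}$ solve $G(\Delta z_+^{\mathrm{cor}})=0$, $\tau_+\Delta\kappa_+^{\mathrm{cor}}+\kappa_+\Delta\tau_+^{\mathrm{cor}}=0$, $W_+\Delta x_+^{\mathrm{cor}}+\Delta s_+^{\mathrm{cor}}=\mu_+\tilde s_+-s_+$. 4. Replace $z$ by $z_{++}:=z_++\Delta z_+^{\mathrm{cor}}$. *)

(* Defs.v *)
From HB Require Import structures.
From mathcomp Require Import all_boot all_order all_algebra.
From mathcomp Require Import all_classical all_reals all_analysis.
Set Implicit Arguments.
Unset Strict Implicit.
Unset Printing Implicit Defensive.
Import Order.TTheory GRing.Theory Num.Theory.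
Import numFieldNormedType.Exports.
Local Open Scope classical_set_scope.
Local Open Scope ring_scope.

(* MathComp-Analysis over an abstract realType R. R^n is 'cV[R]_n. Its library norm is the sup norm,
   which induces the usual topology and notion of differentiability; Euclidean
   lengths are given by enorm. *)

Definition dot (R : realType) (n : nat) (u v : 'cV[R]_n) : R :=
  \sum_i u i 0 * v i 0.

Definition enorm (R : realType) (n : nat) (u : 'cV[R]_n) : R :=
  Num.sqrt (dot u u).

Definition outer (R : realType) (n : nat) (u : 'cV[R]_n) : 'M[R]_n :=
  u *m u^T.

Definition gradient (R : realType) (n : nat) (F : 'cV[R]_n -> R)
    (x : 'cV[R]_n) : 'cV[R]_n :=
  \col_i 'D_(delta_mx i 0) F x.

Definition hessian (R : realType) (n : nat) (F : 'cV[R]_n -> R)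
    (x : 'cV[R]_n) : 'M[R]_n :=
  \matrix_(i, j) 'D_(delta_mx j 0) (fun y => gradient F y i 0) x.

Definition loewner_le (R : realType) (n : nat) (M N : 'M[R]_n) : Prop :=
  forall v : 'cV[R]_n, 0 <= dot v ((N - M) *m v).

Definition proper_cone (R : realType) (n : nat) (K : set 'cV[R]_n) : Prop :=
  [/\ forall (t : R) (x : 'cV[R]_n), 0 <= t -> K x -> K (t *: x),
      convex_set (K : set (convex_lmodType 'cV[R]_n)),
      forall x : 'cV[R]_n, K x -> K (- x) -> x = 0,
      closed K
    & K° !=set0].

Definition dual_cone (R : realType) (n : nat) (K : set 'cV[R]_n) :
    set 'cV[R]_n :=
  [set s | forall x, K x -> 0 <= dot x s].

(* Barriers are total functions of which only the values on the interior of
   the cone are meaningful; that set being open, these values determine the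
   derivatives there. *)
Definition thrice_differentiable_on (R : realType) (n : nat)
    (D : set 'cV[R]_n) (F : 'cV[R]_n -> R) : Prop :=
  forall x, D x -> [/\ differentiable F x, differentiable (gradient F) x
                     & differentiable (hessian F) x].

Definition strictly_convex_on (R : realType) (n : nat)
    (D : set 'cV[R]_n) (F : 'cV[R]_n -> R) : Prop :=
  forall (x y : 'cV[R]_n) (t : R), D x -> D y -> x != y -> 0 < t -> t < 1 ->
    F (t *: x + (1 - t) *: y) < t * F x + (1 - t) * F y.

Definition local_norm (R : realType) (n : nat) (F : 'cV[R]_n -> R)
    (x v : 'cV[R]_n) : R :=
  Num.sqrt (dot v (hessian F x *m v)).

Record lhscb (R : realType) (n : nat) (K : set 'cV[R]_n) (nu : R)
    (F : 'cV[R]_n -> R) : Prop := Lhscb {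
  lhscb_differentiable : thrice_differentiable_on K° F ;
  lhscb_strictly_convex : strictly_convex_on K° F ;
  lhscb_log_homogeneous : forall (t : R) (x : 'cV[R]_n),
    0 < t -> K° x -> F (t *: x) = F x - nu * ln t ;
  lhscb_dikin : forall x x' : 'cV[R]_n,
    K° x -> local_norm F x (x' - x) < 1 -> K° x' ;
  lhscb_self_concordant : forall x x' : 'cV[R]_n, K° x -> K° x' ->
    local_norm F x (x' - x) < 1 ->
    loewner_le ((1 - local_norm F x (x' - x)) ^+ 2 *: hessian F x')
               (hessian F x) /\
    loewner_le (hessian F x)
               ((1 - local_norm F x (x' - x)) ^- 2 *: hessian F x')
}.

(* The real-valued sup is 0 on unbounded sets; the set below is bounded above
   for s in the interior of the dual cone, the only case of interest. *)
Definition conjugate (R : realType) (n : nat) (K : set 'cV[R]_n)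
    (F : 'cV[R]_n -> R) (s : 'cV[R]_n) : R :=
  sup [set - dot s x - F x | x in K°].

Definition xtilde (R : realType) (n : nat) (K : set 'cV[R]_n)
    (F : 'cV[R]_n -> R) (s : 'cV[R]_n) : 'cV[R]_n :=
  - gradient (conjugate K F) s.

Definition stilde (R : realType) (n : nat) (F : 'cV[R]_n -> R)
    (x : 'cV[R]_n) : 'cV[R]_n :=
  - gradient F x.

Definition mu (R : realType) (n : nat) (nu : R) (x s : 'cV[R]_n) : R :=
  dot x s / nu.

Definition scaling_matrix (R : realType) (n : nat) (K : set 'cV[R]_n) (nu : R)
    (F : 'cV[R]_n -> R) (x s : 'cV[R]_n) : 'M[R]_n :=
  let xt := xtilde K F s in
  let st := stilde F x in
  let m := mu nu x s in
  let mt := mu nu xt st in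
  let dP := x - m *: xt in
  let dD := s - m *: st in
  let w := hessian F x *m xt - mt *: st in
  m *: hessian F x + (nu * m)^-1 *: outer s - (m / nu) *: outer st
  + (if x == m *: xt then 0 else
       (dot dP dD)^-1 *: outer dD
       - (m / (local_norm F x xt ^+ 2 - nu * mt ^+ 2)) *: outer w).

(* z = (y, x, tau, s, kappa); R^o makes the product a left R-module. *)
Definition hsd_point (R : realType) (m n : nat) : Type :=
  ('cV[R]_m * 'cV[R]_n * R^o * 'cV[R]_n * R^o)%type.

Definition py (R : realType) (m n : nat) (z : hsd_point R m n) : 'cV[R]_m :=
  z.1.1.1.1.
Definition px (R : realType) (m n : nat) (z : hsd_point R m n) : 'cV[R]_n :=
  z.1.1.1.2.
Definition ptau (R : realType) (m n : nat) (z : hsd_point R m n) : R := z.1.1.2.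
Definition ps (R : realType) (m n : nat) (z : hsd_point R m n) : 'cV[R]_n := z.1.2.
Definition pkappa (R : realType) (m n : nat) (z : hsd_point R m n) : R := z.2.

Definition G (R : realType) (m n : nat) (A : 'M[R]_(m, n)) (b : 'cV[R]_m)
    (c : 'cV[R]_n) (z : hsd_point R m n) : 'cV[R]_(m + (n + 1)) :=
  col_mx (A *m px z - ptau z *: b)
    (col_mx (- (A^T *m py z) + ptau z *: c - ps z)
            (dot b (py z) - dot c (px z) - pkappa z)%:M).

Definition mue (R : realType) (m n : nat) (nu : R) (z : hsd_point R m n) : R :=
  (dot (px z) (ps z) + ptau z * pkappa z) / (nu + 1).

(* dz is a search direction at z for the scaling matrix W, with right-hand
   sides rG, rt and rs. It need not be unique: dz.y is determined only up to
   vectors y with A^T y = 0 and b^T y = 0. *)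
Definition direction (R : realType) (m n : nat) (A : 'M[R]_(m, n))
    (b : 'cV[R]_m) (c : 'cV[R]_n) (W : 'M[R]_n) (z : hsd_point R m n)
    (rG : 'cV[R]_(m + (n + 1))) (rt : R) (rs : 'cV[R]_n)
    (dz : hsd_point R m n) : Prop :=
  [/\ G A b c dz = rG,
      ptau z * pkappa dz + pkappa z * ptau dz = rt
    & W *m px dz + ps dz = rs].

Definition cone_interior (R : realType) (m n : nat) (K : set 'cV[R]_n)
    (z : hsd_point R m n) : Prop :=
  K° (px z) /\ (dual_cone K)° (ps z).

(* The two halves of an iteration. They are relations, since directions may be
   non-unique, and they require the point at which barrier derivatives are
   evaluated to lie in the domain of the barriers. *)
Definition predictor_step (R : realType) (m n : nat) (K : set 'cV[R]_n) (nu : R)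
    (F : 'cV[R]_n -> R) (A : 'M[R]_(m, n)) (b : 'cV[R]_m) (c : 'cV[R]_n)
    (alpha gamma : R) (z zp : hsd_point R m n) : Prop :=
  let W := scaling_matrix K nu F (px z) (ps z) in
  cone_interior K z /\
  exists daff dcen : hsd_point R m n,
    [/\ direction A b c W z (- G A b c z) (- (ptau z * pkappa z)) (- ps z) daff,
        direction A b c W z (G A b c z) (mue nu z)
          (mue nu z *: stilde F (px z)) dcen
      & zp = z + alpha *: (daff + gamma *: dcen)].

Definition corrector_step (R : realType) (m n : nat) (K : set 'cV[R]_n) (nu : R)
    (F : 'cV[R]_n -> R) (A : 'M[R]_(m, n)) (b : 'cV[R]_m) (c : 'cV[R]_n)
    (zp zpp : hsd_point R m n) : Prop :=
  let W := scaling_matrix K nu F (px zp) (ps zp) in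
  cone_interior K zp /\
  exists dcor : hsd_point R m n,
    direction A b c W zp 0 0
      (mu nu (px zp) (ps zp) *: stilde F (px zp) - ps zp) dcor /\
    zpp = zp + dcor.

Definition iteration (R : realType) (m n : nat) (K : set 'cV[R]_n) (nu : R)
    (F : 'cV[R]_n -> R) (A : 'M[R]_(m, n)) (b : 'cV[R]_m) (c : 'cV[R]_n)
    (alpha gamma : R) (z zpp : hsd_point R m n) : Prop :=
  exists zp : hsd_point R m n,
    predictor_step K nu F A b c alpha gamma z zp /\
    corrector_step K nu F A b c zp zpp.

Fixpoint iterate (R : realType) (m n : nat) (K : set 'cV[R]_n) (nu : R)
    (F : 'cV[R]_n -> R) (A : 'M[R]_(m, n)) (b : 'cV[R]_m) (c : 'cV[R]_n)
    (alpha gamma : R) (z0 : hsd_point R m n) (k : nat) (z : hsd_point R m n) : Prop :=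
  if k is k'.+1 then
    exists2 z', iterate K nu F A b c alpha gamma z0 k' z'
              & iteration K nu F A b c alpha gamma z' z
  else z = z0.

(* The algorithm never breaks down: whichever solutions of the linear systems
   were picked so far, both halves of the next iteration can be carried out. *)
Definition never_stuck (R : realType) (m n : nat) (K : set 'cV[R]_n) (nu : R)
    (F : 'cV[R]_n -> R) (A : 'M[R]_(m, n)) (b : 'cV[R]_m) (c : 'cV[R]_n)
    (alpha gamma : R) (z0 : hsd_point R m n) : Prop :=
  forall (k : nat) (z : hsd_point R m n),
    iterate K nu F A b c alpha gamma z0 k z ->
    (exists zp, predictor_step K nu F A b c alpha gamma z zp) /\
    (forall zp, predictor_step K nu F A b c alpha gamma z zp ->
       exists zpp, corrector_step K nu F A b c zp zpp).

Definition is_run (R : realType) (m n : nat) (K : set 'cV[R]_n) (nu : R)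
    (F : 'cV[R]_n -> R) (A : 'M[R]_(m, n)) (b : 'cV[R]_m) (c : 'cV[R]_n)
    (alpha gamma : R) (z0 : hsd_point R m n) (z : nat -> hsd_point R m n) : Prop :=
  z 0%N = z0 /\
  forall k : nat, iteration K nu F A b c alpha gamma (z k) (z k.+1).

(* Main.v *)
(* Let rho = 1 / (500 sqrt nu).  An iterate is good when s = - m F'(y) with
   m = <x, s> / nu for some y within rho of x in the norm of F''(x), and
   |tau kappa - mu^e| <= mu^e / 50.  For such s the maximum defining the
   conjugate is attained at y / m, so the shadow iterate xtilde is y / m; no
   global theory of F_* is needed, as points y of this kind are found by
   minimising <s, .> + F over a Dikin ellipsoid.  Near the central path W
   differs from m F''(x) by at most 9 rho m F''(x).  The skew-symmetry of G makes
   <dx, ds> + dtau dkappa vanish on G(d) = 0, for d the corrector direction and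
   for d the predictor direction plus z / 10.  Hence a predictor step multiplies
   both mu^e and G(z) by exactly 1 - 1 / (1000 nu), and a corrector step leaves
   them unchanged.  The predictor direction has local norm O(sqrt nu), so with
   the step length 1 / (100 nu) the distance of x to y grows to at most
   1.05 / (100 sqrt nu); the corrector is an approximate Newton step and brings
   it back quadratically, below rho.  So all iterates are good, and
   ceil(1000 nu log (1 / eps)) iterations suffice. *)
Require Import Defs.
From HB Require Import structures.
From mathcomp Require Import all_boot all_order all_algebra.
From mathcomp Require Import all_classical all_reals all_analysis.
From mathcomp Require Import ring lra.
Set Implicit Arguments.
Unset Strict Implicit.
Unset Printing Implicit Defensive.
Import Order.TTheory GRing.Theory Num.Theory.
Import numFieldNormedType.Exports.
Local Open Scope classical_set_scope.
Local Open Scope ring_scope.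

(** * Quadratic forms and derivatives along lines *)

(** The obstacle is [W]: its last two terms have denominators that vanish on the central path, and
    near the path each is a rank-one matrix comparable to m F''(x). Put p = x - y, e = F'(x) -
    F'(y), H = F''(x), and let q be p without its component along x. Up to the factor m the two
    terms are e e^T / <p, e> and - (H q)(H q)^T / <q, H q>. Self-concordance gives e = H p +
    O(|p|^2), so they nearly cancel. Beyond this, the steps use [W] mainly through symmetry and the
    identities W x = s and W p = s - m st with st = - F'(x). These identities write the right-hand
    side of each system as W applied to an explicit short vector, and a Pythagorean identity then
    bounds the direction. In units of 1 / sqrt nu the constants close up as follows: radius 0.002,
    dual residual 0.01 after the predictor, radius 0.0105, dual residual 0.0016 after the corrector,
    radius 0.00168. The deviation of tau kappa from mu^e needs its own balance: the predictor
    contracts it faster than mu^e, and the corrector spends the margin so gained. *)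

Section QuadraticForms.
Variables (R : realType) (n : nat).
Implicit Types (u v w : 'cV[R]_n) (M H : 'M[R]_n) (a : R).

Lemma dotC u v : dot u v = dot v u.
Proof. by apply: eq_bigr => i _; rewrite mulrC. Qed.

Lemma dotDl u v w : dot (u + v) w = dot u w + dot v w.
Proof. by rewrite -big_split; apply: eq_bigr => i _; rewrite mxE mulrDl. Qed.

Lemma dotDr u v w : dot w (u + v) = dot w u + dot w v.
Proof. by rewrite !(dotC w) dotDl. Qed.

Lemma dotZl a u v : dot (a *: u) v = a * dot u v.
Proof. by rewrite mulr_sumr; apply: eq_bigr => i _; rewrite mxE mulrA. Qed.

Lemma dotZr a u v : dot u (a *: v) = a * dot u v.
Proof. by rewrite !(dotC u) dotZl. Qed.

Lemma dotNl u v : dot (- u) v = - dot u v.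
Proof. by rewrite -scaleN1r dotZl mulN1r. Qed.

Lemma dotNr u v : dot u (- v) = - dot u v.
Proof. by rewrite !(dotC u) dotNl. Qed.

Lemma dotBl u v w : dot (u - v) w = dot u w - dot v w.
Proof. by rewrite dotDl dotNl. Qed.

Lemma dotBr u v w : dot w (u - v) = dot w u - dot w v.
Proof. by rewrite dotDr dotNr. Qed.

Lemma dot0l u : dot 0 u = 0.
Proof. by rewrite /dot big1 // => i _; rewrite mxE mul0r. Qed.

Lemma dot0r u : dot u 0 = 0.
Proof. by rewrite dotC dot0l. Qed.

Definition dotE := (dotDl, dotDr, dotBl, dotBr, dotNl, dotNr, dotZl, dotZr, dot0l, dot0r).

Lemma mulmxZl m k p a (A : 'M[R]_(m, k)) (B : 'M[R]_(k, p)) :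
  (a *: A) *m B = a *: (A *m B).
Proof. by rewrite scalemxAl. Qed.

Lemma mulmxZr m k p a (A : 'M[R]_(m, k)) (B : 'M[R]_(k, p)) :
  A *m (a *: B) = a *: (A *m B).
Proof. by rewrite scalemxAr. Qed.

Definition mulmx_linE := (@mulmxDr R, @mulmxBr R, @mulmxN R, @mulmxDl R, @mulmxBl R,
  @mulNmx R, mulmxZl, mulmxZr).

Lemma dot_delta u i : dot u (delta_mx i 0) = u i 0.
Proof.
rewrite /dot (bigD1 i) //= big1 => [|j ji]; first by rewrite mxE !eqxx mulr1 addr0.
by rewrite mxE (negPf ji) mulr0.
Qed.

Lemma dot_inj v w : (forall u, dot u v = dot u w) -> v = w.
Proof.
move=> vw; apply/matrixP => i j; rewrite (ord1 j).
by have := vw (delta_mx i 0); rewrite !(dotC (delta_mx i 0)) !dot_delta.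
Qed.

Lemma dot_mulmx_tr (m : nat) (A : 'M[R]_(m, n)) (y : 'cV[R]_m) v :
  dot y (A *m v) = dot (A^T *m y) v.
Proof.
rewrite /dot (eq_bigr (fun i => \sum_j y i 0 * A i j * v j 0)); last first.
  by move=> i _; rewrite mxE mulr_sumr; apply: eq_bigr => j _; rewrite mulrA.
rewrite exchange_big; apply: eq_bigr => j _ /=.
by rewrite mxE mulr_suml; apply: eq_bigr => i _; rewrite mxE (mulrC (A i j)).
Qed.

Lemma dot_sym M u v : M^T = M -> dot u (M *m v) = dot v (M *m u).
Proof. by move=> symM; rewrite dot_mulmx_tr symM dotC. Qed.

Lemma sym_from_dot M : (forall u v, dot u (M *m v) = dot v (M *m u)) -> M^T = M.
Proof.
move=> sM; have eqv v : M^T *m v = M *m v.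
  by apply: dot_inj => u; rewrite dot_mulmx_tr trmxK dotC sM.
apply/matrixP => i j.
have := eqv (delta_mx j 0) => /matrixP/(_ i 0).
by rewrite -!colE !mxE.
Qed.

Lemma dot_outer u v w : dot u (outer w *m v) = dot w u * dot w v.
Proof.
have wv : w^T *m v = (dot w v)%:M.
  apply/matrixP => i j; rewrite !mxE !ord1 eqxx mulr1n.
  by apply: eq_bigr => k _; rewrite mxE.
by rewrite /outer -mulmxA wv mul_mx_scalar dotZr mulrC (dotC u).
Qed.

Lemma loewner_leZl a M H v : loewner_le (a *: M) H ->
  a * dot v (M *m v) <= dot v (H *m v).
Proof. by move=> /(_ v); rewrite mulmxBl mulmxZl dotBr dotZr subr_ge0. Qed.

Lemma loewner_leZr a M H v : loewner_le M (a *: H) ->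
  dot v (M *m v) <= a * dot v (H *m v).
Proof. by move=> /(_ v); rewrite mulmxBl mulmxZl dotBr dotZr subr_ge0. Qed.

Definition qnorm H v : R := Num.sqrt (dot v (H *m v)).

Definition psd H : Prop := forall v, 0 <= dot v (H *m v).

Lemma qnorm_ge0 H v : 0 <= qnorm H v.
Proof. exact: sqrtr_ge0. Qed.

Lemma qnorm_sqr H v : psd H -> qnorm H v ^+ 2 = dot v (H *m v).
Proof. by move=> pH; rewrite sqr_sqrtr. Qed.

Lemma qnormZ H a v : qnorm H (a *: v) = `|a| * qnorm H v.
Proof.
rewrite /qnorm -scalemxAr dotZl dotZr mulrA -expr2 sqrtrM ?sqr_ge0 //.
by rewrite sqrtr_sqr.
Qed.

Lemma qnormN H v : qnorm H (- v) = qnorm H v.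
Proof. by rewrite -scaleN1r qnormZ normrN1 mul1r. Qed.

Lemma qnorm0 H : qnorm H 0 = 0.
Proof. by rewrite /qnorm dot0l sqrtr0. Qed.

(** The optimal choice is t = V / U. If U = 0 a large t, and if V = 0 a small t, contradicts B >
    0. *)
Lemma amgm_scaling (B U V c : R) : 0 <= B -> 0 <= U -> 0 <= V -> 0 <= c ->
  (forall t, 2 * t * B <= c * (t ^+ 2 * U ^+ 2 + V ^+ 2)) -> B <= c * (U * V).
Proof.
move=> B0 U0 V0 c0 main.
have [Upos|] := ltrP 0 U; last first.
  move=> Ule; have U00 : U = 0 by lra.
  rewrite U00 mul0r mulr0; rewrite leNgt; apply/negP => Bpos.
  have := main ((c * V ^+ 2 + 1) / (2 * B)).
  rewrite U00 expr0n /= mulr0 add0r.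
  have -> : 2 * ((c * V ^+ 2 + 1) / (2 * B)) * B = c * V ^+ 2 + 1 by field; lra.
  by lra.
have := main (V / U).
have -> : 2 * (V / U) * B = 2 * (V * B) / U by field; lra.
have -> : c * ((V / U) ^+ 2 * U ^+ 2 + V ^+ 2) = 2 * c * V ^+ 2 by field; lra.
rewrite ler_pdivrMr // => h.
have [Vpos|Vle] := ltrP 0 V; first by nra.
have V00 : V = 0 by lra.
have hh t : 0 < t -> 2 * B <= c * (t * U ^+ 2).
  move=> t0; have := main t; rewrite V00 expr0n /= addr0 => m.
  rewrite -(ler_pM2l t0); lra.
rewrite V00 !mulr0 leNgt; apply/negP => Bpos.
have cU : 0 <= c * U ^+ 2 by rewrite mulr_ge0 // sqr_ge0.
have := hh (B / (c * U ^+ 2 + 1)) ltac:(by rewrite divr_gt0 //; lra).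
have -> : c * (B / (c * U ^+ 2 + 1) * U ^+ 2) = (c * U ^+ 2 * B) / (c * U ^+ 2 + 1).
  by field; lra.
by rewrite ler_pdivlMr; nra.
Qed.

(** 4 t <u, M v> is the difference of the forms of M at t u + v and t u - v, while the forms of H at
    these two points add up to 2 (t^2 |u|^2 + |v|^2); t is then optimised. A bound on a possibly
    indefinite form thus passes to the bilinear form with the same constant. The case M = H is
    Cauchy-Schwarz. *)
Lemma polarization_bound M H (c : R) u v : psd H -> M^T = M -> 0 <= c ->
  (forall w, `|dot w (M *m w)| <= c * dot w (H *m w)) ->
  `|dot u (M *m v)| <= c * (qnorm H u * qnorm H v).
Proof.
move=> pH sM c0 bM.
have main t : 2 * t * `|dot u (M *m v)| <= c * (t ^+ 2 * qnorm H u ^+ 2 + qnorm H v ^+ 2).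
  rewrite !qnorm_sqr //.
  have b1 := bM (t *: u + v); have b2 := bM (t *: u - v).
  have /ler_normlP[] := b1; have /ler_normlP[] := b2.
  rewrite !(mulmx_linE, dotE) (dot_sym v u sM) => {b1 b2} b1 b2 b3 b4.
  by case: (ger0P (dot u (M *m v))) => s; lra.
by apply: amgm_scaling main; rewrite ?normr_ge0 ?qnorm_ge0.
Qed.

Section Psd.
Variable H : 'M[R]_n.
Hypotheses (symH : H^T = H) (psdH : psd H).

Lemma qnorm_CS u v : `|dot u (H *m v)| <= qnorm H u * qnorm H v.
Proof.
rewrite -[leRHS]mul1r; apply: polarization_bound => // w.
by rewrite mul1r ger0_norm.
Qed.

Lemma qnormD u v : qnorm H (u + v) <= qnorm H u + qnorm H v.
Proof.
have s0 : 0 <= qnorm H u + qnorm H v by rewrite addr_ge0 // qnorm_ge0.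
rewrite -(ler_pXn2r (_ : 0 < 2)%N) ?nnegrE ?qnorm_ge0 //.
rewrite sqrrD !qnorm_sqr // !(mulmx_linE, dotE) (dot_sym v u symH).
by have /ler_normlP[_ cs] := qnorm_CS u v; lra.
Qed.

Lemma qnormB u v : qnorm H (u - v) <= qnorm H u + qnorm H v.
Proof. by rewrite -(qnormN H v); exact: qnormD. Qed.

End Psd.

Lemma qnorm_loewner_lower (M H : 'M[R]_n) (a : R) v : psd M -> psd H -> 0 < a ->
  loewner_le (a ^+ 2 *: M) H -> a * qnorm M v <= qnorm H v.
Proof.
move=> pM pH a0 /(loewner_leZl v) h; rewrite -(ler_pXn2r (_ : 0 < 2)%N) ?nnegrE ?mulr_ge0 ?qnorm_ge0 ?(ltW a0) //.
by rewrite exprMn !qnorm_sqr.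
Qed.

Lemma qnorm_loewner_upper (M H : 'M[R]_n) (a : R) v : psd M -> psd H -> 0 < a ->
  loewner_le M (a ^- 2 *: H) -> a * qnorm M v <= qnorm H v.
Proof.
move=> pM pH a0 /(loewner_leZr v); rewrite mulrC ler_pdivlMr ?exprn_gt0 // mulrC => h.
rewrite -(ler_pXn2r (_ : 0 < 2)%N) ?nnegrE ?mulr_ge0 ?qnorm_ge0 ?(ltW a0) //.
by rewrite exprMn !qnorm_sqr.
Qed.

(** The form of M - H lies between q - 1 and q^-1 - 1 times the form of H, and 1 - q <= q^-1 - 1, so
    polarization applies. *)
Lemma loewner_bilinear_bound (M H : 'M[R]_n) (q : R) u v : psd H -> psd M ->
  H^T = H -> M^T = M -> 0 < q <= 1 -> loewner_le (q *: M) H -> loewner_le H (q^-1 *: M) ->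
  `|dot u ((M - H) *m v)| <= (q^-1 - 1) * (qnorm H u * qnorm H v).
Proof.
move=> pH pM sH sM /andP[q0 q1] qM qH.
apply: polarization_bound => //; first by rewrite linearB /= sH sM.
  by rewrite subr_ge0 invf_ge1.
move=> w; rewrite mulmxBl dotBr.
move: (loewner_leZl w qM) (loewner_leZr w qH) (pH w) (pM w).
move: (dot w (H *m w)) (dot w (M *m w)) => {sH sM pH pM qM qH} X Y h1 h2 X0 Y0.
have XY : Y <= q^-1 * X by rewrite mulrC ler_pdivlMr // mulrC.
apply/ler_normlP; split; last lra.
have := ler_wpM2l (ltW q0) h2; rewrite mulrA mulfV ?mul1r ?lt0r_neq0 // => h3.
have : 0 <= (q - 1) ^+ 2 / q by rewrite divr_ge0 ?sqr_ge0 // ltW.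
have -> : (q - 1) ^+ 2 / q = q + q^-1 - 2 by field; lra.
nra.
Qed.

Lemma posdef_psd H : (forall v, v != 0 -> 0 < dot v (H *m v)) -> psd H.
Proof. by move=> pH v; have [->|/pH/ltW//] := eqVneq v 0; rewrite dot0l. Qed.

Lemma posdef_unitmx H : (forall v, v != 0 -> 0 < dot v (H *m v)) -> H \in unitmx.
Proof.
move=> pH; rewrite -unitmx_tr -row_free_unit -kermx_eq0; apply/eqP/row_matrixP => i.
rewrite row0; set r := row i _.
have : r *m H^T = 0 by apply/sub_kermxP/row_sub.
move=> /(congr1 trmx); rewrite trmx_mul trmxK trmx0 => Hr0.
apply/eqP; rewrite -[r]trmxK trmx_eq0; apply/negPn/negP => /pH.
by rewrite Hr0 dot0r ltxx.
Qed.

(** Since w = H (H^-1 w), Cauchy-Schwarz applies; c is the dual norm of w. *)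
Lemma dual_bound H w : H^T = H -> (forall v, v != 0 -> 0 < dot v (H *m v)) ->
  exists2 c, 0 <= c & forall v, `|dot w v| <= c * qnorm H v.
Proof.
move=> sH pH; have pdH : psd H.
  exact: posdef_psd.
exists (qnorm H (invmx H *m w)); first exact: qnorm_ge0.
move=> v; rewrite -[X in dot X _](mulKVmx (posdef_unitmx pH)) dotC (dot_sym _ _ sH).
exact: qnorm_CS.
Qed.

End QuadraticForms.

Section LineDerivatives.
Variables (R : realType) (n : nat).
Implicit Types (F : 'cV[R]_n -> R) (x y u v : 'cV[R]_n) (t : R).

Lemma col_sum_delta v : v = \sum_i v i 0 *: delta_mx i 0.
Proof.
rewrite [LHS]matrix_sum_delta; apply: eq_bigr => i _.
by rewrite big_ord_recl big_ord0 addr0.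
Qed.

Lemma derive_gradient F x v : differentiable F x ->
  'D_v F x = dot (gradient F x) v.
Proof.
move=> dF; rewrite deriveE // [X in 'd F x X]col_sum_delta linear_sum /dot.
by apply: eq_bigr => i _; rewrite linearZ /= mxE deriveE // mulrC.
Qed.

Lemma is_derive_line (V : normedModType R) (f : 'cV[R]_n -> V) x v t :
  derivable f (x + t *: v) v ->
  is_derive t 1 (fun s : R => f (x + s *: v)) ('D_v f (x + t *: v)).
Proof.
have eqf : (fun h : R => h^-1 *: (((fun s : R => f (x + s *: v)) \o shift t) (h *: 1)
    - f (x + t *: v))) =
  (fun h : R => h^-1 *: ((f \o shift (x + t *: v)) (h *: v) - f (x + t *: v))).
  apply/funext => h /=; congr (_ *: (f _ - _)).
  by rewrite [h *: 1]mulr1 scalerDl addrCA.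
move=> df; split; first by rewrite /derivable eqf.
by rewrite /derive eqf.
Qed.

Lemma differentiable_gradient_coord F x i : differentiable (gradient F) x ->
  differentiable (fun y => gradient F y i 0) x.
Proof.
move=> dg; apply: (differentiable_comp (g := fun M : 'cV[R]_n => M i 0) dg).
exact: differentiable_coord.
Qed.

Lemma is_derive_gradient_line F x u v t :
  differentiable (gradient F) (x + t *: v) ->
  is_derive t 1 (fun s : R => dot (gradient F (x + s *: v)) u)
    (dot u (hessian F (x + t *: v) *m v)).
Proof.
move=> dg; have di i := differentiable_gradient_coord i dg.
have d1 i : is_derive t 1 (fun s : R => gradient F (x + s *: v) i 0)
    ((hessian F (x + t *: v) *m v) i 0).
  have -> : (hessian F (x + t *: v) *m v) i 0 =
      'D_v (fun y => gradient F y i 0) (x + t *: v).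
    rewrite derive_gradient // mxE; apply: eq_bigr => j _.
    by rewrite !mxE.
  by apply: (is_derive_line (f := fun y => gradient F y i 0)); exact: diff_derivable.
have -> : (fun s : R => dot (gradient F (x + s *: v)) u) =
    \sum_(i < n) (u i 0 *: (fun s : R => gradient F (x + s *: v) i 0)).
  apply/funext => s; rewrite fct_sumE /=; apply: eq_bigr => i _.
  by rewrite mulrC.
apply: is_derive_eq.
by apply: eq_bigr => i _.
Qed.

Lemma MVT_line (f df : R -> R) : (forall t, 0 <= t <= 1 -> is_derive t 1 f (df t)) ->
  exists2 t, 0 < t < 1 & f 1 - f 0 = df t.
Proof.
move=> d; have [|||t] := @MVT R f df 0 1.
- exact: ltr01.
- by move=> t; rewrite in_itv /= => /andP[/ltW t0 /ltW t1]; apply: d; rewrite t0.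
- apply: derivable_within_continuous => t; rewrite in_itv /= => t01.
  exact: (@ex_derive _ _ _ _ _ _ _ (d t t01)).
- by rewrite in_itv /= subr0 mulr1 => t01 ->; exists t.
Qed.

End LineDerivatives.

(** * Proper cones, their interiors and their duals *)

Section Cones.
Variables (R : realType) (n : nat) (K : set 'cV[R]_n).
Implicit Types (x y v s : 'cV[R]_n) (t : R).

Lemma interior_normP (A : set 'cV[R]_n) x :
  A° x <-> exists2 e, 0 < e & forall y, `|y - x| < e -> A y.
Proof.
split=> [/nbhs_ballP[e e0]|[e e0 eA]].
  rewrite -ball_normE => eA.
  by exists e => // y yx; apply: eA; rewrite /ball_ /= distrC.
apply/nbhs_ballP; exists e => //; rewrite -ball_normE => y.
by rewrite /ball_ /= distrC; exact: eA.
Qed.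

Hypothesis pK : proper_cone K.

Lemma coneZ t x : 0 <= t -> K x -> K (t *: x).
Proof. by case: pK => + _ _ _ _; exact. Qed.

Lemma coneD x y : K x -> K y -> K (x + y).
Proof.
case: pK => _ cK _ _ _ Kx Ky.
have h0 : 0 <= 2^-1 :> R by lra.
have h1 : 2^-1 <= 1 :> R by lra.
have /set_mem Kxy := cK x y (Itv01 h0 h1) (mem_set Kx) (mem_set Ky).
have -> : x + y = 2 *: (2^-1 *: x + (1 - 2^-1) *: y).
  rewrite scalerDr !scalerA.
  have -> : 2 * (1 - 2^-1) = 1 :> R by field.
  have -> : 2 * 2^-1 = 1 :> R by field.
  by rewrite !scale1r.
exact: coneZ.
Qed.

Lemma interior_coneD x y : K° x -> K y -> K° (x + y).
Proof.
move=> /interior_normP[e e0 eK] Ky; apply/interior_normP; exists e => // z zxy.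
by rewrite -(subrK y z); apply: coneD => //; apply: eK; rewrite -addrA -opprD (addrC y).
Qed.

Lemma interior_coneZ t x : 0 < t -> K° x -> K° (t *: x).
Proof.
move=> t0 /interior_normP[e e0 eK]; apply/interior_normP.
exists (t * e) => [|z zx]; first exact: mulr_gt0.
rewrite -(scale1r z) -(mulfV (lt0r_neq0 t0)) -scalerA.
apply: coneZ; [exact: ltW|apply: eK].
rewrite -[x in _ - x]scale1r -(mulVf (lt0r_neq0 t0)) -scalerA -scalerBr normrZ.
by rewrite gtr0_norm ?invr_gt0 // mulrC ltr_pdivrMr // mulrC.
Qed.

Lemma interior_cone_segment x y t : 0 <= t <= 1 -> K° x -> K° y ->
  K° (x + t *: (y - x)).
Proof.
move=> /andP[t0 t1] Kx Ky; have [->|tn1] := eqVneq t 1.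
  by rewrite scale1r addrC subrK.
have -> : x + t *: (y - x) = (1 - t) *: x + t *: y.
  by rewrite scalerBr scalerBl scale1r addrCA addrC.
apply: interior_coneD; first by apply: interior_coneZ => //; lra.
by apply: coneZ => //; exact: interior_subset.
Qed.

(** Dividing x + t v by t and letting t grow puts v in the closed cone K. The same holds for - v,
    and K is pointed. *)
Lemma cone_no_line x v : (forall t, K (x + t *: v)) -> v = 0.
Proof.
move=> Kl.
have Kpm w : (forall t, 0 < t -> K (x + t *: w)) -> K w.
  move=> Kw; case: pK => _ _ _ clK _.
  apply: (@closed_cvg _ _ (at_right (0 : R)) _ (fun t : R => w + t *: x)) clK _ _ _.
    near=> t; have t0 : 0 < t by near: t; exact: nbhs_right_gt.
    have -> : w + t *: x = t *: (x + t^-1 *: w).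
      by rewrite scalerDr scalerA mulfV ?scale1r ?lt0r_neq0 // addrC.
    by apply: coneZ; [exact: ltW|apply: Kw; rewrite invr_gt0].
  apply: cvg_at_right_filter.
  have : (w + t *: x) @[t --> (0 : R)] --> w + (0 : R) *: x.
    by apply: cvgD; [exact: cvg_cst|exact: scalel_continuous].
  by rewrite scale0r addr0.
case: (pK) => _ _ + _ _; apply; first by apply: Kpm => t _; exact: Kl.
by apply: Kpm => t _; rewrite scalerN -scaleNr; exact: Kl.
Unshelve. all: by end_near. Qed.

(** With the origin in its interior, K would by scaling be the whole space and contain a line. In
    dimension 0 the origin is interior, hence [(0 < n)%N]. *)
Lemma interior_cone_neq0 x : (0 < n)%N -> K° x -> x != 0.
Proof.
move=> n0 Kx; apply/eqP => x0; move: Kx; rewrite x0 => K0.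
have Kall v : K v.
  have /interior_normP[e e0 eK] := K0.
  have c0 : 0 < e / (`|v| + 1) by rewrite divr_gt0 // ltr_wpDl.
  have vE : v = (e / (`|v| + 1))^-1 *: ((e / (`|v| + 1)) *: v).
    by rewrite scalerA mulVf ?scale1r ?lt0r_neq0.
  rewrite vE; apply: coneZ; first by rewrite ltW ?invr_gt0.
  apply: eK; rewrite subr0 normrZ gtr0_norm // mulrAC.
  rewrite ltr_pdivrMr; last by rewrite ltr_wpDl.
  by rewrite ltr_pM2l //; lra.
have : delta_mx (Ordinal n0) 0 = 0 :> 'cV[R]_n.
  by apply: (@cone_no_line 0) => t; exact: Kall.
move=> /matrixP/(_ (Ordinal n0) 0); rewrite !mxE !eqxx => /eqP.
by rewrite oner_eq0.
Qed.

(** A point y of K with <y, s> < 0 becomes interior when a multiple of an interior x is added; the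
    multiple is so small that it uses up at most half of the negative value. *)
Lemma dual_cone_interior s : (forall y, K° y -> 0 <= dot y s) -> dual_cone K s.
Proof.
move=> pos y Ky; case: (pK) => _ _ _ _ [x Kx].
rewrite leNgt; apply/negP => ys.
have xs := pos _ Kx.
have := pos (((- dot y s) / (2 * (dot x s + 1))) *: x + y).
have c0 : 0 < - dot y s / (2 * (dot x s + 1)) by apply: divr_gt0; lra.
move=> /(_ (interior_coneD (interior_coneZ c0 Kx) Ky)); rewrite !dotE.
have -> : - dot y s / (2 * (dot x s + 1)) * dot x s =
   - (dot y s / 2) * (dot x s / (dot x s + 1)) by field; lra.
have : dot x s / (dot x s + 1) <= 1 by rewrite ler_pdivrMr; lra.
nra.
Qed.

End Cones.

(** * The sup norm and continuity *)

Section NormComparison.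
Variables (R : realType) (n : nat).

Lemma mx_norm_coord (m k : nat) (M : 'M[R]_(m, k)) i j : `|M i j| <= `|M|.
Proof.
rewrite [leRHS]/Num.Def.normr /= mx_normrE.
exact: (le_bigmax _ (fun ij : 'I_m * 'I_k => `|M ij.1 ij.2|) (i, j)).
Qed.

Lemma mx_norm_le (m k : nat) (M : 'M[R]_(m, k)) (c : R) : 0 <= c ->
  (forall i j, `|M i j| <= c) -> `|M| <= c.
Proof.
by move=> c0 Mc; rewrite [leLHS]/Num.Def.normr /= mx_normrE bigmax_le // => -[i j] _.
Qed.

Lemma dot_norm_bound (u v : 'cV[R]_n) : `|dot u v| <= n%:R * `|u| * `|v|.
Proof.
rewrite /dot (le_trans (ler_norm_sum _ _ _)) //.
rewrite -mulrA mulr_natl -[X in _ *+ X](card_ord n) -sumr_const.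
by apply: ler_sum => i _; rewrite normrM ler_pM // mx_norm_coord.
Qed.

Lemma trmx_continuous (m k : nat) : continuous (@trmx R m k).
Proof.
move=> M A [P MP PA]; exists (fun i j => P j i) => [i j|N NP].
  by have := MP j i; rewrite mxE.
by apply: PA => i j; rewrite mxE; exact: NP.
Qed.

Lemma lipschitz_continuous_real (V : normedModType R) (g : V -> R) (c : R) :
  (forall v w, `|g v - g w| <= c * `|v - w|) -> continuous g.
Proof.
move=> gc v; apply/cvgrPdist_le => e e0.
have c0 : 0 < `|c| + 1 by rewrite ltr_wpDl.
have d0 : 0 < e / (`|c| + 1) by rewrite divr_gt0.
apply/nbhs_normP; exists (e / (`|c| + 1)) => //= w.
rewrite /ball_ /= => vw; apply: le_trans (gc v w) _.
have : c * `|v - w| <= (`|c| + 1) * `|v - w|.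
  by apply: ler_wpM2r => //; have := ler_norm c; lra.
move=> h; apply: le_trans h _; rewrite mulrC -ler_pdivlMr //.
exact: ltW.
Qed.

End NormComparison.

(** * The scaling matrix near the central path *)

Section RankOne.
Variable R : realType.
Implicit Types a b g h k U V G : R.

(** [su] and [sv] stand for <st, u> and <st, v>, of size sqrt nu in the local norm; [eu] and [ev]
    are values of a perturbation e. Since nu >= 1, the division by nu absorbs the sqrt nu of the
    cross terms. *)
Lemma rank_one_shift (nu E U V su sv eu ev : R) : 1 <= nu -> 0 <= E -> 0 <= U -> 0 <= V ->
  `|su| <= Num.sqrt nu * U -> `|sv| <= Num.sqrt nu * V -> `|eu| <= E * U -> `|ev| <= E * V ->
  `|((su + eu) * (sv + ev) - su * sv) / nu| <= (2 * E + E ^+ 2) * (U * V).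
Proof.
move=> nu1 E0 U0 V0; have nu0 : 0 < nu by lra.
have S2 : Num.sqrt nu ^+ 2 = nu by rewrite sqr_sqrtr // ltW.
have S1 : 1 <= Num.sqrt nu by rewrite -(sqrtr1 R) ler_wsqrtr.
move: (Num.sqrt nu) S1 S2 => S S1 S2 hsu hsv heu hev.
rewrite normrM normfV (gtr0_norm nu0) ler_pdivrMr //.
have -> : (su + eu) * (sv + ev) - su * sv = su * ev + eu * sv + eu * ev by ring.
have p1 : `|su * ev| <= S * U * (E * V) by rewrite normrM ler_pM.
have p2 : `|eu * sv| <= E * U * (S * V) by rewrite normrM ler_pM.
have p3 : `|eu * ev| <= E * U * (E * V) by rewrite normrM ler_pM.
have tri : `|su * ev + eu * sv + eu * ev| <= 2 * S * E * (U * V) + E ^+ 2 * (U * V).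
  apply: le_trans (ler_normD _ _) _; have := ler_normD (su * ev) (eu * sv); lra.
apply: le_trans tri _; rewrite -mulrDl [leRHS]mulrAC.
apply: ler_wpM2r; first exact: mulr_ge0.
have sS : S <= S ^+ 2 by nra.
have s1 : 1 <= S ^+ 2 by nra.
have := ler_wpM2l E0 sS; have := ler_wpM2l (sqr_ge0 E) s1; rewrite -S2; lra.
Qed.

(** Here a, b are values of H q, g and h those of e - H q, and q^2 + k is <p, e>. Numerator and
    denominator are both perturbed by a relative amount G / q, so the two quotients, each of order
    one, differ by O(G / q). *)
Lemma rank_one_quotient (G q U V a b g h k : R) : 0 <= G -> G < q -> 0 <= U -> 0 <= V ->
  `|a| <= q * U -> `|b| <= q * V -> `|g| <= G * U -> `|h| <= G * V -> `|k| <= G * q ->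
  `|(a + g) * (b + h) / (q ^+ 2 + k) - a * b / q ^+ 2| <=
  (3 * G * q + G ^+ 2) / (q * (q - G)) * (U * V).
Proof.
move=> G0 Gq U0 V0 ha hb hg hh hk; have q0 : 0 < q by lra.
have d0 : 0 < q * (q - G) by rewrite mulr_gt0 // subr_gt0.
have kd : q * (q - G) <= q ^+ 2 + k by move/ler_normlP: hk => [k1 _]; lra.
have kd0 : 0 < q ^+ 2 + k by lra.
have -> : (a + g) * (b + h) / (q ^+ 2 + k) - a * b / q ^+ 2 =
    (q ^+ 2 * (a * h + g * b + g * h) - k * (a * b)) / (q ^+ 2 * (q ^+ 2 + k)).
  by field; rewrite !gt_eqF.
have p1 : `|a * h| <= q * U * (G * V) by rewrite normrM ler_pM.
have p2 : `|g * b| <= G * U * (q * V) by rewrite normrM ler_pM.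
have p3 : `|g * h| <= G * U * (G * V) by rewrite normrM ler_pM.
have p4 : `|k * (a * b)| <= G * q * (q * U * (q * V)).
  by rewrite normrM ler_pM // normrM ler_pM.
have tri : `|a * h + g * b + g * h| <= (2 * G * q + G ^+ 2) * (U * V).
  apply: le_trans (ler_normD _ _) _; have := ler_normD (a * h) (g * b); lra.
have num : `|q ^+ 2 * (a * h + g * b + g * h) - k * (a * b)| <=
    q ^+ 2 * ((3 * G * q + G ^+ 2) * (U * V)).
  apply: le_trans (ler_normB _ _) _; rewrite normrM (ger0_norm (sqr_ge0 q)).
  have := ler_wpM2l (sqr_ge0 q) tri; lra.
have den : 0 < q ^+ 2 * (q ^+ 2 + k) by rewrite mulr_gt0 // exprn_gt0.
rewrite normrM normfV (gtr0_norm den) ler_pdivrMr //.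
apply: le_trans num _.
have -> : (3 * G * q + G ^+ 2) / (q * (q - G)) * (U * V) * (q ^+ 2 * (q ^+ 2 + k)) =
  q ^+ 2 * ((3 * G * q + G ^+ 2) * (U * V)) * ((q ^+ 2 + k) / (q * (q - G))).
  by field; rewrite subr_eq0 !gt_eqF.
have Gq0 : 0 <= 3 * G * q by rewrite mulr_ge0 ?mulr_ge0 // ltW.
rewrite ler_peMr // ?ler_pdivlMr ?mul1r //.
by rewrite mulr_ge0 ?sqr_ge0 // mulr_ge0 ?addr_ge0 ?sqr_ge0 // mulr_ge0.
Qed.

(** To first order the shift costs 2 r and the quotient 3 * 21/10 r = 6.3 r; the bound 9 r leaves
    room for the rest. *)
Lemma rank_one_constants (r q : R) : 0 < r -> r <= 3 / 250 -> q <= r ->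
  r - 21 / 10 * r ^+ 2 <= q ->
  2 * (r + 21 / 10 * r ^+ 2) + (r + 21 / 10 * r ^+ 2) ^+ 2 +
  (3 * (21 / 10 * r ^+ 2) * q + (21 / 10 * r ^+ 2) ^+ 2) /
    (q * (q - 21 / 10 * r ^+ 2)) <= 9 * r.
Proof.
move=> r0 r12 qr rq.
have r2 : r ^+ 2 <= 3 / 250 * r by rewrite expr2 ler_wpM2r // ltW.
have q1 : 97 / 100 * r <= q by lra.
have q2 : 47 / 50 * r <= q - 21 / 10 * r ^+ 2 by lra.
have e1 : 2 * (r + 21 / 10 * r ^+ 2) + (r + 21 / 10 * r ^+ 2) ^+ 2 <= 52 / 25 * r.
  have E0 : 0 <= r + 21 / 10 * r ^+ 2 by have := sqr_ge0 r; lra.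
  have E1 : r + 21 / 10 * r ^+ 2 <= 103 / 100 * r by lra.
  have := ler_pM E0 E0 E1 E1; rewrite -!expr2.
  by move: (r + _) E1 => E E1; lra.
suff : (3 * (21 / 10 * r ^+ 2) * q + (21 / 10 * r ^+ 2) ^+ 2) /
    (q * (q - 21 / 10 * r ^+ 2)) <= 173 / 25 * r by lra.
have d0 : 0 < q * (q - 21 / 10 * r ^+ 2) by rewrite mulr_gt0 //; lra.
rewrite ler_pdivrMr //.
have d1 : q * (47 / 50 * r) <= q * (q - 21 / 10 * r ^+ 2).
  by rewrite ler_wpM2l //; lra.
have : 173 / 25 * r * (q * (47 / 50 * r)) <= 173 / 25 * r * (q * (q - 21 / 10 * r ^+ 2)).
  by rewrite ler_wpM2l //; lra.
apply: le_trans.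
have -> : 3 * (21 / 10 * r ^+ 2) * q + (21 / 10 * r ^+ 2) ^+ 2 =
  r ^+ 2 * (63 / 10 * q + 441 / 100 * r ^+ 2) by field.
have -> : 173 / 25 * r * (q * (47 / 50 * r)) = r ^+ 2 * (173 / 25 * 47 / 50 * q).
  by ring.
rewrite ler_wpM2l ?sqr_ge0 //; lra.
Qed.

End RankOne.

(** * The scaling matrix as a perturbation of m H *)

Section ScalingForm.
Variables (R : realType) (n : nat).
Implicit Types (u v : 'cV[R]_n).

(* scaling_matrix with the Hessian, the norm and the two shadow iterates made
   into free parameters: everything below is linear algebra. *)
Definition scaling_form (H : 'M[R]_n) (nu : R) (x s xt st : 'cV[R]_n) : 'M[R]_n :=
  let m := mu nu x s in
  let mt := mu nu xt st in
  let dP := x - m *: xt in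
  let dD := s - m *: st in
  let w := H *m xt - mt *: st in
  m *: H + (nu * m)^-1 *: outer s - (m / nu) *: outer st
  + (if x == m *: xt then 0 else
       (dot dP dD)^-1 *: outer dD
       - (m / (qnorm H xt ^+ 2 - nu * mt ^+ 2)) *: outer w).

(* The shadow iterates are x - p and st + e; q is the H-orthogonal projection
   of p onto the complement of x. *)
Variables (H : 'M[R]_n) (nu m c : R) (x p q st e : 'cV[R]_n).
Hypotheses (symH : H^T = H) (posH : forall v, v != 0 -> 0 < dot v (H *m v)) (nu0 : 0 < nu) (m0 : 0 < m).
Hypotheses (Hx : H *m x = st) (xst : dot x st = nu) (xe : dot x e = 0)
  (pse : dot p (st + e) = 0) (pst : dot p st = c * nu) (qE : q = p - c *: x).

Let W := scaling_form H nu x (m *: (st + e)) (m^-1 *: (x - p)) st.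

Let psdH : psd H. Proof. exact: posdef_psd. Qed.

Let dotxH v : dot x (H *m v) = dot st v.
Proof. by rewrite (dot_sym _ _ symH) Hx dotC. Qed.

Let Hq : H *m q = H *m p - c *: st.
Proof. by rewrite qE !mulmx_linE Hx. Qed.

Let dot_q_st : dot q st = 0.
Proof. by rewrite qE dotBl dotZl xst pst subrr. Qed.

Let mn0 : m != 0. Proof. by rewrite gt_eqF. Qed.
Let nun0 : nu != 0. Proof. by rewrite gt_eqF. Qed.

Let qnorm_q : qnorm H q ^+ 2 = qnorm H p ^+ 2 - c ^+ 2 * nu.
Proof.
rewrite !qnorm_sqr // qE !mulmx_linE !dotE Hx !dotxH xst pst (dotC st p) pst.
by ring.
Qed.

(** In these variables [dP] is p, [dD] is m e, the vector [w] is - H q / m, and the denominator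
    belonging to [w] is |q|^2 / m^2. *)
Lemma scaling_form_dot u v : dot u (W *m v) = m * (dot u (H *m v) +
  (dot (st + e) u * dot (st + e) v - dot st u * dot st v) / nu +
  (if p == 0 then 0 else dot e u * dot e v / dot p e -
     dot (H *m q) u * dot (H *m q) v / qnorm H q ^+ 2)).
Proof.
have mE : mu nu x (m *: (st + e)) = m by rewrite /mu dotZr dotDr xst xe addr0 mulfK.
have mtE : mu nu (m^-1 *: (x - p)) st = m^-1 * (1 - c).
  by rewrite /mu dotZl dotBl xst pst; field; rewrite nun0 mn0.
have wE : H *m (m^-1 *: (x - p)) - (m^-1 * (1 - c)) *: st = - m^-1 *: (H *m q).
  rewrite Hq !mulmx_linE Hx.
  by move: (H *m p) => Hp; apply/matrixP => i k; rewrite !mxE; ring.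
have dE : qnorm H (m^-1 *: (x - p)) ^+ 2 - nu * (m^-1 * (1 - c)) ^+ 2 =
    m^-1 ^+ 2 * qnorm H q ^+ 2.
  rewrite qnorm_q !qnorm_sqr // !mulmx_linE !dotE Hx !dotxH xst (dotC st p) pst.
  by ring.
have pE : x - m *: (m^-1 *: (x - p)) = p by rewrite scalerA mulfV // scale1r subKr.
have eE : m *: (st + e) - m *: st = m *: e by rewrite -scalerBr addrC addKr.
have xE : (x == m *: (m^-1 *: (x - p))) = (p == 0) by rewrite -subr_eq0 pE.
rewrite /W /scaling_form mE mtE wE dE xE pE eE.
rewrite mulmxDl dotDr mulmxBl dotBr mulmxDl dotDr !mulmxZl !dotZr !dot_outer.
case: eqVneq => xy.
  by rewrite mul0mx dot0r !dotZl; field; rewrite nun0 mn0.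
rewrite mulmxBl dotBr !mulmxZl !dotZr !dot_outer !dotZl !invfM.
rewrite !invrK.
move: (dot p e)^-1 (qnorm H q)^-1 => pe qq.
by field; rewrite nun0 mn0.
Qed.

Lemma scaling_form_sym : W^T = W.
Proof.
apply: sym_from_dot => u v; rewrite !scaling_form_dot (dot_sym v u symH).
by case: eqVneq => _; congr (_ * _); ring.
Qed.

(** The two quotients vanish on x, because e and H q are orthogonal to x; the remaining terms add up
    to s. *)
Lemma scaling_form_x : W *m x = m *: (st + e).
Proof.
apply: dot_inj => u; rewrite scaling_form_dot dotZr Hx.
have -> : dot (st + e) x = nu by rewrite dotDl dotC xst dotC xe addr0.
have Hqx : dot (H *m q) x = 0 by rewrite dotC dotxH dotC dot_q_st.
rewrite Hqx [dot st x]dotC xst [dot e x]dotC xe.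
rewrite !(mulr0, mul0r) subr0 if_same addr0 dotDl dotDr !(dotC _ u).
by congr (_ * _); field.
Qed.

Section SmallResidual.
Let r := qnorm H p.
Hypotheses (nu1 : 1 <= nu) (r12 : r <= 3 / 250).
Hypothesis residual : forall v, `|dot (e - H *m p) v| <= 21 / 10 * r ^+ 2 * qnorm H v.

Let r0 : 0 <= r. Proof. exact: qnorm_ge0. Qed.
Let G := 21 / 10 * r ^+ 2.
Let Gr : G <= 13 / 500 * r. Proof. by rewrite /G; move: (r) r0 r12 => a; nra. Qed.
Let G0 : 0 <= G. Proof. by rewrite /G; move: (r) r0 => a; nra. Qed.

Let st_bound v : `|dot st v| <= Num.sqrt nu * qnorm H v.
Proof.
have -> : Num.sqrt nu = qnorm H x by rewrite /qnorm Hx xst.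
by rewrite -dotxH; exact: qnorm_CS.
Qed.

Let sqnu : Num.sqrt nu ^+ 2 = nu. Proof. by rewrite sqr_sqrtr // ltW. Qed.

(** Testing the residual on x isolates c, as <e - H p, x> = - c nu and |x| = sqrt nu. The component
    c x of p is therefore of second order. *)
Let c2nu : c ^+ 2 * nu <= G ^+ 2.
Proof.
have cE : dot (e - H *m p) x = - (c * nu).
  by rewrite dotBl dotC xe dotC dotxH dotC pst sub0r.
have := residual x; rewrite cE -/G normrN.
have -> : qnorm H x = Num.sqrt nu by rewrite /qnorm Hx xst.
have S0 : 0 <= Num.sqrt nu by exact: sqrtr_ge0.
move=> h; have : `|c * nu| ^+ 2 <= (G * Num.sqrt nu) ^+ 2.
  by rewrite ler_pXn2r ?nnegrE ?mulr_ge0.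
rewrite real_normK ?num_real // !exprMn sqnu.
have -> : c ^+ 2 * nu ^+ 2 = c ^+ 2 * nu * nu by ring.
by rewrite ler_pM2r.
Qed.

Let rq := qnorm H q.
Let rq0 : 0 <= rq. Proof. exact: qnorm_ge0. Qed.

Let rq_le : rq <= r.
Proof.
rewrite -(ler_pXn2r (_ : 0 < 2)%N) ?nnegrE // qnorm_q lerBlDr lerDl.
by rewrite mulr_ge0 ?sqr_ge0 // ltW.
Qed.

Let rq_ge : r - G <= rq.
Proof.
have h : r ^+ 2 - G ^+ 2 <= rq ^+ 2 by rewrite qnorm_q lerB.
have rG : 0 <= r - G by move: (r) r0 Gr => a; lra.
rewrite -(ler_pXn2r (_ : 0 < 2)%N) ?nnegrE //; apply: le_trans h.
by move: (r) (G) G0 rG => a b b0 ab; nra.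
Qed.

(** e - H q is e - H p plus a multiple of st. Replacing v by its projection w orthogonal to st
    removes this multiple, keeps the value because e - H q vanishes on x, and does not increase the
    norm. *)
Let residual_q v : `|dot (e - H *m q) v| <= G * qnorm H v.
Proof.
pose w := v - (dot st v / nu) *: x.
have stw : dot st w = 0.
  by rewrite /w dotBr dotZr [dot st x]dotC xst divfK ?subrr.
have -> : dot (e - H *m q) v = dot (e - H *m p) w.
  have hx : dot (e - H *m q) x = 0.
    by rewrite dotBl dotC xe dotC dotxH dotC dot_q_st subrr.
  have -> : dot (e - H *m q) v = dot (e - H *m q) w.
    by rewrite [in RHS]dotBr dotZr hx mulr0 subr0.
  have -> : e - H *m q = e - H *m p + c *: st by rewrite Hq opprB addrA addrAC.
  by rewrite dotDl dotZl stw mulr0 addr0.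
apply: le_trans (residual w) _; rewrite -/G ler_wpM2l //.
rewrite -(ler_pXn2r (_ : 0 < 2)%N) ?nnegrE ?qnorm_ge0 // !qnorm_sqr //.
rewrite /w !mulmx_linE !dotE Hx !dotxH xst [dot v st]dotC.
have : dot st v = dot st v / nu * nu by rewrite divfK.
have := mulr_ge0 (sqr_ge0 (dot st v / nu)) (ltW nu0).
move: (dot st v) (dot v (H *m v)) (dot st v / nu) => d b a ann ->.
lra.
Qed.

Let e_bound v : `|dot e v| <= (r + G) * qnorm H v.
Proof.
have -> : dot e v = dot (e - H *m p) v + dot v (H *m p).
  by rewrite dotBl [dot v _]dotC subrK.
apply: le_trans (ler_normD _ _) _; rewrite mulrDl addrC lerD // mulrC.
exact: qnorm_CS.
Qed.

Let e0 : p = 0 -> e = 0.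
Proof.
move=> p0; apply: dot_inj => v; rewrite dot0r dotC; apply/eqP; rewrite -normr_eq0.
have := e_bound v; rewrite /G /r p0 qnorm0 expr0n /= mulr0 addr0 mul0r.
by rewrite normr_le0 normr_eq0.
Qed.

Let pe_ge : r * (r - G) <= dot p e.
Proof.
have -> : dot p e = dot (e - H *m p) p + r ^+ 2.
  by rewrite qnorm_sqr // dotBl [dot _ p]dotC [dot (H *m p) p]dotC subrK.
have /ler_normlP[+ _] := residual p; rewrite -/G -/r.
by move: (r) (G) (dot _ p) => a b d; nra.
Qed.

Let r_gt0 : p != 0 -> 0 < r.
Proof. by move=> p0; rewrite sqrtr_gt0; exact: posH. Qed.

Let pe0 : p != 0 -> dot p e != 0.
Proof.
move=> /r_gt0 rp; rewrite gt_eqF //; apply: lt_le_trans pe_ge.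
by rewrite mulr_gt0 // subr_gt0; apply: le_lt_trans Gr _; move: (r) rp => a; lra.
Qed.

(** A secant equation: <e, p> and <H q, p> = |q|^2 cancel the denominators, so the quotients
    contribute e - H q. The other terms contribute H p - c st = H q, because <s, p> = 0. *)
Lemma scaling_form_p : W *m p = m *: e.
Proof.
apply: dot_inj => u; rewrite scaling_form_dot dotZr.
have -> : dot (st + e) p = 0 by rewrite dotC.
case: eqVneq => [p0|pn0].
  by rewrite e0 // p0 mulmx0 !dot0r; ring.
have pe := pe0 pn0.
have q2 : dot (H *m q) p = qnorm H q ^+ 2.
  rewrite qnorm_sqr // dotC.
  have -> : dot q (H *m q) = dot p (H *m q) - c * dot x (H *m q).
    by rewrite {1}qE dotBl dotZl.
  by rewrite dotxH dotC [dot st q]dotC dot_q_st mulr0 subr0 dotC.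
rewrite q2 [dot e p]dotC mulfK //.
have qn0 : qnorm H q ^+ 2 != 0.
  rewrite qnorm_sqr //; apply/negP => /eqP q20.
  have qz : q = 0 by apply/eqP; apply: contraT => /posH; rewrite q20 ltxx.
  move: pe; have -> : p = c *: x by apply/eqP; rewrite -subr_eq0 -qE qz.
  by rewrite dotZl xe mulr0 eqxx.
rewrite mulfK // [dot st p]dotC pst Hq dotBl dotZl !(dotC _ u).
by congr (_ * _); field.
Qed.

Lemma scaling_form_hessian u v :
  `|dot u (W *m v) - m * dot u (H *m v)| <= 9 * r * m * (qnorm H u * qnorm H v).
Proof.
rewrite scaling_form_dot -mulrBr -[_ + _ + _]addrA [dot u (H *m v) + _]addrC addrK.
have -> : 9 * r * m * (qnorm H u * qnorm H v) = m * (9 * r * (qnorm H u * qnorm H v)).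
  by ring.
rewrite normrM gtr0_norm // ler_pM2l //.
have U0 := qnorm_ge0 H u; have V0 := qnorm_ge0 H v.
have UV0 := mulr_ge0 U0 V0.
have E0 : 0 <= r + G by rewrite addr_ge0.
have cross := rank_one_shift nu1 E0 U0 V0 (st_bound u) (st_bound v) (e_bound u) (e_bound v).
rewrite !dotDl.
have [p0|pn0] := eqVneq p 0.
  have -> : r = 0 by rewrite /r p0 qnorm0.
  rewrite (e0 p0) !dot0l !addr0 subrr mul0r normr0.
  by rewrite mulr0 mul0r.
have rp := r_gt0 pn0.
have rqG : G < rq.
  by apply: lt_le_trans rq_ge; move: (r) (G) rp Gr => a b; lra.
have qv w : `|dot (H *m q) w| <= rq * qnorm H w.
  by rewrite dotC mulrC; exact: qnorm_CS.
(* Since <x, e> = 0, p may be replaced by q, which gives the denominator the form q^2 + k of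
   [rank_one_quotient]. *)
have -> : dot p e = rq ^+ 2 + dot (e - H *m q) q.
  rewrite /rq qnorm_sqr // dotBl [dot (H *m q) q]dotC addrC subrK.
  by rewrite [in RHS]qE dotBr dotZr [dot e x]dotC xe mulr0 subr0 dotC.
have eE w : dot e w = dot (H *m q) w + dot (e - H *m q) w.
  by rewrite dotBl addrC subrK.
have rank1 := rank_one_quotient G0 rqG U0 V0 (qv u) (qv v) (residual_q u) (residual_q v)
  (residual_q q).
rewrite -/rq in rank1 *; rewrite -!eE in rank1.
apply: le_trans (ler_normD _ _) _; apply: le_trans (lerD cross rank1) _.
rewrite -mulrDl ler_wpM2r //.
exact: rank_one_constants rq_le rq_ge.
Qed.

End SmallResidual.
End ScalingForm.

(** * Search directions *)

Section LinearSystems.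
Variable R : realType.

(** The Fredholm alternative. It covers singular M, which occurs here when y is not determined. *)
Lemma solvable_orthogonal (p q : nat) (M : 'M[R]_(p, q)) (r : 'cV[R]_p) :
  (forall w : 'cV[R]_p, M^T *m w = 0 -> dot r w = 0) -> exists v, M *m v = r.
Proof.
move=> orth.
have /submxP[D rD] : (r^T <= M^T)%MS.
  rewrite submxE; apply/eqP/matrixP => i j; rewrite (ord1 i) [RHS]mxE.
  have : M^T *m col j (cokermx M^T) = 0 by rewrite colE mulmxA mulmx_coker mul0mx.
  move=> /orth; rewrite mxE => orth0; rewrite -[RHS]orth0.
  by apply: eq_bigr => k _; rewrite !mxE.
by exists D^T; rewrite -[r]trmxK rD trmx_mul trmxK.
Qed.

Lemma dot_col_mx (p q : nat) (a c : 'cV[R]_p) (b d : 'cV[R]_q) :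
  dot (col_mx a b) (col_mx c d) = dot a c + dot b d.
Proof.
rewrite /dot big_split_ord /=; congr (_ + _); apply: eq_bigr => i _.
  by rewrite !col_mxEu.
by rewrite !col_mxEd.
Qed.

Lemma mul_trmx_dot (n : nat) (u v : 'cV[R]_n) : u^T *m v = (dot u v)%:M.
Proof.
apply/matrixP => i j; rewrite !mxE !ord1 eqxx mulr1n.
by apply: eq_bigr => k _; rewrite mxE.
Qed.

End LinearSystems.

(** * The homogeneous embedding and its linear systems *)

Section Embedding.
Variables (R : realType) (m n : nat) (A : 'M[R]_(m, n)) (b : 'cV[R]_m) (c : 'cV[R]_n).
Implicit Types (z d : hsd_point R m n) (W : 'M[R]_n).

Lemma G_linear a z d : G A b c (a *: z + d) = a *: G A b c z + G A b c d.
Proof.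
rewrite /G /px /py /ptau /ps /pkappa /= !scale_col_mx !add_col_mx; congr col_mx.
  rewrite !mulmx_linE; move: (A *m _) (A *m _) => u v.
  by apply/matrixP => i j; rewrite !mxE /GRing.scale /=; ring.
congr col_mx.
  rewrite !mulmx_linE; move: (A^T *m _) (A^T *m _) => u v.
  by apply/matrixP => i j; rewrite !mxE /GRing.scale /=; ring.
by rewrite !dotE; apply/matrixP => i j; rewrite !ord1 !mxE eqxx !mulr1n /GRing.scale /=; ring.
Qed.

Lemma G_add z d : G A b c (z + d) = G A b c z + G A b c d.
Proof. by have := G_linear 1 z d; rewrite !scale1r. Qed.

Lemma G0 : G A b c 0 = 0.
Proof. by have := G_linear (-1) 0 0; rewrite scaler0 addr0 scaleN1r addNr. Qed.

Lemma G_scale a z : G A b c (a *: z) = a *: G A b c z.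
Proof. by have := G_linear a z 0; rewrite !addr0 G0 addr0. Qed.

(** On the kernel of G, (0, s, kappa) is the image of (y, x, tau) under a skew-symmetric matrix, and
    the left side is the product of the two. *)
Lemma G_skew z : G A b c z = 0 -> dot (px z) (ps z) + ptau z * pkappa z = 0.
Proof.
rewrite /G => G0; have {G0} : col_mx (A *m px z - ptau z *: b)
    (col_mx (- (A^T *m py z) + ptau z *: c - ps z)
      (dot b (py z) - dot c (px z) - pkappa z)%:M) =
    col_mx (0 : 'cV[R]_m) (col_mx (0 : 'cV[R]_n) (0 : 'cV[R]_1)).
  by rewrite G0 !col_mx0.
move=> /eq_col_mx[/eqP + /eq_col_mx[/eqP + /matrixP/(_ 0 0)]].
rewrite !subr_eq0 !mxE eqxx mulr1n => /eqP Ax /eqP <- /eqP.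
rewrite subr_eq0 => /eqP <-.
rewrite dotDr dotNr dotZr dotC -dot_mulmx_tr Ax dotZr (dotC (py z)) (dotC (px z)).
by ring.
Qed.

(* The quadratic form of the system is that of W plus kappa / tau; a vector in
   the left kernel therefore only has a y-component, which the right-hand side
   does not see. *)
Lemma direction_exists W z zr rt rs : (forall v, v != 0 -> 0 < dot v (W *m v)) ->
  0 < ptau z -> 0 < pkappa z ->
  exists d, direction A b c W z (G A b c zr) rt rs d.
Proof.
move=> posW tau0 kap0.
pose k := pkappa z / ptau z.
have k0 : 0 < k by rewrite divr_gt0.
(* As d - [zr] lies in the kernel of G, its s and kappa are functions of (y, x, tau), the unknowns
   that remain. Dividing the complementarity row by tau makes M skew-symmetric up to the diagonal
   blocks [W] and [k]. *)
pose M : 'M[R]_(m + (n + 1)) := block_mx 0 (row_mx A (- b))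
  (col_mx (- A^T) b^T) (block_mx W c (- c^T) k%:M).
have split3 (w : 'cV[R]_(m + (n + 1))) : exists y x t, w = col_mx y (col_mx x t%:M).
  exists (usubmx w), (usubmx (dsubmx w)), (dsubmx (dsubmx w) 0 0).
  by rewrite -mx11_scalar !vsubmxK.
have ME (y : 'cV[R]_m) (x : 'cV[R]_n) (t : R) :
    M *m col_mx y (col_mx x t%:M) = col_mx (A *m x - t *: b)
      (col_mx (- (A^T *m y) + W *m x + t *: c) (dot b y - dot c x + k * t)%:M).
  rewrite /M mul_block_col mul0mx add0r mul_row_col mulNmx mul_mx_scalar; congr col_mx.
  rewrite mul_block_col mul_col_mx add_col_mx mulNmx !mul_mx_scalar addrA; congr col_mx.
  rewrite mulNmx !mul_trmx_dot; apply/matrixP => i j; rewrite !ord1 !mxE eqxx !mulr1n.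
  by rewrite [t * k]mulrC addrA.
pose rs' := rs - (W *m px zr + ps zr).
pose rt' := (rt - (ptau z * pkappa zr + pkappa z * ptau zr)) / ptau z.
have [w Mw|v Mv] := @solvable_orthogonal R _ _ M (col_mx 0 (col_mx rs' rt'%:M)).
  move: Mw; have [y [x [t ->]]] := split3 w => Mw.
  have scal (a a' : R) : dot (a%:M : 'cV[R]_1) a'%:M = a * a'.
    by rewrite /dot big_ord1 !mxE eqxx !mulr1n.
  have : dot (col_mx y (col_mx x t%:M)) (M *m col_mx y (col_mx x t%:M)) = 0.
    by rewrite dot_mulmx_tr Mw dot0l.
  rewrite ME !dot_col_mx scal !dotE dot_mulmx_tr [dot y b]dotC.
  rewrite -[dot x (A^T *m y)]dotC [dot x c]dotC => h.
  have h0 : dot x (W *m x) + k * t ^+ 2 = 0 by rewrite -h; ring.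
  have x0 : x = 0.
    apply/eqP; apply: contraT => /posW W0.
    have : 0 <= k * t ^+ 2 by rewrite mulr_ge0 ?sqr_ge0 // ltW.
    by move: h0 W0; move: (dot x _) (k * _) => p q; lra.
  move: h0; rewrite x0 dot0l add0r => /eqP.
  rewrite mulf_eq0 gt_eqF //= sqrf_eq0 => /eqP ->.
  by rewrite scal !dot0r mulr0 !addr0 subrr addr0.
move: Mv; have [y [x [t ->]]] := split3 v.
rewrite ME => /eq_col_mx[E1 /eq_col_mx[E2 /matrixP/(_ 0 0)]].
rewrite !mxE eqxx !mulr1n => E3.
pose d : hsd_point R m n := (y, x, t, - (A^T *m y) + t *: c, dot b y - dot c x).
exists (zr + d); split.
- rewrite G_add -[RHS]addr0; congr (_ + _).
  rewrite /G /= /px /py /ptau /ps /pkappa /= E1 !subrr.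
  by rewrite raddf0 !col_mx0.
- rewrite /ptau /pkappa /= -/(ptau z) -/(pkappa z) -/(ptau zr) -/(pkappa zr).
  move: E3; rewrite /rt' /k => /(congr1 ( *%R^~ (ptau z))); rewrite divfK ?gt_eqF //.
  rewrite mulrDl [_ / _ * t]mulrAC divfK ?gt_eqF //.
  rewrite mulrDl; lra.
- rewrite /px /ps /= -/(px zr) -/(ps zr) mulmxDr.
  have : W *m x + (- (A^T *m y) + t *: c) = rs' by rewrite -E2 addrA [W *m x + _]addrC.
  rewrite /rs' => E; rewrite addrACA E addrC subrK.
  by [].
Qed.

End Embedding.

(** * Energy of a search direction *)

Section StepEstimates.
Variable R : realType.

Lemma sqr_le_sqr (a b : R) : 0 <= b -> a ^+ 2 <= b ^+ 2 -> a <= b.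
Proof.
move=> b0 ab; rewrite leNgt; apply/negP => ba.
have : b ^+ 2 < a ^+ 2 by nra.
by rewrite ltNge ab.
Qed.

Lemma mu_mue_close (nu m t me : R) : 1 <= nu -> 0 < me -> (nu + 1) * me = nu * m + t ->
  `|t - me| <= me / 50 -> `|m - me| <= me / 50 / nu.
Proof.
move=> nu1 me0 e h; have nu0 : 0 < nu by lra.
rewrite ler_pdivlMr // -{1}(gtr0_norm nu0) -normrM.
have -> : (m - me) * nu = me - t by lra.
by rewrite distrC.
Qed.

(** At m = me the left side is me^2 / 100; 7/500 allows for the deviation of 2 percent. The
    coefficient 4/5 is 1 - 2/10: adding z / 10 to the direction adds 2/10 of s and of tau kappa to
    the right-hand sides. *)
Lemma predictor_target_bound (m me : R) : 0 < me -> `|m - me| <= me / 50 ->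
  (9 / 10 * me - 4 / 5 * m) ^+ 2 <= 7 / 500 * (me * m).
Proof.
move=> me0 /ler_normlP[h1 h2].
have p0 : 0 <= (m - 49 / 50 * me) * (51 / 50 * me - m) by rewrite mulr_ge0 //; lra.
have p1 : 49 / 50 * me * me <= m * me by rewrite ler_pM2r //; lra.
have := sqr_ge0 me; nra.
Qed.

(** The cone part contributes at most 7/500 nu me, the tau kappa part 7/500 me, and the centrality
    error P at most m / 10^4; me <= 50/49 m converts me into m. *)
Lemma predictor_energy_bound (nu m t me P : R) : 1 <= nu -> 0 < me -> 0 < m ->
  (nu + 1) * me = nu * m + t -> `|t - me| <= me / 50 -> 0 <= P -> P <= m / 100 / 100 ->
  (9 / 10 * (me / m) - 4 / 5) ^+ 2 * (nu * m) + (9 / 10 * (me / m)) ^+ 2 * P +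
  (9 / 10 * me - 4 / 5 * t) ^+ 2 / t <= 3 / 100 * (nu * m).
Proof.
move=> nu1 me0 m0 e ht P0 P1.
have nu0 : 0 < nu by lra.
have hm : `|m - me| <= me / 50.
  apply: le_trans (mu_mue_close nu1 me0 e ht) _.
  by rewrite ler_pdivrMr // ler_peMr // divr_ge0 // ltW.
have b1 := predictor_target_bound me0 hm; have b2 := predictor_target_bound me0 ht.
have t0 : 0 < t by move/ler_normlP: ht => [? ?]; lra.
have e1 : (9 / 10 * (me / m) - 4 / 5) ^+ 2 * (nu * m) <= nu * (7 / 500 * me).
  have -> : (9 / 10 * (me / m) - 4 / 5) ^+ 2 * (nu * m) =
     nu * ((9 / 10 * me - 4 / 5 * m) ^+ 2 / m) by field; rewrite gt_eqF.
  by rewrite ler_pM2l // ler_pdivrMr //; lra.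
have e2 : (9 / 10 * me - 4 / 5 * t) ^+ 2 / t <= 7 / 500 * me.
  by rewrite ler_pdivrMr //; lra.
have mem : me <= 50 / 49 * m by move/ler_normlP: hm => [? ?]; lra.
have e3 : (9 / 10 * (me / m)) ^+ 2 * P <= 1 * (m / 100 / 100).
  have z0 : 0 <= 9 / 10 * (me / m) by rewrite mulr_ge0 ?divr_ge0 // ltW.
  have z1 : 9 / 10 * (me / m) <= 1 by rewrite mulrA ler_pdivrMr // mul1r; lra.
  by apply: ler_pM; rewrite ?sqr_ge0 // expr2; move: (_ * _) z0 z1 => z z0 z1; nra.
have num : m <= nu * m by rewrite ler_peMl // ltW.
have nume : nu * me <= nu * (50 / 49 * m) by rewrite ler_pM2l.
lra.
Qed.

Lemma tau_energy (k t u N : R) : 0 < k -> 0 < t -> 0 <= N -> k / t * u ^+ 2 <= N ->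
  u ^+ 2 <= N / (t * k) * t ^+ 2.
Proof.
move=> k0 t0 N0 h; have -> : N / (t * k) * t ^+ 2 = N * (t / k).
  by field; rewrite !gt_eqF.
rewrite -ler_pdivrMr ?divr_gt0 //; apply: le_trans h.
by rewrite invf_div mulrC.
Qed.

Variables (n : nat).
Implicit Types (u v w q x s : 'cV[R]_n).

(** Pythagoras for q = u + (q - u), where u is the primal part of a direction and W (q - u) the dual
    part: the cross terms <u, W (q - u)> and a b cancel against each other. *)
Lemma energy_identity (W : 'M[R]_n) u q (t k a b : R) : W^T = W -> 0 < t -> 0 < k ->
  dot u (W *m (q - u)) + a * b = 0 ->
  dot u (W *m u) + dot (q - u) (W *m (q - u)) + (k / t * a ^+ 2 + t / k * b ^+ 2) =
  dot q (W *m q) + (k * a + t * b) ^+ 2 / (t * k).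
Proof.
move=> sW t0 k0; rewrite !(mulmx_linE, dotE) (dot_sym q u sW) => h.
have -> : (k * a + t * b) ^+ 2 / (t * k) =
    k / t * a ^+ 2 + t / k * b ^+ 2 + 2 * (a * b) by field; rewrite !gt_eqF.
have -> : a * b = - (dot u (W *m q) - dot u (W *m u)) by apply/eqP; rewrite -addr_eq0 addrC h.
by ring.
Qed.

Section ScalingNorms.
Variables (W H : 'M[R]_n) (m rho : R).
Hypotheses (psdH : psd H) (m0 : 0 < m) (rho0 : 0 <= rho) (rho12 : rho <= 3 / 250).
Hypothesis WH : forall u v, `|dot u (W *m v) - m * dot u (H *m v)| <=
  9 * rho * m * (qnorm H u * qnorm H v).

Let c0 : 0 < 1 - 9 * rho. Proof. by move: rho12; lra. Qed.

Lemma scaling_lower v : (1 - 9 * rho) * m * qnorm H v ^+ 2 <= dot v (W *m v).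
Proof.
have /ler_normlP[+ _] := WH v v; rewrite -(qnorm_sqr v psdH).
move: (dot v _) (qnorm H v) => a b h; lra.
Qed.

Lemma scaling_upper v : dot v (W *m v) <= (1 + 9 * rho) * m * qnorm H v ^+ 2.
Proof.
have /ler_normlP[_ +] := WH v v; rewrite -(qnorm_sqr v psdH).
move: (dot v _) (qnorm H v) => a b h; lra.
Qed.

Lemma scaling_psd : psd W.
Proof.
move=> v; apply: le_trans (scaling_lower v).
by apply: mulr_ge0 (sqr_ge0 _); exact/ltW/mulr_gt0.
Qed.

Lemma scaling_posdef v : 0 < qnorm H v -> 0 < dot v (W *m v).
Proof.
move=> v0; apply: lt_le_trans (scaling_lower v).
by apply: mulr_gt0 (exprn_gt0 _ v0); exact: mulr_gt0.
Qed.

End ScalingNorms.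
End StepEstimates.

Lemma small_energy (R : realType) (m rho r : R) : 0 <= m -> 0 <= rho -> rho <= 1 / 500 ->
  0 <= r -> r <= rho -> (1 + 9 * rho) * m * r ^+ 2 <= m / 100 / 100.
Proof.
move=> m0 rho0 rho1 r0 rr; have r500 : r <= 1 / 500 by lra.
have r2 := ler_pM r0 r0 r500 r500.
have c0 : 0 <= 1 + 9 * rho by lra.
have c2 : 1 + 9 * rho <= 2 by lra.
have := ler_wpM2l m0 (ler_pM c0 (mulr_ge0 r0 r0) c2 r2); lra.
Qed.

Lemma le_sqr (R : realType) (a b : R) : 0 <= a -> a <= b -> a ^+ 2 <= b ^+ 2.
Proof. by move=> a0 ab; rewrite !expr2; exact: ler_pM. Qed.

Lemma le_of_sum4 (R : realType) (N a b c d : R) : a + b + (c + d) <= N ->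
  0 <= a -> 0 <= b -> 0 <= c -> 0 <= d -> [/\ a <= N, b <= N, c <= N & d <= N].
Proof. by move=> h a0 b0 c0 d0; split; lra. Qed.

(** * Size of the predictor direction *)

Section Predictor.
Variables (R : realType) (n : nat) (W H : 'M[R]_n) (nu m rho me t k : R).
Variables (x s st p dx ds : 'cV[R]_n) (dt dk : R).
Hypotheses (symW : W^T = W) (psdH : psd H) (nu1 : 1 <= nu) (m0 : 0 < m)
  (rho0 : 0 <= rho) (rho_small : rho <= 1 / 500).
Hypothesis WH : forall u v, `|dot u (W *m v) - m * dot u (H *m v)| <=
  9 * rho * m * (qnorm H u * qnorm H v).
Hypotheses (Wx : W *m x = s) (Wp : W *m p = s - m *: st) (xWp : dot x (W *m p) = 0)
  (xs : dot x s = nu * m) (xst : dot x st = nu) (p_rho : qnorm H p <= rho).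
Hypotheses (t0 : 0 < t) (k0 : 0 < k) (me0 : 0 < me)
  (meE : (nu + 1) * me = nu * m + t * k) (tk_close : `|t * k - me| <= me / 50).
Hypotheses (dirW : W *m dx + ds = - s + (9 / 10 * me) *: st)
  (dirt : t * dk + k * dt = - (t * k) + 9 / 10 * me)
  (skew : dot (dx + (1 / 10) *: x) (ds + (1 / 10) *: s) +
    (dt + t / 10) * (dk + k / 10) = 0).

Let rho12 : rho <= 3 / 250. Proof. by move: rho_small; lra. Qed.
Let psdW : psd W. Proof. exact: (scaling_psd psdH m0 rho12 WH). Qed.
Let nu0 : 0 < nu. Proof. by move: nu1; lra. Qed.

Lemma predictor_linear : dot x ds + dot s dx = - (nu * m) + 9 / 10 * me * nu.
Proof.
have := congr1 (dot x) dirW; rewrite !dotE xs xst (dot_sym _ _ symW) Wx.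
by rewrite [dot s dx]dotC addrC.
Qed.

(** In the expansion of [skew] the linear terms sum to - (nu + 1) me / 100 and cancel the constant
    ones. Hence mu^e is an affine function of the step length. *)
Lemma predictor_orthogonal : dot dx ds + dt * dk = 0.
Proof.
have := predictor_linear; move: skew; rewrite !dotE [dot dx s]dotC xs => h1 h2.
move: (dot dx ds) (dot x ds) (dot s dx) h1 h2 dirt meE => a b c; lra.
Qed.

Lemma predictor_energy :
  exists z, [/\ ds = W *m z, qnorm W dx <= 137 / 500 * qnorm W x,
    qnorm W z <= 137 / 500 * qnorm W x &
    k / t * (dt + t / 10) ^+ 2 <= 3 / 100 * (nu * m) /\
    t / k * (dk + k / 10) ^+ 2 <= 3 / 100 * (nu * m)].
Proof.
have [M ME] : exists M, M = me / m by eexists.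
have Mm : M * m = me by rewrite ME divfK // gt_eqF.
have [u uE] : exists u, u = dx + (1 / 10) *: x by eexists.
(* W q is the right-hand side for the direction shifted by z / 10, since me st = M (s - W p). *)
have [q qE] : exists q, q = (9 / 10 * M - 4 / 5) *: x - (9 / 10 * M) *: p by eexists.
have Wq : W *m q = - (4 / 5) *: s + (9 / 10 * me) *: st.
  rewrite qE !mulmx_linE Wx Wp -Mm.
  by apply/matrixP => i j; rewrite !mxE; ring.
have dsE : ds = W *m (q - u - (1 / 10) *: x).
  have -> : ds = (W *m dx + ds) - W *m dx by rewrite addrC addKr.
  rewrite dirW uE !(mulmx_linE, Wq) Wx.
  by move: (W *m dx) => a; apply/matrixP => i j; rewrite !mxE; field.
have vE : ds + (1 / 10) *: s = W *m (q - u).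
  by rewrite dsE [W *m (_ - (1 / 10) *: x)]mulmxBr mulmxZr Wx subrK.
have orth : dot u (W *m (q - u)) + (dt + t / 10) * (dk + k / 10) = 0.
  by rewrite -vE uE.
have := energy_identity symW t0 k0 orth.
have xWx : dot x (W *m x) = nu * m by rewrite Wx.
have qq : dot q (W *m q) =
    (9 / 10 * M - 4 / 5) ^+ 2 * (nu * m) + (9 / 10 * M) ^+ 2 * dot p (W *m p).
  rewrite qE !(mulmx_linE, dotE) xWx xWp (dot_sym p x symW) xWp; ring.
have kt : k * (dt + t / 10) + t * (dk + k / 10) = 9 / 10 * me - 4 / 5 * (t * k).
  by move: dirt; lra.
rewrite qq kt => en.
have P0 := psdW p.
have P1 : dot p (W *m p) <= m / 100 / 100.
  apply: le_trans (scaling_upper psdH WH p) _.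
  exact: small_energy (ltW m0) rho0 rho_small (qnorm_ge0 H p) p_rho.
have bound := predictor_energy_bound nu1 me0 m0 meE tk_close P0 P1.
rewrite -ME -en in bound.
have a1 := psdW u; have a2 := psdW (q - u).
have a3 : 0 <= k / t * (dt + t / 10) ^+ 2 by rewrite mulr_ge0 ?sqr_ge0 ?divr_ge0 // ltW.
have a4 : 0 <= t / k * (dk + k / 10) ^+ 2 by rewrite mulr_ge0 ?sqr_ge0 ?divr_ge0 // ltW.
have T0 := qnorm_ge0 W x.
have T2 : qnorm W x ^+ 2 = nu * m by rewrite (qnorm_sqr x psdW) Wx.
(* 87/500 exceeds the square root of 3/100; undoing the shift by z / 10 adds 1/10 and gives
   137/500. *)
have c87 : 0 <= 87 / 500 :> R by lra.
have c3 : 3 / 100 <= (87 / 500) ^+ 2 :> R by lra.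
have small w : dot w (W *m w) <= 3 / 100 * (nu * m) ->
    qnorm W (w - (1 / 10) *: x) <= 137 / 500 * qnorm W x.
  move=> hw; apply: le_trans (qnormB symW psdW _ _) _.
  rewrite qnormZ ger0_norm; last by lra.
  suff : qnorm W w <= 87 / 500 * qnorm W x by move: (qnorm W w) (qnorm W x) => a b; lra.
  apply: sqr_le_sqr; first exact: mulr_ge0 c87 T0.
  rewrite exprMn T2 (qnorm_sqr w psdW); apply: le_trans hw _.
  by apply: ler_wpM2r c3; exact/ltW/mulr_gt0.
have [b1 b2 b3 b4] := le_of_sum4 bound a1 a2 a3 a4.
exists (q - u - (1 / 10) *: x); split; [exact: dsE| | |by split].
- have -> : dx = u - (1 / 10) *: x by rewrite uE addrK.
  exact: small.
- exact: small.
Qed.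

(** Exchanging [W] for m H costs factors 1 - 9/500 and 1 + 9/500 under the square root, which 7/25
    in place of 137/500 absorbs. The bounds on dt and dk are crude but keep tau and kappa positive,
    as the step length times nu is 1/100. *)
Lemma predictor_bounds :
  [/\ qnorm H dx <= 7 / 25 * Num.sqrt nu,
    forall w, `|dot ds w| <= 7 / 25 * Num.sqrt nu * m * qnorm H w,
    `|dot dx ds| <= 2 / 25 * (nu * m)
    & `|dt + t / 10| <= nu * t /\ `|dk + k / 10| <= nu * k].
Proof.
have [z [dsE hdx hz [ht hk]]] := predictor_energy.
have T0 := qnorm_ge0 W x.
have T2 : qnorm W x ^+ 2 = nu * m by rewrite (qnorm_sqr x psdW) Wx.
have S0 := sqrtr_ge0 nu.
have c7 : 0 <= 7 / 25 :> R by lra.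
have c137 : (137 / 500) ^+ 2 <= 2 / 25 :> R by lra.
have c509 : 509 / 500 * (137 / 500) ^+ 2 <= (7 / 25) ^+ 2 :> R by lra.
have S2 : Num.sqrt nu ^+ 2 = nu by rewrite sqr_sqrtr // ltW.
split.
- apply: sqr_le_sqr; first exact: mulr_ge0 c7 S0.
  have h1 := scaling_lower psdH WH dx.
  have h2 := le_sqr (qnorm_ge0 W dx) hdx.
  rewrite exprMn T2 (qnorm_sqr dx psdW) in h2.
  have h3 : 491 / 500 * m * qnorm H dx ^+ 2 <= (1 - 9 * rho) * m * qnorm H dx ^+ 2.
    apply: ler_wpM2r; first exact: sqr_ge0.
    by apply: ler_wpM2r; [exact: ltW|move: rho_small; lra].
  have h4 := le_trans h3 (le_trans h1 h2).
  rewrite exprMn S2 -(ler_pM2l m0).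
  have -> : m * ((7 / 25) ^+ 2 * nu) = (7 / 25) ^+ 2 * (nu * m) by ring.
  move: (qnorm H dx ^+ 2) h4 => a; rewrite -[491 / 500 * m * a]mulrA.
  move: (m * a) (nu * m) (mulr_gt0 nu0 m0) => d e; lra.
- move=> w; rewrite dsE dotC.
  apply: le_trans (qnorm_CS symW psdW _ _) _.
  have h1 := ler_wpM2l (qnorm_ge0 W w) hz.
  apply: le_trans h1 _; apply: sqr_le_sqr.
    by apply: mulr_ge0 (qnorm_ge0 H w); apply: mulr_ge0 (ltW m0); exact: mulr_ge0.
  have h2 := scaling_upper psdH WH w.
  have h3 : (1 + 9 * rho) * m * qnorm H w ^+ 2 <= 509 / 500 * m * qnorm H w ^+ 2.
    apply: ler_wpM2r; first exact: sqr_ge0.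
    by apply: ler_wpM2r; [exact: ltW|move: rho_small; lra].
  have h4 := le_trans h2 h3.
  have -> : (qnorm W w * (137 / 500 * qnorm W x)) ^+ 2 =
      (137 / 500) ^+ 2 * (nu * m) * dot w (W *m w).
    by rewrite -T2 -(qnorm_sqr w psdW); ring.
  have -> : (7 / 25 * Num.sqrt nu * m * qnorm H w) ^+ 2 =
      (7 / 25) ^+ 2 * (nu * m * (m * qnorm H w ^+ 2)) by rewrite -[in RHS]S2; ring.
  have nm0 : 0 <= (137 / 500) ^+ 2 * (nu * m).
    by apply: mulr_ge0 (sqr_ge0 _) _; exact/ltW/mulr_gt0.
  apply: le_trans (ler_wpM2l nm0 h4) _.
  have -> : (137 / 500) ^+ 2 * (nu * m) * (509 / 500 * m * qnorm H w ^+ 2) =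
    509 / 500 * (137 / 500) ^+ 2 * (nu * m * (m * qnorm H w ^+ 2)) by ring.
  apply: ler_wpM2r; last exact: c509.
  by apply: mulr_ge0; [exact/ltW/mulr_gt0|apply: mulr_ge0 (ltW m0) (sqr_ge0 _)].
- rewrite dsE; apply: le_trans (qnorm_CS symW psdW _ _) _.
  have := ler_pM (qnorm_ge0 W dx) (qnorm_ge0 W z) hdx hz.
  have -> : 137 / 500 * qnorm W x * (137 / 500 * qnorm W x) =
    (137 / 500) ^+ 2 * (nu * m) by rewrite -T2; ring.
  move=> h; apply: le_trans h _; apply: ler_wpM2r; first exact/ltW/mulr_gt0.
  exact: c137.
- have hm := mu_mue_close nu1 me0 meE tk_close.
  have N0 : 0 <= 3 / 100 * (nu * m) by have := mulr_gt0 nu0 m0; lra.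
  have tk0 := mulr_gt0 t0 k0.
  have frac : 3 / 100 * (nu * m) / (t * k) <= nu ^+ 2.
    rewrite ler_pdivrMr //.
    have h1 : m <= 51 / 50 * me.
      have : me / 50 / nu <= me / 50 by rewrite ler_pdivrMr // ler_peMr // divr_ge0 // ltW.
      by move/ler_normlP: hm => [_ +]; move: (_ / nu) => a; lra.
    have h2 : m <= 2 * (t * k) by move/ler_normlP: tk_close => [+ _]; move: (t * k) me0 h1 => a; lra.
    have h3 : nu * m <= nu * (2 * (t * k)) by rewrite ler_pM2l.
    have h4 : nu * (t * k) <= nu ^+ 2 * (t * k).
      by rewrite ler_pM2r // expr2 ler_peMr // ltW.
    by move: (nu * m) (t * k) h3 h4 (mulr_gt0 nu0 tk0) => a b; lra.
  split.
    apply: sqr_le_sqr; first by rewrite mulr_ge0 // ltW.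
    rewrite real_normK ?num_real // exprMn; apply: le_trans (tau_energy k0 t0 N0 ht) _.
    by rewrite ler_wpM2r // sqr_ge0.
  apply: sqr_le_sqr; first by rewrite mulr_ge0 // ltW.
  rewrite real_normK ?num_real // exprMn; apply: le_trans (tau_energy t0 k0 N0 hk) _.
  by rewrite [k * t]mulrC ler_wpM2r // sqr_ge0.
Qed.

End Predictor.

(** * Scalar estimates for the predictor step *)

Section PredictorScalars.
Variable R : realType.

(* Throughout sg stands for 1 / sqrt nu, so that alpha = sg ^+ 2 / 100. *)
Lemma predictor_mu_close (nu sg m me mp e : R) : 0 < sg -> sg <= 1 -> nu * sg ^+ 2 = 1 ->
  0 < m -> `|m - me| <= me / 50 ->
  nu * mp = nu * m + sg ^+ 2 / 100 * (- (nu * m) + 9 / 10 * me * nu) +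
    (sg ^+ 2 / 100) ^+ 2 * e ->
  `|e| <= 2 / 25 * (nu * m) ->
  `|mp - m| <= 121 / 1000 / 100 * m * sg ^+ 2.
Proof.
move=> sg0 sg1 nusg m0 /ler_normlP[c1 c2] E he.
have q0 : 0 < sg ^+ 2 by exact: exprn_gt0.
have q1 : sg ^+ 2 <= 1 by rewrite expr_le1 // ltW.
have dE : mp - m = sg ^+ 2 * ((9 / 10 * me - m) / 100 + (sg ^+ 2) ^+ 2 * e / 100 / 100).
  have -> : mp - m = nu * sg ^+ 2 * (mp - m) by rewrite nusg mul1r.
  have -> : nu * sg ^+ 2 * (mp - m) = sg ^+ 2 * (nu * mp - nu * m) by ring.
  rewrite E.
  have -> : nu * m + sg ^+ 2 / 100 * (- (nu * m) + 9 / 10 * me * nu) +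
    (sg ^+ 2 / 100) ^+ 2 * e - nu * m =
    nu * sg ^+ 2 * ((9 / 10 * me - m) / 100) + (sg ^+ 2) ^+ 2 * e / 100 / 100.
    by field.
  by rewrite nusg mul1r.
rewrite dE normrM (gtr0_norm q0) mulrC ler_pM2r //.
have he2 : `|(sg ^+ 2) ^+ 2 * e| <= 2 / 25 * m.
  rewrite normrM ger0_norm ?sqr_ge0 //.
  have := ler_wpM2l (sqr_ge0 (sg ^+ 2)) he.
  have -> : (sg ^+ 2) ^+ 2 * (2 / 25 * (nu * m)) = nu * sg ^+ 2 * (2 / 25 * m * sg ^+ 2).
    by ring.
  rewrite nusg mul1r => h; apply: le_trans h _; rewrite ler_piMr //.
  by apply: mulr_ge0 (ltW m0); lra.
move/ler_normlP: he2 => [h1 h2]; move: (_ * e) h1 h2 => a h1 h2.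
by clear -c1 c2 h1 h2 m0; apply/ler_normlP; split; lra.
Qed.

(** At a test vector, a is the old residual, b the step in s, c the value of st and d the change of
    F'. In units of sg / 100 the four terms contribute about 0.206, 0.28, 0.121 and 0.3; the
    remainder pays for passing from m to [mp] and from the norm at x to that at the new point. *)
Lemma predictor_dual_sum (sg m mp V Vp h a b c d : R) : 0 < sg -> sg <= 1 -> 0 < m ->
  0 <= V -> `|mp - m| <= 121 / 1000 / 100 * m * sg ^+ 2 ->
  0 <= h -> h <= 7 / 25 / 100 * sg -> (1 - h) * V <= Vp ->
  `|a| <= 103 / 100 * (sg / 500) * m * V ->
  `|b| <= 7 / 25 / 100 * sg * m * V ->
  `|c| * sg <= V -> `|d| <= (h + 21 / 10 * h ^+ 2) * V ->
  `|a + b + (m - mp) * c + mp * d| <= sg / 100 * mp * Vp.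
Proof.
move=> sg0 sg1 m0 V0 hm h0 hsg VVp ha hb hc hd.
have sgm0 := mulr_gt0 sg0 m0.
have hs : h <= 1 / 300 by lra.
have m2 : m * sg ^+ 2 <= m by rewrite ler_piMr ?expr_le1 // ltW.
have [mp1 mp2] : 99 / 100 * m <= mp /\ mp <= 101 / 100 * m.
  by move/ler_normlP: hm => [k1 k2]; split; lra.
have mp0 : 0 < mp by lra.
have tc : `|(m - mp) * c| <= 121 / 1000 / 100 * (sg * m) * V.
  rewrite normrM distrC.
  have := ler_wpM2r (normr_ge0 c) hm => k; apply: le_trans k _.
  have -> : 121 / 1000 / 100 * m * sg ^+ 2 * `|c| =
    121 / 1000 / 100 * (sg * m) * (`|c| * sg) by ring.
  by apply: ler_wpM2l hc; apply: mulr_ge0 (ltW sgm0); lra.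
have td : `|mp * d| <= 3 / 1000 * (sg * mp) * V.
  rewrite normrM (gtr0_norm mp0).
  have k : h + 21 / 10 * h ^+ 2 <= 3 / 1000 * sg.
    have := ler_wpM2l h0 hs; rewrite expr2; lra.
  have := ler_wpM2l (ltW mp0) (le_trans hd (ler_wpM2r V0 k)); lra.
have sV0 : 0 <= sg * mp * V by rewrite !mulr_ge0 // ltW.
have smV : sg * m * V <= 100 / 99 * (sg * mp * V).
  have := ler_wpM2r V0 (ler_wpM2l (ltW sg0) mp1); lra.
have tot : `|a + b + (m - mp) * c + mp * d| <= 97 / 100 / 100 * (sg * mp * V).
  have n1 := ler_normD (a + b + (m - mp) * c) (mp * d).
  have n2 := ler_normD (a + b) ((m - mp) * c).
  have n3 := ler_normD a b.
  move: (`|a + b + (m - mp) * c + mp * d|) (`|a + b + (m - mp) * c|) (`|a + b|) n1 n2 n3.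
  move: (`|(m - mp) * c|) (`|mp * d|) tc td => tc td htc htd X Y Z n1 n2 n3.
  clear -ha hb htc htd n1 n2 n3 smV sV0; lra.
apply: le_trans tot _.
have k : (1 - 1 / 300) * V <= Vp.
  by apply: le_trans VVp; apply: ler_wpM2r => //; lra.
have := ler_wpM2l (ltW (mulr_gt0 sg0 mp0)) k; lra.
Qed.

(** The deviation tau kappa - mu^e is multiplied by 1 - sg^2 / 100, but mu^e only by 1 - sg^2 /
    1000. The gap pays for the second-order term and leaves the margin sg^2 / 100 / 100. *)
Lemma predictor_tk_close (sg nu t k dt dk me e : R) : 0 < sg -> sg <= 1 ->
  nu * sg ^+ 2 = 1 -> 0 < me -> `|t * k - me| <= me / 50 ->
  t * dk + k * dt = - (t * k) + 9 / 10 * me -> e + dt * dk = 0 ->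
  `|e| <= 1 / 10 * (nu * me) ->
  `|(t + sg ^+ 2 / 100 * dt) * (k + sg ^+ 2 / 100 * dk) - (1 - sg ^+ 2 / 1000) * me| <=
    (1 - sg ^+ 2 / 1000) * me * (1 / 50 - sg ^+ 2 / 100 / 100).
Proof.
move=> sg0 sg1 nusg me0 htk E orth he.
have q0 : 0 < sg ^+ 2 by exact: exprn_gt0.
have q1 : sg ^+ 2 <= 1 by rewrite expr_le1 // ltW.
have he2 : `|(sg ^+ 2) ^+ 2 * e| <= 1 / 10 * me * sg ^+ 2.
  rewrite normrM ger0_norm ?sqr_ge0 //.
  have := ler_wpM2l (sqr_ge0 (sg ^+ 2)) he.
  have -> : (sg ^+ 2) ^+ 2 * (1 / 10 * (nu * me)) = nu * sg ^+ 2 * (1 / 10 * me * sg ^+ 2).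
    by ring.
  by rewrite nusg mul1r.
have -> : (t + sg ^+ 2 / 100 * dt) * (k + sg ^+ 2 / 100 * dk) - (1 - sg ^+ 2 / 1000) * me =
    (1 - sg ^+ 2 / 100) * (t * k - me) - (sg ^+ 2) ^+ 2 * e / 100 / 100.
  have dd : dt * dk = - e by lra.
  have -> : (t + sg ^+ 2 / 100 * dt) * (k + sg ^+ 2 / 100 * dk) =
     t * k + sg ^+ 2 / 100 * (t * dk + k * dt) + (sg ^+ 2 / 100) ^+ 2 * (dt * dk) by ring.
  by rewrite E dd; field.
move: (t * k - me) htk (_ * e) he2 => a ha b hb; clear E orth he.
have n1 : `|(1 - sg ^+ 2 / 100) * a| <= (1 - sg ^+ 2 / 100) * (me / 50).
  by rewrite normrM ger0_norm; [apply: ler_wpM2l|]; lra.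
have q2 : 0 <= me * (sg ^+ 2) ^+ 2 by apply: mulr_ge0 (ltW me0) (sqr_ge0 _).
have mq := mulr_gt0 me0 q0.
move/ler_normlP: n1 => [c1 c2]; move/ler_normlP: hb => [c3 c4].
by clear -c1 c2 c3 c4 q2 mq; apply/ler_normlP; split; lra.
Qed.

Lemma predictor_positive (nu sg t dt : R) : 1 <= nu -> nu * sg ^+ 2 = 1 -> 0 < t ->
  `|dt + t / 10| <= nu * t -> 0 < t + sg ^+ 2 / 100 * dt.
Proof.
move=> nu1 nusg t0 /ler_normlP[h _].
have q0 : 0 <= sg ^+ 2 by exact: sqr_ge0.
have q1 : sg ^+ 2 <= 1 by have := ler_wpM2r q0 nu1; lra.
have := ler_wpM2l q0 h.
have -> : sg ^+ 2 * (nu * t) = nu * sg ^+ 2 * t by ring.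
rewrite nusg mul1r => h2.
have := ler_wpM2r (ltW t0) q1; lra.
Qed.

End PredictorScalars.

(** * Scalar estimates for the corrector step *)

Section CorrectorScalars.
Variable R : realType.

(** For such rho, (1 + 9 rho) / (1 - 9 rho) is below (11/10)^2 and 1 + 9 rho is below 11/10. *)
Lemma corrector_radius (m rho N e : R) : 0 < m -> 0 <= rho -> rho <= 21 / 20 / 100 -> 0 <= N ->
  (1 - 9 * rho) * m * N ^+ 2 <= e -> e <= (1 + 9 * rho) * m * rho ^+ 2 ->
  N <= 11 / 10 * rho /\ e <= 11 / 10 * m * rho ^+ 2.
Proof.
move=> m0 rho0 rho1 N0 h1 h2.
have m1 : 0 <= m * rho ^+ 2 by apply: mulr_ge0 (sqr_ge0 _); exact: ltW.
have m2 : 0 <= m * N ^+ 2 by apply: mulr_ge0 (sqr_ge0 _); exact: ltW.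
have e1 : e <= 219 / 200 * (m * rho ^+ 2).
  apply: le_trans h2 _; rewrite -mulrA; apply: ler_wpM2r => //; lra.
split; last by lra.
apply: sqr_le_sqr; first by apply: mulr_ge0 rho0; lra.
rewrite -(ler_pM2l m0).
have : 181 / 200 * (m * N ^+ 2) <= (1 - 9 * rho) * (m * N ^+ 2).
  by apply: ler_wpM2r => //; lra.
rewrite exprMn; lra.
Qed.

Lemma corrector_mu_close (nu sg m mp e : R) : 0 < sg -> sg <= 1 -> nu * sg ^+ 2 = 1 ->
  0 < m -> nu * mp = nu * m + e -> `|e| <= 11 / 20 * m * (21 / 20 / 100 * sg) ^+ 2 ->
  `|mp - m| <= m / 100 / 100 * sg ^+ 2.
Proof.
move=> sg0 sg1 nusg m0 E he.
have q0 : 0 < sg ^+ 2 by exact: exprn_gt0.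
have q1 : sg ^+ 2 <= 1 by rewrite expr_le1 // ltW.
have -> : mp - m = sg ^+ 2 * e.
  by rewrite -[LHS]mul1r -nusg mulrAC mulrBr E; ring.
rewrite normrM (gtr0_norm q0) mulrC ler_pM2r //; apply: le_trans he _.
have := ler_wpM2l (ltW m0) q1; have := mulr_gt0 m0 q0; rewrite exprMn; lra.
Qed.

(** At a test vector, c is the new st, d the Taylor remainder of F' and f the value of (W - m H) dx.
    All three terms are quadratic in the old radius, and f dominates. *)
Lemma corrector_dual_sum (sg m mp V Vp h c d f : R) : 0 < sg -> sg <= 1 -> 0 < m ->
  0 <= V -> `|mp - m| <= m / 100 / 100 * sg ^+ 2 ->
  0 <= h -> h <= 11 / 10 * (21 / 20 / 100 * sg) -> (1 - h) * V <= Vp ->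
  `|c| * sg <= Vp -> `|d| <= 21 / 10 * h ^+ 2 * V ->
  `|f| <= 9 * (21 / 20 / 100 * sg) * m * (V * h) ->
  `|(m - mp) * c + m * d - f| <= 4 / 25 / 100 * sg * mp * Vp.
Proof.
move=> sg0 sg1 m0 V0 hm h0 hsg VVp hc hd hf.
have q0 : 0 < sg ^+ 2 by exact: exprn_gt0.
have q1 : sg ^+ 2 <= sg by rewrite expr2 ler_piMr // ltW.
have h100 : h <= 3 / 250 by lra.
have Vp0 : 0 <= Vp by apply: le_trans VVp; apply: mulr_ge0 V0; lra.
have VVp2 : V <= 250 / 247 * Vp.
  have := ler_wpM2r V0 h100; lra.
have m2 : m * sg ^+ 2 <= m by rewrite ler_piMr ?expr_le1 // ltW.
have mp1 : m <= 100 / 99 * mp by move/ler_normlP: hm => [k1 k2]; lra.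
have h2 : h ^+ 2 <= (11 / 10 * (21 / 20 / 100 * sg)) ^+ 2 by exact: le_sqr.
have sgV0 : 0 <= sg * V by apply: mulr_ge0 V0; exact: ltW.
have sgVp0 : 0 <= sg * Vp by apply: mulr_ge0 Vp0; exact: ltW.
have sgVVp : sg * V <= 250 / 247 * (sg * Vp).
  have := ler_wpM2l (ltW sg0) VVp2; lra.
have q1V : sg ^+ 2 * V <= sg * V by exact: ler_wpM2r.
have td : `|d| <= 3 / 100 / 100 * (sg * V).
  apply: le_trans hd _; have := ler_wpM2r V0 h2; rewrite !exprMn; lra.
have tf : `|f| <= m * (11 / 100 / 100 * (sg * V)).
  apply: le_trans hf _.
  have -> : 9 * (21 / 20 / 100 * sg) * m * (V * h) = m * (9 * 21 / 20 / 100 * (sg * V) * h) by ring.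
  apply: ler_wpM2l; first exact: ltW.
  have := ler_wpM2l sgV0 hsg; have -> : sg * V * (11 / 10 * (21 / 20 / 100 * sg)) =
    11 / 10 * (21 / 20 / 100) * (sg ^+ 2 * V) by ring.
  by move: (sg * V * h) (sg ^+ 2 * V) (sg * V) q1V sgV0 => a b e *; lra.
have tc : `|(m - mp) * c| <= m * (1 / 100 / 100 * (sg * Vp)).
  rewrite normrM distrC.
  have := ler_wpM2r (normr_ge0 c) hm => k; apply: le_trans k _.
  have -> : m / 100 / 100 * sg ^+ 2 * `|c| = m * (1 / 100 / 100 * (sg * (`|c| * sg))) by ring.
  apply: ler_wpM2l; first exact: ltW.
  apply: ler_wpM2l; first by lra.
  by apply: ler_wpM2l; first exact: ltW.
have tot : `|(m - mp) * c + m * d - f| <= m * (153 / 100 / 100 / 10 * (sg * Vp)).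
  have n1 := ler_normB ((m - mp) * c + m * d) f.
  have n2 := ler_normD ((m - mp) * c) (m * d).
  rewrite [`|m * d|]normrM (gtr0_norm m0) in n2.
  have td2 := ler_wpM2l (ltW m0) td.
  have sv2 := ler_wpM2l (ltW m0) sgVVp.
  have sv0 := mulr_ge0 (ltW m0) sgVp0.
  lra.
apply: le_trans tot _.
have -> : 4 / 25 / 100 * sg * mp * Vp = mp * (4 / 25 / 100 * (sg * Vp)) by ring.
have := ler_wpM2r sgVp0 mp1; have := mulr_ge0 (ltW m0) sgVp0; lra.
Qed.

(** tau kappa changes only by dt dk, which fits into the margin sg^2 / 100 / 100 left by the
    predictor. *)
Lemma corrector_tk_close (nu sg m t k dt dk me : R) : 1 <= nu -> 0 < sg -> sg <= 1 ->
  nu * sg ^+ 2 = 1 -> 0 < me -> (nu + 1) * me = nu * m + t * k ->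
  `|t * k - me| <= me * (1 / 50 - sg ^+ 2 / 100 / 100) ->
  t * dk + k * dt = 0 -> `|dt * dk| <= 11 / 20 * m * (21 / 20 / 100 * sg) ^+ 2 ->
  `|(t + dt) * (k + dk) - me| <= me / 50.
Proof.
move=> nu1 sg0 sg1 nusg me0 meE tk E hd.
have q0 : 0 < sg ^+ 2 by exact: exprn_gt0.
have meq := mulr_gt0 me0 q0.
have tk50 : `|t * k - me| <= me / 50 by apply: le_trans tk _; lra.
have hm := mu_mue_close nu1 me0 meE tk50.
have m2 : m <= 51 / 50 * me.
  have : me / 50 / nu <= me / 50.
    by rewrite ler_pdivrMr ?ler_peMr // ?divr_ge0 ?(ltW me0) //; lra.
  by move/ler_normlP: hm => [_ +]; move: (_ / nu) => a; lra.
have -> : (t + dt) * (k + dk) - me = (t * k - me) + dt * dk.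
  by have := E; lra.
apply: le_trans (ler_normD _ _) _; apply: le_trans (lerD tk hd) _.
have := ler_wpM2r (ltW q0) m2; rewrite exprMn; lra.
Qed.

Lemma corrector_positive (m rho t k dt : R) : 0 < t -> 0 < k -> 0 < m -> m <= 2 * (t * k) ->
  0 <= rho -> rho <= 1 / 10 -> k / t * dt ^+ 2 <= 11 / 10 * m * rho ^+ 2 -> 0 < t + dt.
Proof.
move=> t0 k0 m0 mtk rho0 rho1 h.
have tk0 := mulr_gt0 t0 k0.
have N0 : 0 <= 11 / 10 * m * rho ^+ 2.
  by apply: mulr_ge0 (sqr_ge0 _); apply: mulr_ge0 (ltW m0); lra.
have h2 := tau_energy k0 t0 N0 h.
have r2 : rho ^+ 2 <= (1 / 10) ^+ 2 by exact: le_sqr.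
have frac : 11 / 10 * m * rho ^+ 2 / (t * k) <= (1 / 2) ^+ 2.
  rewrite ler_pdivrMr //; have := ler_wpM2l (ltW m0) r2; lra.
have h3 := le_trans h2 (ler_wpM2r (sqr_ge0 t) frac).
have : `|dt| <= 1 / 2 * t.
  apply: sqr_le_sqr; first by apply: mulr_ge0 (ltW t0); lra.
  by rewrite real_normK ?num_real // exprMn.
by move/ler_normlP => [c1 _]; lra.
Qed.

Lemma mu_le_twice_tk (nu m t me : R) : 1 <= nu -> 0 < me -> (nu + 1) * me = nu * m + t ->
  `|t - me| <= me / 50 -> m <= 2 * t.
Proof.
move=> nu1 me0 meE ht; have := mu_mue_close nu1 me0 meE ht.
have : me / 50 / nu <= me / 50.
  by rewrite ler_pdivrMr ?ler_peMr // ?divr_ge0 ?(ltW me0) //; lra.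
move: (me / 50 / nu) => a ha /ler_normlP[_ h]; move/ler_normlP: ht => [c1 _]; lra.
Qed.

End CorrectorScalars.

(** * Size of the corrector direction *)

Section Corrector.
Variables (R : realType) (n : nat) (W H : 'M[R]_n) (nu m rho t k : R).
Variables (x s st p dx ds : 'cV[R]_n) (dt dk : R).
Hypotheses (symW : W^T = W) (psdH : psd H) (m0 : 0 < m)
  (rho0 : 0 <= rho) (rho_small : rho <= 21 / 20 / 100).
Hypothesis WH : forall u v, `|dot u (W *m v) - m * dot u (H *m v)| <=
  9 * rho * m * (qnorm H u * qnorm H v).
Hypotheses (Wx : W *m x = s) (Wp : W *m p = s - m *: st) (p_rho : qnorm H p <= rho).
Hypotheses (t0 : 0 < t) (k0 : 0 < k).
Hypotheses (dirW : W *m dx + ds = m *: st - s) (dirt : t * dk + k * dt = 0)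
  (skew : dot dx ds + dt * dk = 0).

(** The right-hand side is - W p, so the energy identity with q = - p bounds everything by <p, W p>.
    As t dk = - k dt, the two scalar energies both equal - dt dk, which halves the bound on the
    product. *)
Lemma corrector_bounds : [/\ qnorm H dx <= 11 / 10 * rho,
  `|dt * dk| <= 11 / 20 * m * rho ^+ 2,
  k / t * dt ^+ 2 <= 11 / 10 * m * rho ^+ 2 &
  t / k * dk ^+ 2 <= 11 / 10 * m * rho ^+ 2].
Proof.
have rho12 : rho <= 3 / 250 by move: rho_small; lra.
have psdW := scaling_psd psdH m0 rho12 WH.
have dsE : ds = W *m (- p - dx).
  have -> : ds = (W *m dx + ds) - W *m dx by rewrite addrC addKr.
  by rewrite dirW mulmxBr mulmxN Wp opprB.
have orth : dot dx (W *m (- p - dx)) + dt * dk = 0 by rewrite -dsE.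
have := energy_identity symW t0 k0 orth.
rewrite [k * dt + _]addrC dirt expr0n /= mul0r addr0.
have -> : dot (- p) (W *m - p) = dot p (W *m p) by rewrite mulmxN dotNl dotNr opprK.
move=> en.
have P1 : dot p (W *m p) <= (1 + 9 * rho) * m * rho ^+ 2.
  apply: le_trans (scaling_upper psdH WH p) _.
  apply: ler_wpM2l; last exact: le_sqr (qnorm_ge0 H p) p_rho.
  by apply: mulr_ge0 (ltW m0); move: rho0; lra.
have a1 := psdW dx; have a2 := psdW (- p - dx).
have a3 : 0 <= k / t * dt ^+ 2 by rewrite mulr_ge0 ?sqr_ge0 ?divr_ge0 // ltW.
have a4 : 0 <= t / k * dk ^+ 2 by rewrite mulr_ge0 ?sqr_ge0 ?divr_ge0 // ltW.
have ee : k / t * dt ^+ 2 + t / k * dk ^+ 2 <= dot p (W *m p) by rewrite -en lerDr addr_ge0.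
have enle := lexx (dot p (W *m p)); rewrite -{1}en in enle.
have [b1 _ _ _] := le_of_sum4 enle a1 a2 a3 a4.
have [N1 _] := corrector_radius m0 rho0 rho_small (qnorm_ge0 H dx)
  (scaling_lower psdH WH dx) (le_trans b1 P1).
(* Only the energy half of [corrector_radius] is wanted here, hence N = 0. *)
have z1 : (1 - 9 * rho) * m * 0 ^+ 2 <= dot p (W *m p).
  by rewrite expr0n mulr0; exact: psdW.
have [_ e1] := corrector_radius m0 rho0 rho_small (lexx 0) z1 P1.
have dd1 : dt * dk = - (k / t * dt ^+ 2).
  have -> : dk = - (k * dt) / t.
    by move: dirt => /eqP; rewrite addr_eq0 => /eqP <-; field; rewrite gt_eqF.
  by field; rewrite gt_eqF.
have dd2 : dt * dk = - (t / k * dk ^+ 2).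
  have -> : dt = - (t * dk) / k.
    by move: dirt => /eqP; rewrite addrC addr_eq0 => /eqP <-; field; rewrite gt_eqF.
  by field; rewrite gt_eqF.
move: (dot p _) (k / t * _) (t / k * _) ee e1 a3 a4 dd1 dd2 => P a b ee e1 a3 a4 dd1 dd2.
have e2 : a + b <= 11 / 10 * m * rho ^+ 2 by exact: le_trans ee e1.
have ab : a = b by apply: oppr_inj; rewrite -dd1 -dd2.
split; first exact: N1.
- rewrite dd1 normrN ger0_norm //; rewrite -ab in e2.
  have half (c : R) : a + a <= 11 / 10 * c -> a <= 11 / 20 * c by lra.
  by rewrite -mulrA; apply: half; rewrite mulrA.
- by apply: le_trans e2; rewrite lerDl.
- by apply: le_trans e2; rewrite lerDr.
Qed.

End Corrector.

(** * Barriers and their conjugates *)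

(* Keeps unification from unfolding derivatives. *)
#[local] Opaque hessian gradient dot.

Section Barrier.
Variables (R : realType) (n : nat) (K : set 'cV[R]_n) (nu : R) (F : 'cV[R]_n -> R).
Hypotheses (pK : proper_cone K) (bF : lhscb K nu F).
Implicit Types (x y u v : 'cV[R]_n) (t : R).

Lemma near_interior_line (A : set 'cV[R]_n) x v : A° x ->
  \forall s \near (0 : R), A° (x + s *: v).
Proof.
move=> /nbhs_interior/interior_normP[e e0 eA].
have c0 : 0 < e / (`|v| + 1) by rewrite divr_gt0 // ltr_wpDl.
apply: (filterS _ (@nbhs0_lt R R^o _ c0)) => s.
rewrite ltr_pdivlMr ?ltr_wpDl // => h; apply: eA; rewrite addrC addKr normrZ.
by apply: le_lt_trans h; rewrite ler_wpM2l // lerDl.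
Qed.

Lemma barrier_diff x : K° x -> differentiable F x.
Proof. by case: bF => d _ _ _ _ /d[]. Qed.

Lemma barrier_diff_gradient x : K° x -> differentiable (gradient F) x.
Proof. by case: bF => d _ _ _ _ /d[]. Qed.

Lemma barrier_is_derive_line x v t : K° (x + t *: v) ->
  is_derive t 1 (fun s : R => F (x + s *: v)) (dot (gradient F (x + t *: v)) v).
Proof.
move=> Kx; rewrite -derive_gradient; last exact: barrier_diff.
by apply: is_derive_line; apply/diff_derivable/barrier_diff.
Qed.

Lemma barrier_is_derive_gradient_line x u v t : K° (x + t *: v) ->
  is_derive t 1 (fun s : R => dot (gradient F (x + s *: v)) u)
    (dot u (hessian F (x + t *: v) *m v)).
Proof. by move=> Kx; apply/is_derive_gradient_line/barrier_diff_gradient. Qed.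

Lemma gradient_MVT x y u : K° x -> K° y ->
  exists2 t, 0 < t < 1 & dot (gradient F y - gradient F x) u =
    dot u (hessian F (x + t *: (y - x)) *m (y - x)).
Proof.
move=> Kx Ky.
have [t t01|t t01] := @MVT_line R (fun s : R => dot (gradient F (x + s *: (y - x))) u)
    (fun t => dot u (hessian F (x + t *: (y - x)) *m (y - x))).
  exact/barrier_is_derive_gradient_line/interior_cone_segment.
by rewrite scale1r scale0r addr0 addrCA subrr addr0 -dotBl => ->; exists t.
Qed.

Lemma barrier_MVT x y : K° x -> K° y ->
  exists2 t, 0 < t < 1 & F y - F x = dot (gradient F (x + t *: (y - x))) (y - x).
Proof.
move=> Kx Ky.
have [t t01|t t01] := @MVT_line R (fun s : R => F (x + s *: (y - x)))
    (fun t => dot (gradient F (x + t *: (y - x))) (y - x)).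
  exact/barrier_is_derive_line/interior_cone_segment.
by rewrite scale1r scale0r addr0 addrCA subrr addr0 => ->; exists t.
Qed.

(** Otherwise every multiple of v has local norm 0, and the Dikin ellipsoid contains a whole line,
    which a proper cone cannot. *)
Lemma hessian_posdef x v : K° x -> v != 0 -> 0 < dot v (hessian F x *m v).
Proof.
move=> Kx v0; rewrite ltNge; apply/negP => Hv.
suff : v = 0 by move/eqP: v0.
apply: (cone_no_line pK (x := x)) => t; apply: interior_subset.
apply: (lhscb_dikin bF Kx); rewrite addrC addKr.
have -> : local_norm F x (t *: v) = qnorm (hessian F x) (t *: v) by [].
by rewrite qnormZ /qnorm ler0_sqrtr // mulr0.
Qed.

Lemma hessian_psd x : K° x -> psd (hessian F x).
Proof.
move=> Kx v; have [->|v0] := eqVneq v 0; first by rewrite dot0l.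
exact/ltW/hessian_posdef.
Qed.

(** The mean value theorem along u, then along v. The set A keeps track of where the intermediate
    point lies. *)
Lemma mixed_difference (A : set 'cV[R]_n) x u v : A `<=` K° ->
  (forall a b, 0 <= a <= 1 -> 0 <= b <= 1 -> A (x + a *: u + b *: v)) ->
  exists2 y, A y & F (x + u + v) - F (x + u) - F (x + v) + F x =
    dot u (hessian F y *m v).
Proof.
move=> AK Ain; have Kin a b a01 b01 := AK _ (Ain a b a01 b01).
have z01 : 0 <= (0 : R) <= 1 by rewrite lexx ler01.
have o01 : 0 <= (1 : R) <= 1 by rewrite lexx ler01.
have [a|a a01] := @MVT_line R
  (fun s : R => F (x + v + s *: u) - F (x + s *: u))
  (fun s => dot (gradient F (x + v + s *: u)) u - dot (gradient F (x + s *: u)) u).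
  move=> a01; apply: is_deriveB; apply: barrier_is_derive_line.
    by have := Kin a 1 a01 o01; rewrite scale1r addrAC.
  by have := Kin a 0 a01 z01; rewrite scale0r addr0.
have {}a01 : 0 <= a <= 1 by case/andP: a01 => /ltW -> /ltW ->.
rewrite !scale1r !scale0r !addr0.
have [b|b b01] := @MVT_line R
  (fun s : R => dot (gradient F (x + a *: u + s *: v)) u)
  (fun s => dot u (hessian F (x + a *: u + s *: v) *m v)).
  by move=> b01; apply: barrier_is_derive_gradient_line; exact: Kin.
rewrite scale1r scale0r addr0 => E1 E2; exists (x + a *: u + b *: v).
  by apply: Ain => //; case/andP: b01 => /ltW -> /ltW ->.
by rewrite -E1 [_ + a *: u + v]addrAC -E2 [x + v + u]addrAC; ring.
Qed.

(** Schwarz's argument: the mixed difference over a small square is t^2 times an (i, j) entry at one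
    nearby point and t^2 times a (j, i) entry at another. The Hessian, being differentiable, is
    continuous, so both entries are close to those at x. *)
Lemma hessian_sym x : K° x -> (hessian F x)^T = hessian F x.
Proof.
move=> Kx; apply/matrixP => i j; rewrite mxE.
have cvH : {for x, continuous (hessian F)}.
  by apply: differentiable_continuous; case: bF => d _ _ _ _; case: (d _ Kx).
have cH k l e : 0 < e -> \forall y \near x, `|hessian F y k l - hessian F x k l| < e.
  move=> e0; have cv : {for x, continuous (fun y => hessian F y k l)}.
    apply: (@continuous_comp _ _ _ (hessian F) (fun M : 'M[R]_n => M k l) x cvH).
    exact: coord_continuous.
  have nb : nbhs x [set y | ball (hessian F x k l : R) e (hessian F y k l)].
    exact: cv _ (nbhsx_ballx (hessian F x k l : R) e e0).
  have flip (a b : R) : `|a - b| < e -> `|b - a| < e by rewrite distrC.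
  apply: filterS nb => y yb; exact: flip _ _ yb.
apply/eqP; rewrite -subr_eq0 -normr_eq0 eq_le normr_ge0 andbT.
apply/ler_addgt0Pl => e e0; rewrite addr0.
have e2 : 0 < e / 2 by rewrite divr_gt0.
pose A : set 'cV[R]_n := [set y | [/\ K° y,
    `|hessian F y i j - hessian F x i j| < e / 2 &
    `|hessian F y j i - hessian F x j i| < e / 2]].
have /interior_normP[r r0 rA] : A° x.
  have Kx' : nbhs x K° by exact: nbhs_interior.
  near=> y; split; near: y; [exact: Kx'|exact: cH|exact: cH].
have AK : A `<=` K° by move=> y [].
have A1 y : A y -> `|hessian F y i j - hessian F x i j| < e / 2 by case.
have A2 y : A y -> `|hessian F y j i - hessian F x j i| < e / 2 by case.
clearbody A.
have [U UE] : exists U : 'cV[R]_n, U = delta_mx i 0 by eexists.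
have [V VE] : exists V : 'cV[R]_n, V = delta_mx j 0 by eexists.
have [t t0 tE] : exists2 t, 0 < t & t * (`|U| + `|V| + 1) = r.
  have UV0 : 0 < `|U| + `|V| + 1 by rewrite ltr_wpDl ?addr_ge0.
  by exists (r / (`|U| + `|V| + 1)); rewrite ?divr_gt0 // mulfVK // lt0r_neq0.
have close a b : 0 <= a <= 1 -> 0 <= b <= 1 -> A (x + a *: (t *: U) + b *: (t *: V)).
  move=> /andP[a0 a1] /andP[b0 b1]; apply: rA.
  rewrite -[x + _ + _]addrA [x + _]addrC addrK (le_lt_trans (ler_normD _ _)) // !normrZ.
  rewrite (ger0_norm a0) (ger0_norm b0) (gtr0_norm t0) -tE.
  have tU : 0 <= t * `|U| by rewrite mulr_ge0 // ltW.
  have tV : 0 <= t * `|V| by rewrite mulr_ge0 // ltW.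
  by nra.
have entry k l y : dot (t *: delta_mx k 0) (hessian F y *m (t *: delta_mx l 0)) =
    t ^+ 2 * hessian F y k l.
  by rewrite mulmxZr dotZl dotZr dotC dot_delta -colE mxE expr2 mulrA.
have [y /A1 h1 E1] := mixed_difference AK close.
have [z /A2 h2 E2] : exists2 z, A z &
    F (x + t *: V + t *: U) - F (x + t *: V) - F (x + t *: U) + F x =
    dot (t *: V) (hessian F z *m (t *: U)).
  by apply: mixed_difference AK _ => a b a01 b01; have := close b a b01 a01; rewrite addrAC.
have E : hessian F z j i = hessian F y i j.
  have t2 : t ^+ 2 != 0 by rewrite expf_neq0 // lt0r_neq0.
  apply: (mulfI t2).
  rewrite -(entry j i z) -(entry i j y) -UE -VE -E1 -E2.
  by rewrite [x + t *: V + t *: U]addrAC; ring.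
have triangle (p p' q s : R) : `|p - q| < e / 2 -> `|p' - s| < e / 2 -> p = p' ->
    `|q - s| <= e.
  move=> /ltr_normlP[a1 a2] /ltr_normlP[a3 a4] pp.
  by apply/ler_normlP; split; lra.
exact: triangle h2 h1 E.
Unshelve. all: by end_near. Qed.

End Barrier.

(** * Homogeneity and self-concordance *)

Section BarrierCalculus.
Variables (R : realType) (n : nat) (K : set 'cV[R]_n) (nu : R) (F : 'cV[R]_n -> R).
Hypotheses (pK : proper_cone K) (bF : lhscb K nu F).
Implicit Types (x y u v : 'cV[R]_n) (t : R).

Lemma gradientZ t x : 0 < t -> K° x -> gradient F (t *: x) = t^-1 *: gradient F x.
Proof.
move=> t0 Kx; apply: dot_inj => u; rewrite dotZr !(dotC u).
have K0 : K° (x + (0 : R) *: u) by rewrite scale0r addr0.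
have Kt0 : K° (t *: x + (0 : R) *: (t *: u)).
  by rewrite scale0r addr0; exact: interior_coneZ.
have d1 := barrier_is_derive_line bF Kt0.
have d2 := is_deriveB (barrier_is_derive_line bF K0) (is_derive_cst (nu * ln t) (0 : R) 1).
have nE : \forall s \near (0 : R),
    F (x + s *: u) - nu * ln t = F (t *: x + s *: (t *: u)).
  apply: (filterS _ (near_interior_line u Kx)) => s Ks.
  have -> : t *: x + s *: (t *: u) = t *: (x + s *: u).
    by rewrite scalerDr !scalerA (mulrC s).
  by rewrite (lhscb_log_homogeneous bF).
have d3 := near_eq_is_derive nE d2.
have := etrans (esym (@derive_val _ _ _ _ _ _ _ d1)) (@derive_val _ _ _ _ _ _ _ d3).
rewrite !scale0r !addr0 subr0 dotZr => <-.
by rewrite mulrA mulVf ?mul1r // lt0r_neq0.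
Qed.

Let near_pos : \forall s \near (1 : R), 0 < s.
Proof. by apply: lt_nbhsr; exact: ltr01. Qed.

(** Euler's identity: F (s x) = F x - nu ln s is differentiated at s = 1. *)
Lemma dot_gradient_self x : K° x -> dot (gradient F x) x = - nu.
Proof.
move=> Kx; have K1 : K° (0 + (1 : R) *: x) by rewrite scale1r add0r.
have d1 := barrier_is_derive_line bF K1.
have d2 : is_derive (1 : R) 1 (fun s : R => F x - nu * ln s) (- nu).
  have := is_deriveB (is_derive_cst (F x) (1 : R) 1)
    (is_deriveZ nu (is_derive1_ln ltr01)).
  by rewrite invr1 sub0r [nu *: _]mulr1.
have nE : \forall s \near (1 : R), F x - nu * ln s = F (0 + s *: x).
  apply: (filterS _ near_pos) => s s0.
  by rewrite add0r (lhscb_log_homogeneous bF).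
have d3 := near_eq_is_derive nE d2.
have := etrans (esym (@derive_val _ _ _ _ _ _ _ d1)) (@derive_val _ _ _ _ _ _ _ d3).
by rewrite scale1r add0r.
Qed.

(** The relation F'(s x) = F'(x) / s is differentiated at s = 1. *)
Lemma hessian_mul_self x : K° x -> hessian F x *m x = - gradient F x.
Proof.
move=> Kx; apply: dot_inj => u; rewrite dotNr.
have K1 : K° (0 + (1 : R) *: x) by rewrite scale1r add0r.
have d1 := barrier_is_derive_gradient_line bF u K1.
have d2 : is_derive (1 : R) 1 (fun s : R => dot (gradient F x) u * s^-1)
    (- dot (gradient F x) u).
  have dV : is_derive (1 : R) 1 (fun s : R => s^-1) (-1).
    have := @is_deriveV R id 1 1 1 (oner_neq0 _) (is_derive_id _ _).
    by rewrite expr1n invr1 scaleN1r.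
  by have := is_deriveZ (dot (gradient F x) u) dV; rewrite [_ *: -1]mulrN1.
have nE : \forall s \near (1 : R),
    dot (gradient F x) u * s^-1 = dot (gradient F (0 + s *: x)) u.
  apply: (filterS _ near_pos) => s s0.
  by rewrite add0r gradientZ // dotZl mulrC.
have d3 := near_eq_is_derive nE d2.
have := etrans (esym (@derive_val _ _ _ _ _ _ _ d1)) (@derive_val _ _ _ _ _ _ _ d3).
by rewrite scale1r add0r (dotC u (gradient _ _)).
Qed.

Lemma dot_hessian_self x v : K° x -> dot x (hessian F x *m v) = - dot (gradient F x) v.
Proof.
by move=> Kx; rewrite (dot_sym _ _ (hessian_sym bF Kx)) hessian_mul_self // dotNr dotC.
Qed.

Lemma lnormE x v : local_norm F x v = qnorm (hessian F x) v.
Proof. by []. Qed.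

Lemma lnorm_ge0 x v : 0 <= local_norm F x v.
Proof. exact: qnorm_ge0. Qed.

Lemma lnorm0 x : local_norm F x 0 = 0.
Proof. exact: qnorm0. Qed.

Lemma lnormZ x a v : local_norm F x (a *: v) = `|a| * local_norm F x v.
Proof. exact: qnormZ. Qed.

Lemma lnormN x v : local_norm F x (- v) = local_norm F x v.
Proof. exact: qnormN. Qed.

Lemma lnorm_sqr x v : K° x -> local_norm F x v ^+ 2 = dot v (hessian F x *m v).
Proof. by move=> Kx; exact/qnorm_sqr/(hessian_psd pK bF). Qed.

Lemma lnorm_gt0 x v : K° x -> v != 0 -> 0 < local_norm F x v.
Proof. by move=> Kx v0; rewrite sqrtr_gt0; exact: (hessian_posdef pK bF). Qed.

Lemma lnorm_CS x u v : K° x ->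
  `|dot u (hessian F x *m v)| <= local_norm F x u * local_norm F x v.
Proof.
by move=> Kx; apply: qnorm_CS; [exact: (hessian_sym bF)|exact: (hessian_psd pK bF)].
Qed.

Lemma lnormD x u v : K° x ->
  local_norm F x (u + v) <= local_norm F x u + local_norm F x v.
Proof.
by move=> Kx; apply: qnormD; [exact: (hessian_sym bF)|exact: (hessian_psd pK bF)].
Qed.

Lemma lnorm_self_sqr x : K° x -> local_norm F x x ^+ 2 = nu.
Proof. by move=> Kx; rewrite lnorm_sqr // dot_hessian_self // dot_gradient_self ?opprK. Qed.

(** The origin is at local distance |x|_x = sqrt nu from x; nu < 1 would put it in the Dikin
    ellipsoid and hence in the interior of K. *)
Lemma barrier_parameter_ge1 : (0 < n)%N -> 1 <= nu.
Proof.
move=> n0; case: (pK) => _ _ _ _ [x Kx].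
rewrite leNgt; apply/negP => nu1.
suff /(interior_cone_neq0 pK n0)/eqP : K° 0 by [].
apply: (lhscb_dikin bF Kx); rewrite sub0r lnormN.
have := lnorm_self_sqr Kx; have := lnorm_ge0 x x.
by move: (local_norm F x x) => a a0 a2; nra.
Qed.

Section SelfConcordance.
Variables x y : 'cV[R]_n.
Hypotheses (Kx : K° x) (Ky : K° y).
Let r := local_norm F x (y - x).
Hypothesis r1 : r < 1.

Lemma lnorm_sc v : (1 - r) * local_norm F y v <= local_norm F x v /\
  (1 - r) * local_norm F x v <= local_norm F y v.
Proof.
have [h1 h2] := lhscb_self_concordant bF Kx Ky r1.
have r0 : 0 < 1 - r by rewrite subr_gt0.
split.
  exact: (qnorm_loewner_lower v (hessian_psd pK bF Ky) (hessian_psd pK bF Kx) r0 h1).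
exact: (qnorm_loewner_upper v (hessian_psd pK bF Kx) (hessian_psd pK bF Ky) r0 h2).
Qed.

Lemma hessian_sc u v : `|dot u ((hessian F y - hessian F x) *m v)| <=
  ((1 - r) ^- 2 - 1) * (local_norm F x u * local_norm F x v).
Proof.
have [h1 h2] := lhscb_self_concordant bF Kx Ky r1.
have r0 : 0 <= r by exact: lnorm_ge0.
have q01 : 0 < (1 - r) ^+ 2 <= 1.
  by rewrite exprn_gt0 ?subr_gt0 //=; move: (r) r0 r1 => a; nra.
exact: (loewner_bilinear_bound u v (hessian_psd pK bF Kx) (hessian_psd pK bF Ky)
  (hessian_sym bF Kx) (hessian_sym bF Ky) q01 h1 h2).
Qed.

End SelfConcordance.

Lemma lnorm_segment x y t : 0 <= t ->
  local_norm F x (x + t *: (y - x) - x) = t * local_norm F x (y - x).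
Proof. by move=> t0; rewrite addrC addKr lnormZ ger0_norm. Qed.

Lemma gradient_sc x y u : K° x -> K° y -> local_norm F x (y - x) < 1 ->
  `|dot (gradient F y - gradient F x) u - dot u (hessian F x *m (y - x))| <=
  ((1 - local_norm F x (y - x)) ^- 2 - 1) * (local_norm F x u * local_norm F x (y - x)).
Proof.
move=> Kx Ky; have := @hessian_sc x; have r0 := lnorm_ge0 x (y - x).
set r := local_norm F x (y - x) in r0 * => sc r1.
have [t /andP[t0 t1] ->] := gradient_MVT pK bF u Kx Ky.
have t01 : 0 <= t <= 1 by rewrite !ltW.
have Kt := interior_cone_segment pK t01 Kx Ky.
have rt : local_norm F x (x + t *: (y - x) - x) = t * r by rewrite lnorm_segment ?ltW.
move: (x + _) Kt rt => z Kz rz.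
have tr0 : 0 <= t * r by rewrite mulr_ge0 // ltW.
have tr : t * r <= r by rewrite ler_piMl // ltW.
rewrite -dotBr -mulmxBl; apply: le_trans (sc z Kx Kz _ u _) _; rewrite rz.
  by apply: le_lt_trans r1.
apply: ler_wpM2r; first by rewrite mulr_ge0 // lnorm_ge0.
rewrite lerB // lef_pV2 ?posrE ?exprn_gt0 ?subr_gt0 //; last exact: le_lt_trans r1.
by rewrite ler_pXn2r ?nnegrE ?subr_ge0 ?lerB // ltW // (le_lt_trans tr).
Qed.

(** With r the distance, ((1 - r)^-2 - 1) r is r^2 (2 - r) / (1 - r)^2, and the last quotient is at
    most 21/10 for r <= 1/50. This is the 21/10 of the residual bounds. *)
Lemma gradient_sc_small x y u : K° x -> K° y -> local_norm F x (y - x) <= 1 / 50 ->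
  `|dot (gradient F y - gradient F x) u - dot u (hessian F x *m (y - x))| <=
  21 / 10 * local_norm F x (y - x) ^+ 2 * local_norm F x u.
Proof.
move=> Kx Ky; have := @gradient_sc x y u Kx Ky; have := lnorm_ge0 x (y - x).
have := lnorm_ge0 x u.
move: (local_norm F x u) (local_norm F x (y - x)) => U r U0 r0 sc r50.
apply: le_trans (sc _) _; first lra.
have q0 : 0 < (1 - r) ^+ 2 by rewrite exprn_gt0 //; lra.
have -> : ((1 - r) ^- 2 - 1) * (U * r) = U * r ^+ 2 * ((2 - r) / (1 - r) ^+ 2).
  by field; lra.
have -> : 21 / 10 * r ^+ 2 * U = U * r ^+ 2 * (21 / 10) by ring.
apply: ler_wpM2l; first by rewrite mulr_ge0 ?sqr_ge0.
by rewrite ler_pdivrMr //; nra.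
Qed.

Lemma gradient_monotone x y : K° x -> K° y -> local_norm F x (y - x) < 1 ->
  (1 - local_norm F x (y - x)) ^+ 2 * local_norm F x (y - x) ^+ 2 <=
  dot (gradient F y - gradient F x) (y - x).
Proof.
move=> Kx Ky; have := @lnorm_sc x; have r0 := lnorm_ge0 x (y - x).
set r := local_norm F x (y - x) in r0 * => sc r1.
have [t /andP[t0 t1] ->] := gradient_MVT pK bF (y - x) Kx Ky.
have t01 : 0 <= t <= 1 by rewrite !ltW.
have Kt := interior_cone_segment pK t01 Kx Ky.
have rt : local_norm F x (x + t *: (y - x) - x) = t * r by rewrite lnorm_segment ?ltW.
move: (x + _) Kt rt => z Kz rz.
have tr : t * r <= r by rewrite ler_piMl // ltW.
rewrite -(lnorm_sqr (y - x) Kz).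
have tr1 : t * r < 1 by exact: le_lt_trans tr r1.
have [|_] := sc z Kx Kz _ (y - x); first by rewrite rz.
rewrite rz -/r; move: (local_norm F z _) (lnorm_ge0 z (y - x)) => Z Z0.
move: r r0 r1 tr tr1 {sc rz} => r r0 r1 tr tr1 h.
have h' : (1 - r) * r <= Z by apply: le_trans h; nra.
rewrite -exprMn ler_pXn2r ?nnegrE //; nra.
Qed.

Lemma gradient_strict_monotone x y : K° x -> K° y -> x != y ->
  0 < dot (gradient F y - gradient F x) (y - x).
Proof.
move=> Kx Ky xy.
have [t /andP[t0 t1] ->] := gradient_MVT pK bF (y - x) Kx Ky.
have t01 : 0 <= t <= 1 by rewrite !ltW.
apply: (hessian_posdef pK bF (interior_cone_segment pK t01 Kx Ky)).
by rewrite subr_eq0 eq_sym.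
Qed.

Lemma barrier_tangent_le x y : K° x -> K° y ->
  F x + dot (gradient F x) (y - x) <= F y.
Proof.
move=> Kx Ky; have [t /andP[t0 t1] e] := barrier_MVT pK bF Kx Ky.
have t01 : 0 <= t <= 1 by rewrite !ltW.
have Kt := interior_cone_segment pK t01 Kx Ky.
suff : 0 <= dot (gradient F (x + t *: (y - x)) - gradient F x) (y - x).
  by rewrite dotBl -e; lra.
rewrite -(pmulr_rge0 _ t0) -dotZr.
have zx : x + t *: (y - x) - x = t *: (y - x) by rewrite addrC addKr.
move: (x + _) zx Kt => z <- Kz; have [<-|xz] := eqVneq x z.
  by rewrite !subrr dot0r.
exact/ltW/gradient_strict_monotone.
Qed.

(** By homogeneity, monotonicity of F' between x and t y reads t a + b / t >= 2 nu with a = -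
    <F'(x), y> and b = - <F'(y), x>. If a < 0 this fails at t = 1 + |b| / (- a), where t a = a - |b|
    and b / t <= |b|. *)
Lemma neg_gradient_dual x : (0 < n)%N -> K° x -> dual_cone K (- gradient F x).
Proof.
move=> n0 Kx; apply: (dual_cone_interior pK) => y Ky.
have nu1 := barrier_parameter_ge1 n0.
rewrite leNgt; apply/negP; rewrite dotNr dotC => a0.
set a := - dot (gradient F x) y in a0.
have main t : 0 < t -> 0 <= t * a + t^-1 * (- dot (gradient F y) x) - 2 * nu.
  move=> t0; have Kty := interior_coneZ pK t0 Ky.
  have : 0 <= dot (gradient F (t *: y) - gradient F x) (t *: y - x).
    have [<-|xy] := eqVneq x (t *: y); first by rewrite !subrr dot0r.
    exact/ltW/gradient_strict_monotone.
  rewrite gradientZ // !(dotBl, dotBr, dotZl, dotZr) !dot_gradient_self // /a.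
  have e : t^-1 * t * nu = nu by rewrite mulVf ?mul1r // lt0r_neq0.
  lra.
set b := - dot (gradient F y) x in main.
have t1 : 1 <= 1 + `|b| / (- a) by rewrite lerDl divr_ge0 // oppr_ge0 ltW.
have t0 : 0 < 1 + `|b| / (- a) by lra.
have := main _ t0.
have -> : (1 + `|b| / (- a)) * a = a - `|b| by field; lra.
have : (1 + `|b| / (- a))^-1 * b <= `|b|.
  apply: le_trans (ler_norm _) _; rewrite normrM ger0_norm ?invr_ge0 ?(ltW t0) //.
  by rewrite ler_piMl // invf_le1.
lra.
Qed.

End BarrierCalculus.

(** * Minimisation over a Dikin ellipsoid *)

Section LocalInversion.
Variables (R : realType) (n : nat) (K : set 'cV[R]_n) (nu : R) (F : 'cV[R]_n -> R).
Hypotheses (pK : proper_cone K) (bF : lhscb K nu F).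
Implicit Types (x y z u v s : 'cV[R]_n) (t : R).

Lemma lnorm_le_norm x : K° x ->
  exists2 c, 0 <= c & forall v, local_norm F x v <= c * `|v|.
Proof.
move=> Kx; exists (\sum_i local_norm F x (delta_mx i 0)).
  by apply: sumr_ge0 => i _; exact: lnorm_ge0.
move=> v; rewrite mulr_suml {1}(col_sum_delta v).
elim/big_ind2: _ => [|a b c d ab cd|i _].
- by rewrite lnorm0.
- by rewrite (le_trans (lnormD pK bF _ _ Kx)) // lerD.
- by rewrite lnormZ mulrC ler_wpM2l ?lnorm_ge0 // mx_norm_coord.
Qed.

Lemma dot_le_lnorm x u : K° x ->
  exists2 c, 0 <= c & forall v, `|dot u v| <= c * local_norm F x v.
Proof.
move=> Kx; have [v v0|c c0 cP] := dual_bound u (hessian_sym bF Kx) _.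
  exact: (hessian_posdef pK bF).
by exists c.
Qed.

Lemma norm_le_lnorm x : K° x ->
  exists2 c, 0 <= c & forall v, `|v| <= c * local_norm F x v.
Proof.
move=> Kx.
have /choice[c cP] : forall i : 'I_n, exists c : R,
    0 <= c /\ forall v, `|v i 0| <= c * local_norm F x v.
  move=> i; have [c c0 cP] := dot_le_lnorm (delta_mx i 0) Kx.
  by exists c; split=> // v; rewrite -dot_delta dotC.
have sum0 : 0 <= \sum_i c i by apply: sumr_ge0 => i _; case: (cP i).
exists (\sum_i c i) => // v; apply: mx_norm_le => [|i j].
  by rewrite mulr_ge0 // lnorm_ge0.
have [_ /(_ v)] := cP i; rewrite (ord1 j) => /le_trans; apply.
apply: ler_wpM2r; first exact: lnorm_ge0.
rewrite (bigD1 i) //= lerDl; apply: sumr_ge0 => k _; by case: (cP k).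
Qed.

(** For rho < 1 the closed ellipsoid is compact and lies in the interior of K, where F is
    continuous. The set A consists of row vectors to suit [EVT_min_rV]. *)
Lemma ellipsoid_minimum x s (rho : R) : K° x -> 0 <= rho -> rho < 1 ->
  exists y, [/\ K° y, local_norm F x (y - x) <= rho &
    forall z, local_norm F x (z - x) <= rho -> dot s y + F y <= dot s z + F z].
Proof.
move=> Kx rho0 rho1.
pose A : set 'rV[R]_n := [set w | local_norm F x (w^T - x) <= rho].
have AK (w : 'rV[R]_n) : A w -> K° w^T.
  by move=> Aw; apply: (lhscb_dikin bF Kx); exact: le_lt_trans rho1.
have clA : closed A.
  have [c c0 cP] := lnorm_le_norm Kx.
  have ctr (w : 'rV[R]_n) : `|w^T| <= `|w|.
    by apply: mx_norm_le => // i j; rewrite mxE mx_norm_coord.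
  have cN : continuous (fun w : 'rV[R]_n => local_norm F x (w^T - x)).
    apply: (@lipschitz_continuous_real _ _ _ c) => v w.
    have le1 (a b : 'cV[R]_n) : local_norm F x a - local_norm F x b <=
        local_norm F x (a - b).
      by rewrite lerBlDr -{1}(subrK b a); exact: (lnormD pK bF).
    have E a b : local_norm F x ((a : 'rV[R]_n)^T - x - (b^T - x)) <= c * `|a - b|.
      apply: le_trans (cP _) _; rewrite ler_wpM2l //.
      by rewrite opprB addrA subrK -linearB; exact: ctr.
    apply/ler_normlP; split; last exact: le_trans (le1 _ _) (E _ _).
    rewrite opprB distrC; exact: le_trans (le1 _ _) (E _ _).
  exact: (iffLR (continuous_closedP _) cN _ (@closed_le R rho)).
have bA : bounded_set A.
  have [c c0 cP] := norm_le_lnorm Kx.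
  exists (c * rho + `|x|); split=> [|M ltM w Aw]; first exact: num_real.
  apply: le_trans (ltW ltM).
  have -> : `|w| = `|w^T|.
    apply/eqP; rewrite eq_le; apply/andP; split; apply: mx_norm_le => // i j.
      by have := mx_norm_coord w^T j i; rewrite mxE.
    by rewrite mxE mx_norm_coord.
  rewrite -[w^T](subrK x) (le_trans (ler_normD _ _)) // lerD2r.
  by apply: le_trans (cP _) _; rewrite ler_wpM2l.
have A0 : A !=set0 by exists x^T; rewrite /A /= trmxK subrr lnorm0.
have fA : {within A, continuous (fun w : 'rV[R]_n => dot s w^T + F w^T)}.
  apply: continuous_in_subspaceT => w; rewrite inE => Aw.
  have ctr := @trmx_continuous R 1 n w.
  have cd : continuous (dot s).
    apply: (@lipschitz_continuous_real _ _ _ (n%:R * `|s|)) => v z.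
    by rewrite -dotBr dot_norm_bound.
  have c1 : {for w, continuous (dot s \o @trmx R 1 n)}.
    exact: continuous_comp ctr (cd _).
  have c2 : {for w, continuous (F \o @trmx R 1 n)}.
    apply: continuous_comp ctr _.
    by apply: differentiable_continuous; apply: (barrier_diff bF); exact: AK.
  exact: cvgD c1 c2.
have [w + wmin] := EVT_min_rV A0 (bounded_closed_compact bA clA) fA.
rewrite inE => Aw; exists w^T; split; [exact: AK|exact: Aw|] => z zrho.
have := wmin z^T; rewrite trmxK; apply; rewrite inE /A /=.
by rewrite trmxK.
Qed.

End LocalInversion.

(** * Local inversion of F' and the conjugate barrier *)

Section Conjugate.
Variables (R : realType) (n : nat) (K : set 'cV[R]_n) (nu : R) (F : 'cV[R]_n -> R).
Hypotheses (pK : proper_cone K) (bF : lhscb K nu F).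
Implicit Types (x y z u v s : 'cV[R]_n) (t : R).

Lemma ellipsoid_minimum_stationary x y s (rho : R) : K° x -> rho < 1 ->
  local_norm F x (y - x) < rho ->
  (forall z, local_norm F x (z - x) <= rho -> dot s y + F y <= dot s z + F z) ->
  gradient F y = - s.
Proof.
move=> Kx rho1 yrho ymin; apply/eqP; rewrite -subr_eq0 opprK; apply/eqP.
apply: dot_inj => v; rewrite dot0r dotC.
have c0 : 0 < local_norm F x v + 1 by rewrite ltr_wpDl // lnorm_ge0.
pose a := (rho - local_norm F x (y - x)) / (local_norm F x v + 1).
have a0 : 0 < a by rewrite divr_gt0 // subr_gt0.
have inA t : t \in `](- a), a[ -> local_norm F x (y + t *: v - x) <= rho.
  rewrite in_itv /= -ltr_norml ltr_pdivlMr // => ta.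
  rewrite addrAC (le_trans (lnormD pK bF _ _ Kx)) // lnormZ.
  have := normr_ge0 t; have := lnorm_ge0 F x v; nra.
have d t : t \in `](- a), a[ ->
    is_derive t 1 (fun t : R => dot (y + t *: v) s + F (y + t *: v))
      (dot v s + dot (gradient F (y + t *: v)) v).
  move=> ta; have Kt : K° (y + t *: v).
    by apply: (lhscb_dikin bF Kx); apply: le_lt_trans rho1; exact: inA.
  apply: is_deriveD; last exact: (barrier_is_derive_line bF).
  have -> : (fun t : R => dot (y + t *: v) s) =
      (cst (dot y s) : R -> R) + dot v s *: (id : R -> R).
    by apply/funext => q; rewrite dotDl dotZl mulrC.
  have dd : is_derive t 1 ((cst (dot y s) : R -> R) + dot v s *: (id : R -> R))
    (0 + dot v s * 1) by exact: is_deriveD.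
  by rewrite add0r mulr1 in dd.
have z0 : (0 : R) \in `](- a), a[ by rewrite in_itv /= oppr_lt0 a0.
have := @derive1_at_min R (fun t : R => dot (y + t *: v) s + F (y + t *: v))
  (- a) a 0 _ _ z0 _.
case=> [|t ta|t ta|_].
- by rewrite ge0_cp // ltW.
- exact: (@ex_derive _ _ _ _ _ _ _ (d t ta)).
- rewrite scale0r addr0 dotC [dot (_ + _) s]dotC.
  by apply: ymin; exact: inA.
rewrite (@derive_val _ _ _ _ _ _ _ (d 0 z0)) scale0r addr0 => e.
by rewrite dotDl (dotC s) addrC.
Qed.

Lemma local_inversion x s (eta : R) : K° x -> 0 <= eta <= 1 / 10 ->
  (forall v, `|dot (gradient F x + s) v| <= eta * local_norm F x v) ->
  exists y, [/\ K° y, gradient F y = - s, local_norm F x (y - x) <= 1 / 4 &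
    local_norm F x (y - x) * (1 - local_norm F x (y - x)) ^+ 2 <= eta].
Proof.
move=> Kx /andP[eta0 eta1] small.
have q0 : 0 <= 1 / 4 :> R by lra.
have q1 : 1 / 4 < 1 :> R by lra.
have [y [Ky yrho ymin]] := ellipsoid_minimum pK bF s Kx q0 q1.
have r0 := lnorm_ge0 F x (y - x).
have yint : local_norm F x (y - x) < 1 / 4.
  rewrite lt_neqAle yrho andbT; apply/negP => /eqP r4.
  (* The point z at 9/10 of the segment from x to y avoids a one-sided derivative at y. Minimality
     and the tangent inequality at z give <F'(z) + s, y - x> <= 0, while monotonicity and the
     smallness of F'(x) + s make this product positive. *)
  have t01 : 0 <= (9 / 10 : R) <= 1 by apply/andP; split; lra.
  have Kz := interior_cone_segment pK t01 Kx Ky.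
  have rz : local_norm F x (x + 9 / 10 *: (y - x) - x) = 9 / 10 * (1 / 4).
    by rewrite lnorm_segment ?r4 //; lra.
  have := gradient_monotone pK bF Kx Kz; rewrite rz => /(_ ltac:(lra)).
  have := barrier_tangent_le pK bF Kz Ky.
  have := ymin (x + 9 / 10 *: (y - x)); rewrite rz => /(_ ltac:(lra)).
  have /ler_normlP[] := small (y - x); rewrite r4.
  have -> : y - (x + 9 / 10 *: (y - x)) = 1 / 10 *: (y - x).
    have -> : 1 / 10 = 1 - 9 / 10 :> R by lra.
    by rewrite scalerBl scale1r opprD addrA.
  have -> : x + 9 / 10 *: (y - x) - x = 9 / 10 *: (y - x) by rewrite addrC addKr.
  rewrite !dotZr !dotBl !dotDl.
  move: (dot (gradient F (x + _)) (y - x)) (dot (gradient F x) (y - x)) => p q.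
  move: (F y) (F (x + _)) => fy fz.
  rewrite (dotDr x) dotZr !dotBr; move: (dot s y) (dot s x) => sy sx.
  move=> {small ymin yrho r4 t01 rz Kz r0}; lra.
exists y; rewrite (ltW yint).
have gy := ellipsoid_minimum_stationary Kx q1 yint ymin.
split=> //.
have := gradient_monotone pK bF Kx Ky (lt_trans yint q1); rewrite gy.
have /ler_normlP[+ _] := small (y - x).
rewrite -opprD dotNl [s + _]addrC.
move: (local_norm F x (y - x)) r0 (dot _ _) => r r0 d h1 h2.
have [rp|] := ltrP 0 r; last first.
  move=> rle; have r00 : r = 0 by lra.
  by rewrite r00 mul0r.
rewrite -(ler_pM2r rp); lra.
Qed.

(** Fenchel's inequality. The tangent inequality at z bounds the set above, so that [sup] is a true
    supremum. *)
Lemma conjugate_le y z : K° y -> K° z ->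
  dot (gradient F z) y - F y <= conjugate K F (- gradient F z).
Proof.
move=> Ky Kz; apply: ub_le_sup; last by exists y => //; rewrite dotNl opprK.
exists (dot (gradient F z) z - F z) => _ [x Kx <-]; rewrite dotNl opprK.
by have := barrier_tangent_le pK bF Kz Kx; rewrite dotBr; lra.
Qed.

Lemma conjugate_neg_gradient y : K° y ->
  conjugate K F (- gradient F y) = dot (gradient F y) y - F y.
Proof.
move=> Ky; apply/eqP; rewrite eq_le conjugate_le // andbT.
apply: ge_sup; first by exists (- dot (- gradient F y) y - F y), y.
move=> _ [x Kx <-]; rewrite dotNl opprK.
by have := barrier_tangent_le pK bF Ky Kx; rewrite dotBr; lra.
Qed.

Lemma newton_radius_bound (r m : R) : 0 <= r -> r <= 1 / 4 -> r * (1 - r) ^+ 2 <= m ->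
  r <= 2 * m.
Proof.
move=> r0 r4 rm; have q : 1 / 2 <= (1 - r) ^+ 2 by nra.
by have := ler_wpM2l r0 q; lra.
Qed.

(** Local inversion gives z with F'(z) = F'(y) - h e and |z - y| = O(h). Two Fenchel inequalities
    enclose the increment of the conjugate between - h <e, y> and - h <e, z>, which differ by
    O(h^2). *)
Lemma derive_conjugate y e : K° y ->
  'D_e (conjugate K F) (- gradient F y) = - dot e y.
Proof.
move=> Ky; have [c c0 cP] := dot_le_lnorm pK bF e Ky.
have close (h : R) : `|h| * c <= 1 / 10 ->
    `|conjugate K F (h *: e + - gradient F y) - conjugate K F (- gradient F y) + h * dot e y|
    <= `|h| * (`|h| * (2 * c ^+ 2)).
  move=> hc; have hc0 : 0 <= `|h| * c by rewrite mulr_ge0.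
  have [|v|z [Kz gz r4 rz]] := @local_inversion y (h *: e - gradient F y) (`|h| * c) Ky.
  - by rewrite hc0.
  - by rewrite addrC subrK dotZl normrM -mulrA ler_wpM2l.
  have sE : h *: e + - gradient F y = - gradient F z by rewrite gz opprK.
  have le1 := conjugate_le Ky Kz; have le2 := conjugate_le Kz Ky.
  have E1 := conjugate_neg_gradient Ky; have E2 := conjugate_neg_gradient Kz.
  rewrite sE; move: le1 le2; rewrite E1 E2.
  have gzE u : dot (gradient F z) u = dot (gradient F y) u - h * dot e u.
    by rewrite gz opprB dotBl dotZl.
  rewrite !gzE => le1 le2.
  have bd : `|dot e (z - y)| <= `|h| * (2 * c ^+ 2).
    apply: le_trans (cP _) _.
    have /(ler_wpM2l c0) := newton_radius_bound (lnorm_ge0 F y (z - y)) r4 rz.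
    by move=> /le_trans; apply; rewrite le_eqVlt; apply/orP; left; apply/eqP; ring.
  have : `|h * dot e (z - y)| <= `|h| * (`|h| * (2 * c ^+ 2)).
    by rewrite normrM ler_wpM2l.
  move: (`|h| * (`|h| * (2 * c ^+ 2))) le1 le2 => b.
  rewrite (dotBr z y e); move: (dot e z) (dot e y) (F z) (F y).
  move: (dot (gradient F y) z) (dot (gradient F y) y).
  move=> {cP bd E1 E2 rz gz gzE sE hc hc0} gz gy ez ey fz fy le1 le2 /ler_normlP[b1 b2].
  by apply/ler_normlP; split; lra.
apply: cvg_lim => //; apply/cvgrPdist_le => eps eps0.
have d1 : 0 < 1 / (10 * (c + 1)) by rewrite divr_gt0 // mulr_gt0 //; lra.
have q1 : 0 < 2 * c ^+ 2 + 1 by rewrite ltr_wpDl // mulr_ge0 // sqr_ge0.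
have d2 : 0 < eps / (2 * c ^+ 2 + 1) by rewrite divr_gt0.
near=> h.
have h0 : h != 0 by near: h; exact: nbhs_dnbhs_neq.
have hn : 0 < `|h| by rewrite normr_gt0.
have hd1 : `|h| <= 1 / (10 * (c + 1)) by near: h; exact: (@dnbhs0_le R R^o).
have hd2 : `|h| <= eps / (2 * c ^+ 2 + 1) by near: h; exact: (@dnbhs0_le R R^o).
have hc : `|h| * c <= 1 / 10.
  have : `|h| * (10 * (c + 1)) <= 1 by rewrite -ler_pdivlMr // mulr_gt0 //; lra.
  by move: (`|h|) hn => H H0; nra.
have := close h hc; rewrite /=.
move: (conjugate K F _) (conjugate K F _) => q p b.
rewrite -normrN opprB opprK.
have -> : h^-1 *: (p - q) + dot e y = h^-1 * (p - q + h * dot e y).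
  by rewrite mulrDr mulrA mulVf // mul1r.
rewrite normrM normfV ler_pdivrMl //; apply: le_trans b _.
rewrite ler_pM2l //; move: hd2; rewrite ler_pdivlMr //.
by move: (`|h|) hn => H H0; nra.
Unshelve. all: by end_near. Qed.

Lemma xtilde_neg_gradient y : K° y -> xtilde K F (- gradient F y) = y.
Proof.
move=> Ky; apply/eqP; rewrite /xtilde eqr_oppLR; apply/eqP.
apply/matrixP => i j; rewrite (ord1 j) [LHS]mxE derive_conjugate // dotC dot_delta.
by rewrite mxE.
Qed.

(** By local inversion every s close to - F'(x) is itself - F'(z) for some interior z, hence lies in
    the dual cone. *)
Lemma neg_gradient_dual_interior x : (0 < n)%N -> K° x ->
  (dual_cone K)° (- gradient F x).
Proof.
move=> n0 Kx; have [c c0 cP] := norm_le_lnorm pK bF Kx.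
have q0 : 0 < 10 * (n%:R * c + 1) by rewrite mulr_gt0 // ltr_wpDl // mulr_ge0.
apply/interior_normP; exists (1 / (10 * (n%:R * c + 1))); first by rewrite divr_gt0.
move=> s sx.
have [|v|z [Kz gz _ _]] := @local_inversion x s (n%:R * `|s + gradient F x| * c) Kx.
- move: sx; rewrite opprK ltr_pdivlMr // => sx.
  have p0 : 0 <= n%:R * c by rewrite mulr_ge0.
  rewrite !mulr_ge0 //=; have := normr_ge0 (s + gradient F x).
  move: (`|_|) sx => H sx H0; rewrite mulrAC; move: (n%:R * c) p0 sx => a a0 sx.
  by nra.
- rewrite addrC; apply: le_trans (dot_norm_bound _ _) _.
  by rewrite -[leRHS]mulrA ler_wpM2l // mulr_ge0.
by rewrite -[s]opprK -gz; exact: (neg_gradient_dual pK bF).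
Qed.

End Conjugate.

(** * The iterates *)

Section NearCentralPath.
Variables (R : realType) (n : nat) (K : set 'cV[R]_n) (nu : R) (F : 'cV[R]_n -> R).
Hypotheses (n0 : (0 < n)%N) (pK : proper_cone K) (bF : lhscb K nu F).
Implicit Types (x y s u v w p : 'cV[R]_n) (rho m : R).

(* y is mu times the primal shadow iterate xtilde of s. *)
Definition near_central rho x s m := exists y, [/\ K° x, K° y, 0 < m,
  s = m *: (- gradient F y) & dot x s = nu * m /\ local_norm F x (x - y) <= rho].

Let nu1 : 1 <= nu. Proof. exact: (barrier_parameter_ge1 pK bF n0). Qed.
Let nu0 : 0 < nu. Proof. exact: lt_le_trans ltr01 nu1. Qed.

Lemma near_central_interior rho x s m : near_central rho x s m ->
  K° x /\ (dual_cone K)° s.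
Proof.
move=> [y [Kx Ky m0 -> _]]; split=> //.
have mV0 : 0 < m^-1 by rewrite invr_gt0.
have -> : m *: (- gradient F y) = - gradient F (m^-1 *: y).
  by rewrite (gradientZ pK bF mV0 Ky) invrK scalerN.
by apply: (neg_gradient_dual_interior pK bF n0); exact: interior_coneZ.
Qed.

Lemma mu_near_central rho x s m : near_central rho x s m -> mu nu x s = m.
Proof.
by move=> [y [_ _ _ _ [xs _]]]; rewrite /mu xs mulrC mulKf // gt_eqF.
Qed.

(** The results on [scaling_form] apply with p = x - y and e = F'(x) - F'(y). The relation <x, s> =
    nu m gives <x, e> = 0, and Euler's identity at y then gives <p, st + e> = 0. The factor 103/100
    covers 1 + 21/10 rho. *)
Lemma scaling_matrix_near_central rho x s m : rho <= 3 / 250 ->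
  near_central rho x s m ->
  let W := scaling_matrix K nu F x s in
  exists p, [/\ W^T = W, W *m x = s, W *m p = s - m *: stilde F x,
    dot x (W *m p) = 0 & [/\ local_norm F x p <= rho,
    forall u v, `|dot u (W *m v) - m * dot u (hessian F x *m v)| <=
      9 * rho * m * (local_norm F x u * local_norm F x v)
    & forall v, `|dot (s - m *: stilde F x) v| <=
      103 / 100 * rho * m * local_norm F x v]].
Proof.
move=> rho12 [y [Kx Ky m0 sE [xs xy]]]; cbv zeta.
have r12 := le_trans xy rho12.
have mV0 : 0 < m^-1 by rewrite invr_gt0.
have xt : xtilde K F s = m^-1 *: (x - (x - y)).
  have -> : s = - gradient F (m^-1 *: y).
    by rewrite sE (gradientZ pK bF mV0 Ky) invrK scalerN.
  by rewrite subKr (xtilde_neg_gradient pK bF) //; exact: interior_coneZ.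
pose p := x - y; pose st := stilde F x; pose e := gradient F x - gradient F y.
have ste : st + e = - gradient F y by rewrite /st /e /stilde addrA addNr sub0r.
have sE' : s = m *: (st + e) by rewrite ste.
have W_E : scaling_matrix K nu F x s =
    scaling_form (hessian F x) nu x (m *: (st + e)) (m^-1 *: (x - p)) st.
  by rewrite -sE' -xt.
have symH := hessian_sym bF Kx.
have posH v := hessian_posdef pK bF (v := v) Kx.
have Hx : hessian F x *m x = st by exact: (hessian_mul_self pK bF).
have xst : dot x st = nu by rewrite /st dotNr dotC (dot_gradient_self bF) ?opprK.
have xe : dot x e = 0.
  have : dot x (st + e) = nu.
    have : m * dot x (st + e) = m * nu by rewrite -dotZr -sE' xs mulrC.
    by apply: mulfI; rewrite gt_eqF.
  by rewrite dotDr xst => /eqP; rewrite -subr_eq0 addrC addKr => /eqP.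
have pse : dot p (st + e) = 0.
  rewrite /p dotBl dotDr xst xe addr0 ste dotNr dotC (dot_gradient_self bF Ky).
  by rewrite opprK subrr.
have nun0 : nu != 0 by rewrite gt_eqF.
have pst : dot p st = dot p st / nu * nu by rewrite (divfK nun0).
have resid v : `|dot (e - hessian F x *m p) v| <=
    21 / 10 * qnorm (hessian F x) p ^+ 2 * qnorm (hessian F x) v.
  have xyN : local_norm F x (y - x) = local_norm F x p.
    by rewrite -lnormN opprB.
  have := @gradient_sc_small R n K nu F pK bF x y v Kx Ky.
  have -> : dot (e - hessian F x *m p) v =
      - (dot (gradient F y - gradient F x) v - dot v (hessian F x *m (y - x))).
    rewrite (dotC v) -dotBl -dotNl; congr dot.
    rewrite /e /p !mulmx_linE; move: (hessian F x *m x) (hessian F x *m y) => a b.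
    by apply/matrixP => i k; rewrite !mxE; ring.
  rewrite normrN xyN; apply; apply: le_trans r12 _; lra.
have [symW Wx Wp WH] : [/\ (scaling_matrix K nu F x s)^T = scaling_matrix K nu F x s,
   scaling_matrix K nu F x s *m x = s,
   scaling_matrix K nu F x s *m p = m *: e &
   forall u v, `|dot u (scaling_matrix K nu F x s *m v) - m * dot u (hessian F x *m v)| <=
      9 * qnorm (hessian F x) p * m * (local_norm F x u * local_norm F x v)].
  rewrite W_E; split.
  - exact: (scaling_form_sym symH posH nu0 m0 Hx xst xe pst erefl).
  - by rewrite (scaling_form_x symH posH nu0 m0 Hx xst xe pst erefl) -sE'.
  - exact: (scaling_form_p symH posH nu0 m0 Hx xst xe pse pst erefl r12 resid).
  - exact: (scaling_form_hessian symH posH nu0 m0 Hx xst xe pst erefl nu1 r12 resid).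
have eE : m *: e = s - m *: st by rewrite sE' -scalerBr [st + e]addrC addrK.
clear W_E xt; move: (scaling_matrix K nu F x s) symW Wx Wp WH => W symW Wx Wp WH.
exists p; split; [exact: symW|exact: Wx|by rewrite Wp|by rewrite Wp dotZr xe mulr0|].
split; first exact: xy.
- move=> u v; apply: le_trans (WH u v) _.
  rewrite ler_wpM2r ?mulr_ge0 ?lnorm_ge0 // ler_wpM2r ?(ltW m0) //.
  by rewrite ler_wpM2l.
- move=> v; rewrite -/st -eE dotZl normrM (gtr0_norm m0).
  have -> : dot e v = dot (e - hessian F x *m p) v + dot v (hessian F x *m p).
    by rewrite (dotBl e (hessian F x *m p)) [dot v _]dotC subrK.
  have := ler_normD (dot (e - hessian F x *m p) v) (dot v (hessian F x *m p)).
  move: (`|dot (e - _) v + _|) => a; have := resid v; have := lnorm_CS pK bF v p Kx.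
  rewrite -lnormE -lnormE; move: (`|dot _ _|) (`|dot _ _|) => b d hb hd ha.
  have := lnorm_ge0 F x v; have := lnorm_ge0 F x p; move: hb hd xy r12; rewrite -/p.
  move: (local_norm F x v) (local_norm F x p) => V r hb hd xy r12 r0 V0.
  have -> : 103 / 100 * rho * m * V = m * (103 / 100 * rho * V) by ring.
  rewrite ler_pM2l //.
  have r2 : 21 / 10 * r ^+ 2 <= 3 / 100 * r by have := ler_wpM2l r0 r12; rewrite -expr2; lra.
  have h1 := ler_wpM2r V0 r2; have h2 := ler_wpM2r V0 xy; lra.
Qed.

(** Local inversion at s / m. The crude bound r <= 2 eta <= 1/50 gives (1 - r)^2 >= 24/25; inserted
    into r (1 - r)^2 <= eta it improves the factor 2 to 21/20. *)
Lemma near_central_of_bound x s m (eta : R) : K° x -> 0 < m -> dot x s = nu * m ->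
  0 <= eta <= 1 / 100 ->
  (forall v, `|dot (s - m *: stilde F x) v| <= eta * m * local_norm F x v) ->
  near_central (21 / 20 * eta) x s m.
Proof.
move=> Kx m0 xs /andP[eta0 eta1] bd.
have mn0 : m != 0 by rewrite gt_eqF.
have eta10 : 0 <= eta <= 1 / 10 by rewrite eta0 /=; lra.
have [|y [Ky gy r4 ry]] := @local_inversion R n K nu F pK bF x (m^-1 *: s) eta Kx eta10.
  move=> v; have -> : gradient F x + m^-1 *: s = m^-1 *: (s - m *: stilde F x).
    by rewrite scalerBr scalerA mulVf // scale1r /stilde opprK addrC.
  rewrite dotZl normrM (gtr0_norm (_ : 0 < m^-1)) ?invr_gt0 // ler_pdivrMl //.
  by apply: le_trans (bd v) _; rewrite mulrA (mulrC m).
exists y; split=> //; first by rewrite gy opprK scalerA mulfV // scale1r.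
split=> //; rewrite -lnormN opprB.
have r0 := lnorm_ge0 F x (y - x); have r2 := newton_radius_bound r0 r4 ry.
move: (local_norm F x (y - x)) r0 r2 ry {r4 bd gy} => r r0 r2 ry.
have q : 24 / 25 <= (1 - r) ^+ 2 by nra.
by have := ler_wpM2l r0 q; lra.
Qed.

End NearCentralPath.

Lemma norm_le_of_dist (R : realType) (a b c d : R) :
  `|a - b| <= c -> `|b| <= d -> `|a| <= d + c.
Proof.
by move=> h1 h2; rewrite -[a](subrK b) addrC; apply: le_trans (ler_normD _ _) (lerD _ _).
Qed.

(** * The two half steps in terms of x, s, tau and kappa *)

Section Steps.
Variables (R : realType) (n : nat) (K : set 'cV[R]_n) (nu : R) (F : 'cV[R]_n -> R).
Hypotheses (n0 : (0 < n)%N) (pK : proper_cone K) (bF : lhscb K nu F).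
Implicit Types (x y s u v w p dx ds : 'cV[R]_n) (m t k me dt dk : R).

Local Notation sg := (Num.sqrt nu)^-1.

Let nu1 : 1 <= nu. Proof. exact: (barrier_parameter_ge1 pK bF n0). Qed.
Let nu0 : 0 < nu. Proof. exact: lt_le_trans ltr01 nu1. Qed.
Let S0 : 0 < Num.sqrt nu. Proof. by rewrite sqrtr_gt0. Qed.
Let S1 : 1 <= Num.sqrt nu. Proof. by rewrite -(sqrtr1 R) ler_wsqrtr. Qed.
Let sg0 : 0 < sg. Proof. by rewrite invr_gt0. Qed.
Let sg1 : sg <= 1. Proof. by rewrite invf_le1. Qed.
Let Ssg : Num.sqrt nu * sg = 1. Proof. by rewrite mulfV // gt_eqF. Qed.
Let nusg : nu * sg ^+ 2 = 1.
Proof.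
have {1}-> : nu = Num.sqrt nu ^+ 2 by rewrite sqr_sqrtr // ltW.
by rewrite -exprMn Ssg expr1n.
Qed.

Let rho0 : 0 <= sg / 500. Proof. by move: sg sg0 => a; lra. Qed.
Let rho500 : sg / 500 <= 1 / 500. Proof. by move: sg sg1 => a; lra. Qed.
Let rho12 : sg / 500 <= 3 / 250. Proof. by move: sg sg0 sg1 => a; lra. Qed.

Lemma stilde_bound x v : K° x ->
  `|dot (stilde F x) v| * sg <= local_norm F x v.
Proof.
move=> Kx; have -> : dot (stilde F x) v = dot x (hessian F x *m v).
  by rewrite dotNl (dot_hessian_self pK bF _ Kx).
have := lnorm_CS pK bF x v Kx.
have -> : local_norm F x x = Num.sqrt nu.
  by rewrite -[LHS]ger0_norm ?lnorm_ge0 // -sqrtr_sqr (lnorm_self_sqr pK bF Kx).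
move: (`|_|) => a h; rewrite -(ler_pM2r S0) -mulrA [sg * _]mulrC Ssg mulr1.
by rewrite mulrC.
Qed.

Lemma near_central_le rho rho' x s m : rho <= rho' ->
  near_central K nu F rho x s m -> near_central K nu F rho' x s m.
Proof.
by move=> rr [y [Kx Ky m0 sE [xs h]]]; exists y; do 2!split=> //; exact: le_trans rr.
Qed.

Lemma near_central_mu_gt0 rho x s m : near_central K nu F rho x s m -> 0 < m.
Proof. by case=> y []. Qed.

Lemma near_central_dot rho x s m : near_central K nu F rho x s m -> dot x s = nu * m.
Proof. by case=> y [_ _ _ _ []]. Qed.

Let dot_st x : K° x -> dot x (stilde F x) = nu.
Proof. by move=> Kx; rewrite dotNr dotC (dot_gradient_self bF Kx) opprK. Qed.

Lemma predictor_near x s m me t k dx ds dt dk :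
  near_central K nu F (sg / 500) x s m ->
  0 < t -> 0 < k -> 0 < me -> (nu + 1) * me = nu * m + t * k ->
  `|t * k - me| <= me / 50 ->
  scaling_matrix K nu F x s *m dx + ds = - s + (9 / 10 * me) *: stilde F x ->
  t * dk + k * dt = - (t * k) + 9 / 10 * me ->
  dot (dx + (1 / 10) *: x) (ds + (1 / 10) *: s) + (dt + t / 10) * (dk + k / 10) = 0 ->
  exists mp, [/\ near_central K nu F (21 / 20 / 100 * sg)
      (x + (sg ^+ 2 / 100) *: dx) (s + (sg ^+ 2 / 100) *: ds) mp,
    0 < t + sg ^+ 2 / 100 * dt, 0 < k + sg ^+ 2 / 100 * dk,
    (nu + 1) * ((1 - sg ^+ 2 / 1000) * me) =
      nu * mp + (t + sg ^+ 2 / 100 * dt) * (k + sg ^+ 2 / 100 * dk) &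
    `|(t + sg ^+ 2 / 100 * dt) * (k + sg ^+ 2 / 100 * dk) - (1 - sg ^+ 2 / 1000) * me| <=
      (1 - sg ^+ 2 / 1000) * me * (1 / 50 - sg ^+ 2 / 100 / 100)].
Proof.
move=> nc t0 k0 me0 meE tk.
have m0 := near_central_mu_gt0 nc; have xs := near_central_dot nc.
have [Kx _] := near_central_interior n0 pK bF nc.
have [p [symW Wx Wp xWp [prho WH sbound]]] := scaling_matrix_near_central n0 pK bF rho12 nc.
move: (scaling_matrix K nu F x s) symW Wx Wp xWp WH => W symW Wx Wp xWp WH dirW dirt skew.
have psdH := hessian_psd pK bF Kx.
have lin := predictor_linear symW Wx xs (dot_st Kx) dirW.
have orth := predictor_orthogonal symW Wx xs (dot_st Kx) meE dirW dirt skew.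
have [hdx hds hdxds [hdt hdk]] := predictor_bounds symW psdH nu1 m0 rho0 rho500 WH
  Wx Wp xWp xs prho t0 k0 me0 meE tk dirW dirt skew.
clear symW Wx Wp xWp WH dirW.
have [al alE] : exists al, al = sg ^+ 2 / 100 by eexists.
rewrite -!alE.
have al0 : 0 < al by rewrite alE divr_gt0 // exprn_gt0.
pose mp := dot (x + al *: dx) (s + al *: ds) / nu.
have mpE : nu * mp = nu * m + al * (- (nu * m) + 9 / 10 * me * nu) + al ^+ 2 * dot dx ds.
  rewrite mulrC divfK ?gt_eqF // -lin !dotDl !dotDr !dotZl !dotZr xs [dot dx s]dotC.
  ring.
have tk50 : `|m - me| <= me / 50.
  apply: le_trans (mu_mue_close nu1 me0 meE tk) _.
  by rewrite ler_pdivrMr // ler_peMr // divr_ge0 // ltW.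
have mpclose : `|mp - m| <= 121 / 1000 / 100 * m * sg ^+ 2.
  rewrite alE in mpE; exact: predictor_mu_close sg0 sg1 nusg m0 tk50 mpE hdxds.
have hE : local_norm F x (x + al *: dx - x) = al * local_norm F x dx.
  by rewrite addrC addKr lnormZ gtr0_norm.
have hb : al * local_norm F x dx <= 7 / 25 / 100 * sg.
  apply: le_trans (ler_wpM2l (ltW al0) hdx) _.
  have -> : al * (7 / 25 * Num.sqrt nu) = 7 / 25 / 100 * (Num.sqrt nu * sg) * sg.
    by rewrite alE; ring.
  by rewrite Ssg mulr1.
have h0 : 0 <= al * local_norm F x dx by rewrite mulr_ge0 ?lnorm_ge0 // ltW.
have h50 : local_norm F x (x + al *: dx - x) <= 1 / 50.
  by rewrite hE; apply: le_trans hb _; move: sg sg1 => a a1; lra.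
have h1 : local_norm F x (x + al *: dx - x) < 1 by apply: le_lt_trans h50 _; lra.
have Kxp : K° (x + al *: dx) by exact: (lhscb_dikin bF Kx).
have dual v : `|dot (s + al *: ds - mp *: stilde F (x + al *: dx)) v| <=
    sg / 100 * mp * local_norm F (x + al *: dx) v.
  (* In order: the old residual, the step in s, the change of mu and the change of F'. *)
  have -> : s + al *: ds - mp *: stilde F (x + al *: dx) =
      (s - m *: stilde F x) + al *: ds + (m - mp) *: stilde F x +
      mp *: (gradient F (x + al *: dx) - gradient F x).
    rewrite /stilde; move: (gradient F x) (gradient F _) => a b.
    by apply/matrixP => i j; rewrite !mxE; ring.
  rewrite dotDl dotDl dotDl !dotZl .
  have [sc _] := lnorm_sc pK bF Kx Kxp h1 v.
  have [_ sc2] := lnorm_sc pK bF Kx Kxp h1 v.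
  have gsc := gradient_sc_small pK bF v Kx Kxp h50.
  have CS := lnorm_CS pK bF v (x + al *: dx - x) Kx.
  rewrite !hE in sc sc2 gsc CS.
  apply: (predictor_dual_sum sg0 sg1 m0 (lnorm_ge0 F x v) mpclose h0 hb sc2).
  - by have := sbound v; rewrite [103 / 100 * (sg / 500)]mulrC [_ * (103 / 100)]mulrC.
  - rewrite normrM (gtr0_norm al0).
    apply: le_trans (ler_wpM2l (ltW al0) (hds v)) _.
    have -> : al * (7 / 25 * Num.sqrt nu * m * qnorm (hessian F x) v) =
      7 / 25 / 100 * (Num.sqrt nu * sg) * sg * m * local_norm F x v.
      by rewrite alE lnormE; ring.
    by rewrite Ssg mulr1.
  - exact: stilde_bound.
  - apply: le_trans (norm_le_of_dist gsc CS) _.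
    by rewrite le_eqVlt; apply/orP; left; apply/eqP; ring.
exists mp; split.
- have -> : 21 / 20 / 100 * sg = 21 / 20 * (sg / 100) by ring.
  apply: (near_central_of_bound pK bF Kxp) => //.
  + have : m * sg ^+ 2 <= m by rewrite ler_piMr ?expr_le1 // ltW.
    by move/ler_normlP: mpclose => [c1 _]; lra.
  + by rewrite /mp mulrC divfK // gt_eqF.
  + by apply/andP; move: sg sg0 sg1 => a a0 a1; split; lra.
- by rewrite alE; exact: predictor_positive nu1 nusg t0 hdt.
- by rewrite alE; exact: predictor_positive nu1 nusg k0 hdk.
- rewrite mpE; have -> : sg ^+ 2 / 1000 = al / 10.
    by rewrite alE; move: (sg ^+ 2) => a; lra.
  have dd : dt * dk = - dot dx ds by apply/eqP; rewrite -addr_eq0 addrC orth.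
  have -> : (t + al * dt) * (k + al * dk) =
    t * k + al * (t * dk + k * dt) + al ^+ 2 * (dt * dk) by ring.
  rewrite dirt dd; have -> : (nu + 1) * ((1 - al / 10) * me) =
    (1 - al / 10) * ((nu + 1) * me) by ring.
  have me2 : me * nu = nu * m + t * k - me by rewrite -meE; ring.
  rewrite meE -[9 / 10 * me * nu]mulrA me2; by field.
- rewrite alE; apply: (predictor_tk_close sg0 sg1 nusg me0 tk dirt orth).
  apply: le_trans hdxds _.
  have mme : m <= 51 / 50 * me by move/ler_normlP: tk50 => [_ c1]; lra.
  have := ler_wpM2l (ltW nu0) mme; rewrite [nu * (_ * me)]mulrCA; have := mulr_gt0 nu0 me0.
  by move: (nu * m) (nu * me) => a b; lra.
Qed.

Let rho1_ge0 : 0 <= 21 / 20 / 100 * sg. Proof. by move: sg sg0 => a; lra. Qed.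
Let rho1_small : 21 / 20 / 100 * sg <= 21 / 20 / 100.
Proof. by move: sg sg1 => a; lra. Qed.
Let rho1_12 : 21 / 20 / 100 * sg <= 3 / 250. Proof. by move: sg sg0 sg1 => a; lra. Qed.

Lemma corrector_near x s m me t k dx ds dt dk :
  near_central K nu F (21 / 20 / 100 * sg) x s m ->
  0 < t -> 0 < k -> 0 < me -> (nu + 1) * me = nu * m + t * k ->
  `|t * k - me| <= me * (1 / 50 - sg ^+ 2 / 100 / 100) ->
  scaling_matrix K nu F x s *m dx + ds = m *: stilde F x - s ->
  t * dk + k * dt = 0 -> dot dx ds + dt * dk = 0 ->
  exists mp, [/\ near_central K nu F (sg / 500) (x + dx) (s + ds) mp,
    0 < t + dt, 0 < k + dk, (nu + 1) * me = nu * mp + (t + dt) * (k + dk) &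
    `|(t + dt) * (k + dk) - me| <= me / 50].
Proof.
move=> nc t0 k0 me0 meE tk.
have m0 := near_central_mu_gt0 nc; have xs := near_central_dot nc.
have [Kx _] := near_central_interior n0 pK bF nc.
have [p [symW Wx Wp xWp [prho WH sbound]]] := scaling_matrix_near_central n0 pK bF rho1_12 nc.
move: (scaling_matrix K nu F x s) symW Wx Wp xWp WH => W symW Wx Wp xWp WH dirW dirt skew.
have psdH := hessian_psd pK bF Kx.
have [hdx hdd hdt hdk] := corrector_bounds symW psdH m0 rho1_ge0 rho1_small WH
  Wp prho t0 k0 dirW dirt skew.
have lin : dot x ds + dot s dx = 0.
  have := congr1 (dot x) dirW; rewrite dotDr dotBr dotZr xs (dot_st Kx).
  rewrite (dot_sym _ _ symW) Wx [dot dx s]dotC addrC => ->.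
  by rewrite mulrC subrr.
have dsE : ds = m *: stilde F x - s - W *m dx by rewrite -dirW addrC addKr.
have WHdx v := WH v dx.
clear symW Wx Wp xWp WH dirW.
pose mp := dot (x + dx) (s + ds) / nu.
have mpE : nu * mp = nu * m + dot dx ds.
  rewrite mulrC divfK ?gt_eqF // !dotDl !dotDr xs [dot dx s]dotC.
  by rewrite -addrA [dot x ds + _]addrA lin add0r.
have eb : `|dot dx ds| <= 11 / 20 * m * (21 / 20 / 100 * sg) ^+ 2.
  have -> : dot dx ds = - (dt * dk) by apply/eqP; rewrite -addr_eq0 skew.
  by rewrite normrN.
have mpclose := corrector_mu_close sg0 sg1 nusg m0 mpE eb.
have hE : local_norm F x (x + dx - x) = local_norm F x dx by rewrite addrC addKr.
have h0 := lnorm_ge0 F x dx.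
have h50 : local_norm F x (x + dx - x) <= 1 / 50.
  rewrite hE; apply: le_trans hdx _; move: sg sg1 => a a1; lra.
have h1 : local_norm F x (x + dx - x) < 1 by apply: le_lt_trans h50 _; lra.
have Kxp : K° (x + dx) by exact: (lhscb_dikin bF Kx).
have dual v : `|dot (s + ds - mp *: stilde F (x + dx)) v| <=
    4 / 25 / 100 * sg * mp * local_norm F (x + dx) v.
  (* Once ds is substituted the first-order parts cancel; what remains is the change of mu, a Taylor
     remainder and the error of [W] as an approximation of m H. *)
  have -> : dot (s + ds - mp *: stilde F (x + dx)) v =
      (m - mp) * dot (stilde F (x + dx)) v +
      m * (dot (gradient F (x + dx) - gradient F x) v - dot v (hessian F x *m dx)) -
      (dot v (W *m dx) - m * dot v (hessian F x *m dx)).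
    rewrite dsE /stilde !(dotDl, dotBl, dotNl, dotZl) [dot (W *m dx) v]dotC; ring.
  have [_ sc2] := lnorm_sc pK bF Kx Kxp h1 v.
  have gsc := gradient_sc_small pK bF v Kx Kxp h50.
  have dxE : x + dx - x = dx by rewrite addrC addKr.
  rewrite dxE in sc2 gsc.
  apply: (corrector_dual_sum sg0 sg1 m0 (lnorm_ge0 F x v) mpclose h0 hdx sc2).
  - exact: stilde_bound.
  - exact: gsc.
  - exact: WHdx.
have tk50 : `|t * k - me| <= me / 50.
  apply: le_trans tk _; have := mulr_ge0 (ltW me0) (sqr_ge0 sg).
  by move: (sg ^+ 2) => a; lra.
have m2 := mu_le_twice_tk nu1 me0 meE tk50.
have rho1_10 : 21 / 20 / 100 * sg <= 1 / 10 by move: sg sg0 sg1 => a a0 a1; lra.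
exists mp; split.
(* The new radius is 0.00168 sg, below sg / 500. *)
- apply: (@near_central_le (21 / 20 * (4 / 25 / 100 * sg))).
    by move: sg sg0 => a; lra.
  apply: (near_central_of_bound pK bF Kxp) => //.
  + have : m * sg ^+ 2 <= m by rewrite ler_piMr ?expr_le1 // ltW.
    by move/ler_normlP: mpclose => [c1 _]; lra.
  + by rewrite /mp mulrC divfK // gt_eqF.
  + by apply/andP; move: sg sg0 sg1 => a a0 a1; split; lra.
- exact: corrector_positive t0 k0 m0 m2 rho1_ge0 rho1_10 hdt.
- by apply: corrector_positive k0 t0 m0 _ rho1_ge0 rho1_10 hdk; rewrite [k * t]mulrC.
- rewrite mpE meE; have -> : (t + dt) * (k + dk) = t * k + (t * dk + k * dt) + dt * dk by ring.
  by rewrite dirt addr0 addrACA skew addr0.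
- exact: corrector_tk_close nu1 sg0 sg1 nusg me0 meE tk dirt hdd.
Qed.

End Steps.

(** * Invariants of the iteration *)

Section Algorithm.
Variables (R : realType) (m n : nat) (K : set 'cV[R]_n) (nu : R) (F : 'cV[R]_n -> R).
Variables (A : 'M[R]_(m, n)) (b : 'cV[R]_m) (c : 'cV[R]_n).
Hypotheses (n0 : (0 < n)%N) (pK : proper_cone K) (bF : lhscb K nu F).
Implicit Types z d : hsd_point R m n.

Local Notation sg := (Num.sqrt nu)^-1.
Local Notation alpha := (1 / (100 * nu)).
Local Notation gamma := (9 / 10).
Local Notation ratio := (1 - sg ^+ 2 / 1000).

Definition neighbourhood (rho theta : R) z := exists mu0,
  [/\ near_central K nu F rho (px z) (ps z) mu0, 0 < ptau z, 0 < pkappa z &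
    `|ptau z * pkappa z - mue nu z| <= mue nu z * theta].

Definition predictor_ready z := neighbourhood (sg / 500) (1 / 50) z.
(** Wider than [predictor_ready] in the radius but narrower in tau kappa: each half step gains in
    one tolerance and loses in the other. *)
Definition corrector_ready z :=
  neighbourhood (21 / 20 / 100 * sg) (1 / 50 - sg ^+ 2 / 100 / 100) z.

Let nu1 : 1 <= nu. Proof. exact: (barrier_parameter_ge1 pK bF n0). Qed.
Let nu0 : 0 < nu. Proof. exact: lt_le_trans ltr01 nu1. Qed.
Let sg0 : 0 < sg. Proof. by rewrite invr_gt0 sqrtr_gt0. Qed.
Let sg1 : sg <= 1. Proof. by rewrite invf_le1 ?sqrtr_gt0 // -(sqrtr1 R) ler_wsqrtr. Qed.
Let sg2 : sg ^+ 2 = nu^-1. Proof. by rewrite exprVn sqr_sqrtr // ltW. Qed.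
Let alphaE : alpha = sg ^+ 2 / 100.
Proof. by rewrite sg2 mul1r invfM mulrC. Qed.

Let mueE rho z mu0 : near_central K nu F rho (px z) (ps z) mu0 ->
  (nu + 1) * mue nu z = nu * mu0 + ptau z * pkappa z.
Proof.
move=> /near_central_dot xs; rewrite /mue xs mulrC divfK // gt_eqF //.
by move: nu0; lra.
Qed.

Let mue_gt0 rho z mu0 : near_central K nu F rho (px z) (ps z) mu0 ->
  0 < ptau z -> 0 < pkappa z -> 0 < mue nu z.
Proof.
move=> nc t0 k0; have := mueE nc; have m0 := near_central_mu_gt0 nc.
have := addr_gt0 (mulr_gt0 nu0 m0) (mulr_gt0 t0 k0) => h e.
by rewrite -e pmulr_rgt0 // in h; move: nu0; lra.
Qed.

Lemma neighbourhood_interior rho theta z : neighbourhood rho theta z -> cone_interior K z.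
Proof. by case=> mu0 [/(near_central_interior n0 pK bF)]. Qed.

Lemma neighbourhood_direction rho theta z zr rt rs : 0 <= rho -> rho <= 3 / 250 ->
  neighbourhood rho theta z -> exists d,
  direction A b c (scaling_matrix K nu F (px z) (ps z)) z (G A b c zr) rt rs d.
Proof.
move=> rho0 rho12 [mu0 [nc t0 k0 _]].
have [p [symW _ _ _ [_ WH _]]] := scaling_matrix_near_central n0 pK bF rho12 nc.
have [Kx _] := near_central_interior n0 pK bF nc.
have m0 := near_central_mu_gt0 nc.
apply: direction_exists t0 k0 => v v0.
apply: (scaling_posdef (hessian_psd pK bF Kx) m0 rho12 WH).
exact: (lnorm_gt0 pK bF Kx v0).
Qed.

Lemma predictor_step_exists z : predictor_ready z ->
  exists zp, predictor_step K nu F A b c alpha gamma z zp.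
Proof.
move=> rz.
have rho0 : 0 <= sg / 500 by move: sg sg0 => a; lra.
have rho12 : sg / 500 <= 3 / 250 by move: sg sg1 => a; lra.
(* Solvability requires a first right-hand side in the image of G; - G(z) is the image of - z. *)
have [daff haff] := neighbourhood_direction (- 1 *: z) (- (ptau z * pkappa z)) (- ps z)
  rho0 rho12 rz.
have [dcen hcen] := neighbourhood_direction z (mue nu z)
  (mue nu z *: stilde F (px z)) rho0 rho12 rz.
rewrite G_scale scaleN1r in haff.
exists (z + alpha *: (daff + gamma *: dcen)); split.
  exact: neighbourhood_interior rz.
by exists daff, dcen; split.
Qed.

Lemma predictor_step_spec z zp : predictor_ready z ->
  predictor_step K nu F A b c alpha gamma z zp ->
  [/\ corrector_ready zp, mue nu zp = ratio * mue nu z &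
    G A b c zp = ratio *: G A b c z].
Proof.
move=> [mu0 [nc t0 k0 tk]] [_ [daff [dcen [[Ga ta Wa] [Gc tc Wc] ->]]]].
have me0 := mue_gt0 nc t0 k0; have meE := mueE nc.
set me := mue nu z in tk tc Wc me0 meE *.
have dirW : scaling_matrix K nu F (px z) (ps z) *m (px daff + gamma *: px dcen) +
    (ps daff + gamma *: ps dcen) = - ps z + (9 / 10 * me) *: stilde F (px z).
  rewrite mulmxDr mulmxZr addrACA Wa -scalerDr Wc scalerA; reflexivity.
have dirt : ptau z * (pkappa daff + gamma * pkappa dcen) +
    pkappa z * (ptau daff + gamma * ptau dcen) = - (ptau z * pkappa z) + 9 / 10 * me.
  by rewrite -ta -tc; ring.
have Gd : G A b c ((daff + gamma *: dcen) + (1 / 10) *: z) = 0.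
  rewrite !G_add !G_scale Ga Gc; move: (G A b c z) => g.
  by apply/matrixP => i j; rewrite !mxE; field.
have skew := G_skew Gd.
have skew' : dot (px daff + gamma *: px dcen + (1 / 10) *: px z)
    (ps daff + gamma *: ps dcen + (1 / 10) *: ps z) +
  (ptau daff + gamma * ptau dcen + ptau z / 10) *
  (pkappa daff + gamma * pkappa dcen + pkappa z / 10) = 0.
  have t10 (a : R) : a / 10 = 1 / 10 * a by rewrite div1r mulrC.
  by rewrite (t10 (ptau z)) (t10 (pkappa z)); exact: skew.
have tk' : `|ptau z * pkappa z - me| <= me / 50 by rewrite -[50^-1]mul1r.
have [mp [ncp tp kp mepE tkp]] :=
  predictor_near n0 pK bF nc t0 k0 me0 meE tk' dirW dirt skew'.
set zq := z + _.
have ncp' : near_central K nu F (21 / 20 / 100 * sg) (px zq) (ps zq) mp.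
  by rewrite /zq alphaE.
have tE : ptau zq = ptau z + sg ^+ 2 / 100 * (ptau daff + gamma * ptau dcen).
  by rewrite /zq alphaE.
have kE : pkappa zq = pkappa z + sg ^+ 2 / 100 * (pkappa daff + gamma * pkappa dcen).
  by rewrite /zq alphaE.
have mE : mue nu zq = ratio * me.
  have np : nu + 1 != 0 by rewrite gt_eqF //; move: nu0; lra.
  by apply: (mulfI np); rewrite (mueE ncp') tE kE mepE.
split.
- by exists mp; split; rewrite ?mE ?tE ?kE.
- exact: mE.
- rewrite /zq !G_add G_scale !G_add G_scale Ga Gc alphaE.
  move: (G A b c z) (sg ^+ 2) => g q.
  by apply/matrixP => i j; rewrite !mxE; field.
Qed.

Lemma corrector_step_exists z : corrector_ready z ->
  exists zpp, corrector_step K nu F A b c z zpp.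
Proof.
move=> rz.
have rho0 : 0 <= 21 / 20 / 100 * sg by move: sg sg0 => a; lra.
have rho12 : 21 / 20 / 100 * sg <= 3 / 250 by move: sg sg0 sg1 => a a0 a1; lra.
have [d hd] := neighbourhood_direction 0 0
  (mu nu (px z) (ps z) *: stilde F (px z) - ps z) rho0 rho12 rz.
rewrite G0 in hd.
exists (z + d); split; first exact: neighbourhood_interior rz.
by exists d; split.
Qed.

Lemma corrector_step_spec z zpp : corrector_ready z ->
  corrector_step K nu F A b c z zpp ->
  [/\ predictor_ready zpp, mue nu zpp = mue nu z & G A b c zpp = G A b c z].
Proof.
move=> [mu0 [nc t0 k0 tk]] [_ [d [[Gd td Wd] ->]]].
have me0 := mue_gt0 nc t0 k0; have meE := mueE nc.
rewrite (mu_near_central n0 pK bF nc) in Wd.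
have [mp [ncp tp kp mepE tkp]] :=
  corrector_near n0 pK bF nc t0 k0 me0 meE tk Wd td (G_skew Gd).
have ncp' : near_central K nu F (sg / 500) (px (z + d)) (ps (z + d)) mp by exact: ncp.
have mE : mue nu (z + d) = mue nu z.
  have np : nu + 1 != 0 by rewrite gt_eqF //; move: nu0; lra.
  by apply: (mulfI np); rewrite (mueE ncp') mepE.
split.
- by exists mp; split; rewrite ?mE // div1r.
- exact: mE.
- by rewrite G_add Gd addr0.
Qed.

Lemma iteration_spec z zpp : predictor_ready z ->
  iteration K nu F A b c alpha gamma z zpp ->
  [/\ predictor_ready zpp, mue nu zpp = ratio * mue nu z &
    G A b c zpp = ratio *: G A b c z].
Proof.
move=> rz [zp [/(predictor_step_spec rz)[rp mp Gp] /(corrector_step_spec rp)[rpp mpp Gpp]]].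
by split; rewrite ?mpp ?Gpp.
Qed.

End Algorithm.

(** * Counting iterations *)

Lemma enormZ (R : realType) (n : nat) (a : R) (v : 'cV[R]_n) :
  enorm (a *: v) = `|a| * enorm v.
Proof. by rewrite /enorm dotZl dotZr mulrA -expr2 sqrtrM ?sqr_ge0 // sqrtr_sqr. Qed.

(** 1 - u <= exp(- u) with u = 1 / (T nu); the k-th power of the right side is at most eps as soon
    as k u >= ln (1 / eps). *)
Lemma geometric_decay (R : realType) (T nu eps : R) (k : nat) : 1 <= T -> 1 <= nu ->
  0 < eps -> T * nu * ln (1 / eps) <= k%:R -> (1 - nu^-1 / T) ^+ k <= eps.
Proof.
move=> T1 nu1 eps0 hk.
have q1 : 1 <= T * nu by nra.
have q0 : 0 < T * nu by lra.
have rE : 1 - nu^-1 / T = 1 - (T * nu)^-1 by rewrite invfM mulrC.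
have r0 : 0 <= 1 - (T * nu)^-1 by rewrite subr_ge0 invf_le1.
rewrite rE; apply: le_trans (_ : expR (- (T * nu)^-1) ^+ k <= _).
  by apply: lerXn2r; rewrite ?nnegrE ?expR_ge0 // expR_ge1Dx.
rewrite -expRM_natr -[leRHS]lnK ?posrE // ler_expR mulNr lerNl -lnV ?posrE //.
by rewrite mulrC ler_pdivlMr // mulrC -[eps^-1]mul1r.
Qed.

Theorem theorem3 (R : realType) :
  exists C : R, 0 < C /\
  forall (m n : nat) (K : set 'cV[R]_n) (nu : R) (F : 'cV[R]_n -> R)
    (A : 'M[R]_(m, n)) (b : 'cV[R]_m) (c : 'cV[R]_n) (z0 : hsd_point R m n),
  (0 < n)%N -> proper_cone K -> lhscb K nu F ->
  K° (px z0) -> (dual_cone K)° (ps z0) ->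
  px z0 = ps z0 -> ps z0 = - gradient F (px z0) ->
  - gradient F (px z0) = - gradient (conjugate K F) (ps z0) ->
  py z0 = 0 -> ptau z0 = 1 -> pkappa z0 = 1 ->
  let alpha : R := 1 / (100 * nu) in
  let gamma : R := 9 / 10 in
  never_stuck K nu F A b c alpha gamma z0 /\
  forall z : nat -> hsd_point R m n, is_run K nu F A b c alpha gamma z0 z ->
  forall eps : R, 0 < eps -> eps < 1 ->
  exists k : nat,
    [/\ k%:Z <= Num.ceil (C * nu * ln (1 / eps)),
        [/\ K (px (z k)), 0 <= ptau (z k), dual_cone K (ps (z k))
          & 0 <= pkappa (z k)],
        mue nu (z k) <= eps
      & enorm (G A b c (z k)) <= eps * enorm (G A b c z0)].
Proof.
(* 1 / (1000 nu) is the step length times 1 - 9/10, the relative decrease per iteration. *)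
have [T TE] : exists T : R, T = 1000 by eexists.
have T1 : 1 <= T by rewrite TE; lra.
have T0 : 0 < T by lra.
exists T; split=> // m n K nu F A b c z0 n0 pK bF Kx0 _ xs0 s0E _ _ t0 k0.
move=> alpha gamma.
have nu1 := barrier_parameter_ge1 pK bF n0.
have nu0 : 0 < nu by lra.
have xs : dot (px z0) (ps z0) = nu.
  by rewrite s0E dotNr dotC (dot_gradient_self bF Kx0) opprK.
have mue0 : mue nu z0 = 1.
  by rewrite /mue xs t0 k0 mulr1 divff // gt_eqF //; lra.
have sg2 : (Num.sqrt nu)^-1 ^+ 2 = nu^-1 by rewrite exprVn sqr_sqrtr // ltW.
have r0 : predictor_ready K nu F z0.
  exists 1; rewrite t0 k0 mue0; split.
  (* The starting point lies exactly on the central path: y = x_0 and mu = 1. *)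
  - exists (px z0); split; rewrite ?scale1r ?mulr1 //; split=> //.
    rewrite subrr lnorm0; have := sqrtr_ge0 nu; rewrite -invr_ge0.
    by move: (Num.sqrt nu)^-1 => a; lra.
  - exact: ltr01.
  - exact: ltr01.
  - by rewrite mulr1 subrr normr0 mul1r; lra.
split.
  move=> k z itz; have rz : predictor_ready K nu F z.
    elim: k z itz => [z ->//|k IH z [z' /IH rz' /(iteration_spec n0 pK bF rz')[]]] //.
  split; first exact: (predictor_step_exists A b c n0 pK bF rz).
  move=> zp /(predictor_step_spec n0 pK bF rz)[rzp _ _].
  exact: (corrector_step_exists A b c n0 pK bF rzp).
move=> z [z00 run] eps eps0 eps1.
have inv k : [/\ predictor_ready K nu F (z k), mue nu (z k) = (1 - nu^-1 / T) ^+ k &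
    G A b c (z k) = (1 - nu^-1 / T) ^+ k *: G A b c z0].
  elim: k => [|k [rk mk Gk]]; first by rewrite z00 expr0 scale1r.
  have [rk1 mk1 Gk1] := iteration_spec n0 pK bF rk (run k).
  rewrite sg2 -TE mk in mk1; rewrite sg2 -TE Gk scalerA in Gk1.
  by split; [exact: rk1|rewrite exprS|rewrite exprS].
have l0 : 0 < ln (1 / eps) by rewrite ln_gt0 // ltr_pdivlMr // mul1r.
have x0 : 0 <= T * nu * ln (1 / eps) by rewrite !mulr_ge0 // ltW.
have ceil0 : 0 <= Num.ceil (T * nu * ln (1 / eps)).
  by rewrite -(ler0z R); exact: le_trans x0 (ceil_ge _).
exists `|Num.ceil (T * nu * ln (1 / eps))|%N.
set k := `|_|%N.
have kE : k%:Z = Num.ceil (T * nu * ln (1 / eps)) by rewrite gez0_abs.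
have dec : (1 - nu^-1 / T) ^+ k <= eps.
  apply: geometric_decay => //; rewrite -[k%:R]/(k%:Z%:~R) kE; exact: ceil_ge.
have [[mu0 [nc tk kk _]] mk Gk] := inv k.
have [Kx Ks] := near_central_interior n0 pK bF nc.
have rho0 : 0 <= (1 - nu^-1 / T) ^+ k.
  apply: exprn_ge0; have h1 : nu^-1 <= 1 by rewrite invf_le1.
  rewrite subr_ge0 (ler_pdivrMr _ _ T0) mul1r; exact: le_trans h1 T1.
split.
- by rewrite kE.
- by split; [exact: interior_subset|exact: ltW|exact: interior_subset|exact: ltW].
- by rewrite mk.
- by rewrite Gk enormZ ger0_norm // ler_wpM2r // sqrtr_ge0.
Qed.
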